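(* Let $T$ be an $\omega$-Calderón-Zygmund operator on $\mathbb{R}^n$ with $\omega$ satisfying the Dini condition, and let $b\in L^1_{\mathrm{loc}}(\mathbb{R}^n)$. For every compactly supported $f\in L^\infty(\mathbb{R}^n)$, there exist $3^n$ dyadic lattices $\mathscr{D}^{(j)}$, $j=1,\dots,3^n$, and $\frac{1}{2\cdot 9^n}$-sparse families $\mathcal{S}_j\subset\mathscr{D}^{(j)}$ such that for a.e. $x\in\mathbb{R}^n$, $$|[b,T]f(x)|\le c_nC_T\sum_{j=1}^{3^n}\big(\mathcal{T}_{\mathcal{S}_j,b}|f|(x)+\mathcal{T}^{\star}_{\mathcal{S}_j,b}|f|(x)\big),$$ where $c_n$ is a constant depending only on $n$.
   Context: Calderón-Zygmund operators: let $\omega:[0,1]\to[0,\infty)$ be continuous, increasing, subadditive with $\omega(0)=0$. An $\omega$-Calderón-Zygmund operator $T$ on $\mathbb{R}^n$ is a linear operator bounded on $L^2(\mathbb{R}^n)$ and represented as $Tf(x)=\int_{\mathbb{R}^n}K(x,y)f(y)\,dy$ for all $x\notin\operatorname{supp} f$, with kernel $K$ satisfying $|K(x,y)|\le \frac{C_K}{|x-y|^n}$ for $x\neq y$ and $$|K(x,y)-K(x',y)|+|K(y,x)-K(y,x')|\le\omega\left(\frac{|x-x'|}{|x-y|}\right)\frac{1}{|x-y|^n}\quad\text{for }|x-y|>2|x-x'|.$$ The Dini condition is $[\omega]_{\mathrm{Dini}}=\int_0^1\omega(t)\frac{dt}{t}<\infty$. Put $C_T=\|T\|_{L^2\to L^2}+C_K+[\omega]_{\mathrm{Dini}}$.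 Under the Dini condition $T$ is of weak type $(1,1)$ and is understood as extended to $L^1$. The commutator is $[b,T]f(x)=b(x)Tf(x)-T(bf)(x)$. Cubes and lattices: a cube is a half-open cube $Q=\prod_{i=1}^n[a_i,a_i+h)$, $h>0$. $\mathcal{D}(Q)$ denotes the set of dyadic cubes with respect to $Q$, i.e. the cubes obtained by repeated subdivision of $Q$ and each of its descendants into $2^n$ congruent subcubes (the children). A dyadic lattice $\mathscr{D}$ in $\mathbb{R}^n$ is any collection of cubes such that (i) if $Q\in\mathscr{D}$, then each child of $Q$ is in $\mathscr{D}$; (ii) every two cubes $Q',Q''\in\mathscr{D}$ have a common ancestor, i.e. there is $Q\in\mathscr{D}$ with $Q',Q''\in\mathcal{D}(Q)$; (iii) for every compact set $K\subset\mathbb{R}^n$ there is a cube $Q\in\mathscr{D}$ containing $K$. A family $\mathcal{S}\subset\mathscr{D}$ is $\eta$-sparse, $0<\eta<1$, if for every $Q\in\mathcal{S}$ there is a measurable set $E_Q\subset Q$ with $|E_Q|\ge\eta|Q|$, and the sets $\{E_Q\}_{Q\in\mathcal{S}}$ are pairwise disjoint. Sparse operators: with $f_Q=\frac{1}{|Q|}\int_Qf$, $$\mathcal{T}_{\mathcal{S},b}f(x)=\sum_{Q\in\mathcal{S}}|b(x)-b_Q|f_Q\chi_Q(x),\qquad \mathcal{T}^{\star}_{\mathcal{S},b}f(x)=\sum_{Q\in\mathcal{S}}\left(\frac{1}{|Q|}\int_Q|b-b_Q|f\right)\chi_Q(x).$$ *)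

(* Defs.v *)
From HB Require Import structures.
From mathcomp Require Import all_boot all_order all_algebra.
From mathcomp Require Import all_classical all_reals all_analysis.

Set Implicit Arguments.
Unset Strict Implicit.
Unset Printing Implicit Defensive.

Import Order.TTheory GRing.Theory Num.Theory.
Import numFieldNormedType.Exports.

Local Open Scope classical_set_scope.
Local Open Scope ring_scope.

(* R^n is 'rV[R]_n, with its matrix topology and the Borel sigma-algebra,
   generated here by the coordinate functions as for n.-tuple R. *)

Section measurable_rV.
Context {R : realType} (n : nat).

Definition rVcoord (i : 'I_n) (x : 'rV[R]_n) : measurableTypeR R := x 0 i.

Let rV_set0 : g_sigma_preimage rVcoord set0.
Proof. exact: sigma_algebra0. Qed.

Let rV_setC A : g_sigma_preimage rVcoord A -> g_sigma_preimage rVcoord (~` A).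
Proof. exact: sigma_algebraC. Qed.

Let rV_bigcup (F : (set 'rV[R]_n)^nat) :
  (forall i, g_sigma_preimage rVcoord (F i)) ->
  g_sigma_preimage rVcoord (\bigcup_i (F i)).
Proof. exact: sigma_algebra_bigcup. Qed.

HB.instance Definition _ := @isMeasurable.Build default_measure_display
  'rV[R]_n (g_sigma_preimage rVcoord) rV_set0 rV_setC rV_bigcup.

End measurable_rV.

Lemma measurable_rVcoord {R : realType} n (i : 'I_n) :
  measurable_fun [set: 'rV[R]_n] (rVcoord i).
Proof.
move=> _ Y mY; rewrite setTI; apply: sub_sigma_algebra => /=.
rewrite -bigcup_seq/=; exists i => /=; first by rewrite mem_index_enum.
by exists Y => //; rewrite setTI.
Qed.

Lemma measurable_fun_rVcoordP {R : realType} n d (T : measurableType d)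
    (f : T -> 'rV[R]_n) :
  measurable_fun [set: T] f <->
  forall i, measurable_fun [set: T] (rVcoord i \o f).
Proof.
split=> [mf i|mf].
  by apply: measurableT_comp => //; exact: measurable_rVcoord.
move=> _ A mA; rewrite setTI.
have : preimage_set_system setT f (g_sigma_preimage (@rVcoord R n)) (f @^-1` A).
  by exists A => //; rewrite setTI.
rewrite -g_sigma_preimage_comp; move: (f @^-1` A).
apply: smallest_sub; first exact: sigma_algebra_measurable.
rewrite -bigcup_seq /=; apply: bigcup_sub => i _ B [C mC <-].
exact: mf.
Qed.

Section rVcons.
Context {R : realType} (n : nat).

Definition rVcons (p : measurableTypeR R * 'rV[R]_n) : 'rV[R]_n.+1 :=
  \row_i oapp (p.2 0) p.1 (unlift ord0 i).

Definition rVuncons (x : 'rV[R]_n.+1) : measurableTypeR R * 'rV[R]_n :=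
  (x 0 ord0, \row_j x 0 (lift ord0 j)).

Lemma rVconsK : cancel rVcons rVuncons.
Proof.
move=> [r v]; rewrite /rVuncons/= mxE unlift_none/=; congr pair.
by apply/rowP => j; rewrite !mxE liftK.
Qed.

Lemma measurable_rVcons : measurable_fun setT rVcons.
Proof.
apply/measurable_fun_rVcoordP => i; case: (unliftP ord0 i) => [j|] ->.
  rewrite (_ : _ \o _ = rVcoord j \o snd).
    by apply: measurableT_comp => //; exact: measurable_rVcoord.
  by apply/funext => p; rewrite /rVcoord/= mxE liftK.
rewrite (_ : _ \o _ = fst)//.
by apply/funext => p; rewrite /rVcoord/= mxE unlift_none.
Qed.

Lemma measurable_rVuncons : measurable_fun setT rVuncons.
Proof.
apply: measurable_fun_pair; first exact: (measurable_rVcoord ord0).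
apply/measurable_fun_rVcoordP => i.
rewrite (_ : _ \o _ = rVcoord (lift ord0 i)); first exact: measurable_rVcoord.
by apply/funext => p; rewrite /rVcoord/= mxE.
Qed.

End rVcons.

Section lebesgue_step.
Context {R : realType} (n : nat).
Variable m : {sigma_finite_measure set 'rV[R]_n -> \bar R}.

Definition lebesgue_step : set 'rV[R]_n.+1 -> \bar R :=
  pushforward (lebesgue_measure \x m)%E (@rVcons R n).

Let lebesgue_step0 : lebesgue_step set0 = 0%E.
Proof. by rewrite /lebesgue_step /pushforward preimage_set0 measure0. Qed.

Let lebesgue_step_ge0 A : (0 <= lebesgue_step A)%E.
Proof. by rewrite /lebesgue_step /pushforward; exact: measure_ge0. Qed.

Let lebesgue_step_sigma_additive : semi_sigma_additive lebesgue_step.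
Proof.
move=> F mF tF mUF; rewrite /lebesgue_step /pushforward preimage_bigcup.
apply: measure_semi_sigma_additive.
- by move=> k; rewrite -[X in measurable X]setTI; exact: measurable_rVcons.
- apply/trivIsetP => /= i j _ _ ij; rewrite -preimage_setI.
  by move/trivIsetP : tF => /(_ _ _ _ _ ij) ->//; rewrite preimage_set0.
- rewrite -preimage_bigcup -[X in measurable X]setTI.
  exact: measurable_rVcons.
Qed.

HB.instance Definition _ := isMeasure.Build _ _ _ lebesgue_step
  lebesgue_step0 lebesgue_step_ge0 lebesgue_step_sigma_additive.

Let lebesgue_step_sigma_finite : sigma_finite setT lebesgue_step.
Proof.
have /sigma_finiteP[F [TF ndF Foo]] := sigma_finiteT (@lebesgue_measure R).
have /sigma_finiteP[G [TG ndG Goo]] := sigma_finiteT m.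
exists (fun k => @rVuncons R n @^-1` (F k `*` G k)).
  rewrite -preimage_bigcup -(preimage_setT (@rVuncons R n)); congr (_ @^-1` _).
  rewrite -setXTT TF TG predeqE => -[x y]; split.
    move=> [/= [k _ Fkx] [l _ Gly]]; exists (maxn k l) => //; split.
    - by move: x Fkx; exact/subsetPset/ndF/leq_maxl.
    - by move: y Gly; exact/subsetPset/ndG/leq_maxr.
  by move=> [k _ []/= ? ?]; split; exists k.
move=> k; have [mF Fk] := Foo k; have [mG Gk] := Goo k; split.
  rewrite -[X in measurable X]setTI; apply: measurable_rVuncons => //.
  exact: measurableX.
rewrite /lebesgue_step /pushforward -comp_preimage.
rewrite (_ : @rVuncons R n \o @rVcons R n = id); last first.
  by apply/funext => p; exact: rVconsK.
rewrite preimage_id.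
by rewrite product_measure1E// lte_mul_pinfty// ge0_fin_numE.
Qed.

HB.instance Definition _ := Measure_isSigmaFinite.Build _ _ _ lebesgue_step
  lebesgue_step_sigma_finite.

End lebesgue_step.

(* The n-fold product of the Lebesgue measure on R; see lebesgue_rV_cube. *)
Fixpoint lebesgue_rV (R : realType) (n : nat) :
    {sigma_finite_measure set 'rV[R]_n -> \bar R} :=
  match n with
  | 0 => \d_(0 : 'rV[R]_0)
  | m.+1 => lebesgue_step (lebesgue_rV R m)
  end.

Section cubes.
Context {R : realType} {n : nat}.
Implicit Types (a : 'rV[R]_n) (h : R) (Q : set 'rV[R]_n).

Definition cube a h : set 'rV[R]_n :=
  [set x | forall i, a 0 i <= x 0 i < a 0 i + h].

Definition is_cube Q := exists a h, 0 < h /\ Q = cube a h.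

(* A child of cube a h has side h / 2 and corner a + (h / 2) e, where e is one
   of the 2 ^ n vectors with coordinates 0 or 1. *)
Definition child Q Q' := exists a h (e : 'I_n -> bool),
  [/\ 0 < h, Q = cube a h &
      Q' = cube (a + (h / 2) *: \row_i (e i)%:R) (h / 2)].

Inductive dyadic Q : set (set 'rV[R]_n) :=
| dyadic_self : is_cube Q -> dyadic Q Q
| dyadic_child Q' Q'' : dyadic Q Q' -> child Q' Q'' -> dyadic Q Q''.

Definition dyadic_lattice (D : set (set 'rV[R]_n)) :=
  [/\ D `<=` is_cube,
      forall Q Q', D Q -> child Q Q' -> D Q',
      forall Q' Q'', D Q' -> D Q'' ->
        exists Q, [/\ D Q, dyadic Q Q' & dyadic Q Q''] &
      forall K, compact K -> exists Q, D Q /\ K `<=` Q].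

Definition sparse (eta : R) (S : set (set 'rV[R]_n)) :=
  exists E : set 'rV[R]_n -> set 'rV[R]_n,
    (forall Q, S Q -> [/\ measurable (E Q), E Q `<=` Q &
       (eta%:E * lebesgue_rV R n Q <= lebesgue_rV R n (E Q))%E]) /\
    trivIset S E.

End cubes.

Lemma cube_rVcons {R : realType} n (a : 'rV[R]_n.+1) h :
  @rVcons R n @^-1` cube a h =
  `[(rVuncons a).1, (rVuncons a).1 + h[ `*` cube (rVuncons a).2 h.
Proof.
apply/seteqP; split => -[r v] /=.
  move=> H; split => /=.
    by have := H ord0; rewrite /rVcons mxE unlift_none /= in_itv.
  move=> i; have := H (lift ord0 i); rewrite /rVcons mxE liftK /=.
  by rewrite /rVuncons/= !mxE.
move=> [/=]; rewrite in_itv/= => H0 H1 i; rewrite /rVcons mxE.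
case: (unliftP ord0 i) => [j|] -> //=.
by have := H1 j; rewrite /rVuncons/= !mxE.
Qed.

Lemma measurable_cube {R : realType} n (a : 'rV[R]_n) h : measurable (cube a h).
Proof.
rewrite (_ : cube a h = \bigcap_(i in [set: 'I_n])
    (rVcoord i @^-1` `[a 0 i, a 0 i + h[)).
  apply: fin_bigcap_measurable => // i _.
  by rewrite -[X in measurable X]setTI; exact: measurable_rVcoord.
apply/seteqP; split => x /=.
  by move=> H i _; have := H i; rewrite /= in_itv.
by move=> H i; have := H i I; rewrite /= in_itv.
Qed.

Lemma lebesgue_rV_cube {R : realType} n (a : 'rV[R]_n) h : 0 <= h ->
  lebesgue_rV R n (cube a h) = (h ^+ n)%:E.
Proof.
move=> h0; elim: n a => [|n IH] a.
  by rewrite expr0 /= diracE mem_set// => -[].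
rewrite /= /lebesgue_step /pushforward cube_rVcons product_measure1E//.
- rewrite [X in (_ * X)%E]IH /= lebesgue_measure_itv/= lte_fin exprS.
  have [_|hN] := ltP (a 0 ord0) (a 0 ord0 + h).
    by rewrite -EFinB addrAC subrr add0r -EFinM.
  have -> : h = 0 by apply/eqP; rewrite eq_le h0 andbT -(gerDl (a 0 ord0)).
  by rewrite mul0e mul0r.
- exact: measurable_cube.
Qed.

Section functions_on_Rn.
Context {R : realType} {n : nat}.
Implicit Types f g b : 'rV[R]_n -> R.

Local Notation mu := (lebesgue_rV R n).

(* The Euclidean norm; the library norm on 'rV[R]_n is the sup norm. *)
Definition enorm (x : 'rV[R]_n) : R := Num.sqrt (\sum_i x 0 i ^+ 2).

Definition supp f : set 'rV[R]_n := closure [set x | f x != 0].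

Definition locally_integrable_rV f := measurable_fun setT f /\
  forall K, compact K -> (\int[mu]_(x in K) `|f x|%:E < +oo)%E.

(* Real-valued: only used for functions that are integrable on the cube Q. *)
Definition average f (Q : set 'rV[R]_n) : R :=
  (\int[mu]_(x in Q) f x) / fine (mu Q).

End functions_on_Rn.

Section calderon_zygmund.
Context {R : realType} {n : nat}.
Implicit Types (omega : R -> R) (K : 'rV[R]_n -> 'rV[R]_n -> R) (CK : R).
Implicit Types f g b : 'rV[R]_n -> R.
Implicit Types T : ('rV[R]_n -> R) -> ('rV[R]_n -> R).

Local Notation mu := (lebesgue_rV R n).

Definition modulus_of_continuity omega :=
  [/\ {within `[0, 1], continuous omega},
      {in `[0, 1] &, {homo omega : s t / s <= t}},
      forall s t, 0 <= s -> 0 <= t -> s + t <= 1 ->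
        omega (s + t) <= omega s + omega t,
      omega 0 = 0 &
      {in `[0, 1], forall t, 0 <= omega t}].

Definition dini omega : \bar R :=
  (\int[lebesgue_measure]_(t in `]0%R, 1%R]) (omega t / t)%:E)%E.

Definition cz_kernel omega CK K :=
  (forall x y, x != y -> `|K x y| <= CK / enorm (x - y) ^+ n) /\
  (forall x x' y, 2 * enorm (x - x') < enorm (x - y) ->
    `|K x y - K x' y| + `|K y x - K y x'| <=
    omega (enorm (x - x') / enorm (x - y)) / enorm (x - y) ^+ n).

(* An operator on L^2 acts on representatives; only its values on L^2, up to
   almost everywhere equality, are constrained.  Linearity and boundedness make
   it compatible with almost everywhere equality. *)
Definition bounded_linear_L2 T :=
  [/\ forall f, f \in Lfun mu 2%:E -> T f \in Lfun mu 2%:E,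
      forall (c : R) f g, f \in Lfun mu 2%:E -> g \in Lfun mu 2%:E ->
        {ae mu, forall x, T (fun y => c * f y + g y) x = c * T f x + T g x} &
      exists A : R, forall f, f \in Lfun mu 2%:E ->
        ('N[mu]_2%:E[EFin \o T f] <= A%:E * 'N[mu]_2%:E[EFin \o f])%E].

Definition opnorm_L2 T : \bar R :=
  ereal_sup [set 'N[mu]_2%:E[EFin \o T f]%E | f in
    [set f | f \in Lfun mu 2%:E /\ ('N[mu]_2%:E[EFin \o f] <= 1)%E]].

Definition cz_operator omega CK K T :=
  [/\ bounded_linear_L2 T, cz_kernel omega CK K &
      forall f, f \in Lfun mu 2%:E -> {ae mu, forall x, ~ supp f x ->
        T f x = \int[mu]_y (K x y * f y)}].

Definition cz_constant omega CK T : \bar R :=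
  (opnorm_L2 T + CK%:E + dini omega)%E.

(* The values on L^1 of an operator of weak type (1, 1) given on L^2: the limit
   in measure of T (u k), for any u k in L^1 and L^2 converging to f in L^1.
   It is unique almost everywhere, and L1_extension selects a representative;
   the default value 0 is only reached when there is no such limit. *)
Definition L1_value T f g := measurable_fun setT g /\
  forall u : nat -> 'rV[R]_n -> R,
    (forall k, u k \in Lfun mu 1%E /\ u k \in Lfun mu 2%:E) ->
    (fun k => 'N[mu]_1[EFin \o (u k \- f)%R]%E) @ \oo --> 0%E ->
    forall e, 0 < e ->
      (fun k => mu [set x | (e < `|T (u k) x - g x|)%R]) @ \oo --> 0%E.

Definition L1_extension T f : 'rV[R]_n -> R := xget (cst 0) (L1_value T f).

Definition commutator b T f : 'rV[R]_n -> R :=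
  fun x => b x * T f x - T (fun y => b y * f y) x.

Definition sparse_op (S : set (set 'rV[R]_n)) b f x : \bar R :=
  (\esum_(Q in S) (`|b x - average b Q| * average f Q * \1_Q x)%:E)%E.

Definition sparse_op_star (S : set (set 'rV[R]_n)) b f x : \bar R :=
  (\esum_(Q in S)
     (average (fun y => (`|b y - average b Q| * f y)%R) Q * \1_Q x)%:E)%E.

End calderon_zygmund.

(* Main.v *)
From HB Require Import structures.
Require Import Defs.
From mathcomp Require Import all_boot all_order all_algebra.
From mathcomp Require Import all_classical all_reals all_analysis.
From mathcomp Require Import measurable_realfun ess_sup_inf.
From mathcomp Require Import zify ring lra.

(** The theorem is an instance of sparse domination by stopping times.  Write T1
for the extension of T to L^1, 3P for the cube with the centre of P and three
times its side, and [b, T1] for the commutator.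

Two properties of T1 carry everything (they are collected in [weak_osc]): it
is of weak type (1, 1), and, if h vanishes on 3P and the averages of |h| over
the triples of all dyadic ancestors of P are at most B, then T1 h varies by at
most C B on P.  The first is the Calderon-Zygmund decomposition
([weak_type_stopping]); the second sums the regularity of the kernel over the
annuli between consecutive tripled ancestors, where the Dini condition bounds
the sum ([integral_majorant_le], [kernel_osc]).  Both are proved for L^2
functions or for kernel integrals, and reach L^1 by truncation and convergence
in measure ([L1_extensionP], [T1_weak], [T1_kernel]).

These two properties replace a maximal operator of truncations.  For g
supported in 3Q there is a set E, of measure at most a small multiple of |Q|,
outside which T1 g and the maximal function of g are at most a constant times
the average of |g| over 3Q.  Let P be a cube of which E covers at most half.
Splitting g at 3P, some point of P outside E satisfies the same bound for the
far part g 1_(R^n \ 3P), since the near part is controlled by the weak type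
inequality on the rest of P; the oscillation property then carries the bound
from this point to almost all of P ([good_set]).

Apply this to g = f and to g = (b - c) f on 3Q, c being the average of b over
3Q, and let the P_i be the maximal dyadic cubes in which E has density above
2^-(n+1).  Their total volume is at most |Q| / 2.  Almost everywhere on Q
outside them, and for the passage from [b, T1] (f 1_3Q) to
[b, T1] (f 1_3P_i) on P_i, the identity
  [b, T1] h = (b - c) T1 h - T1 ((b - c) h)
costs at most a constant times
  |b - c| (average of |f| on 3Q) + (average of |b - c| |f| on 3Q),
which is the summand of the two sparse operators at 3Q ([sparse_step]).
Iterating produces a family in which each Q keeps half of its volume, and
almost every point lies in finitely many of its cubes, so the errors add up to
a finite sum ([sparse_family]).  The recursion starts from a partition of R^n
into cubes whose triples all contain the support of f ([tower]).

Finally the triples of the cubes of one dyadic grid split into 3^n dyadic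
lattices ([dyadic_lattice_tlattice]), and half of Q is at least 1 / (2 9^n) of
3Q ([sparse_tfamily]).  The grid is shifted alternately by a third of the side
so that each bounded set lies in a single cube of every large generation;
hence no orthant has to be treated apart. *)

Set Implicit Arguments.
Unset Strict Implicit.
Unset Printing Implicit Defensive.

Import Order.TTheory GRing.Theory Num.Theory.
Import numFieldNormedType.Exports.

Local Open Scope classical_set_scope.
Local Open Scope ring_scope.

(** * A dyadic grid without boundary at the origin *)

(** The parity sign of a generation, by which the shift of the grid alternates:
only with alternating shifts are consecutive generations nested, because
2 * (1 / 3) = 1 - 1 / 3. *)
Definition grid_sign (k : int) : int := if odd `|k|%N then -1 else 1.

Lemma grid_signS k : grid_sign (k + 1) = - grid_sign k.
Proof.
rewrite /grid_sign; case: k => m.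
  have -> : `|(Posz m + 1)%R|%N = m.+1 by lia.
  by rewrite /=; case: odd; rewrite ?opprK.
have -> : `|(Negz m + 1)%R|%N = m by lia.
have -> : `|Negz m|%N = m.+1 by lia.
by rewrite /=; case: odd; rewrite ?opprK.
Qed.

Lemma grid_sign_cases k : grid_sign k = 1 \/ grid_sign k = -1.
Proof. by rewrite /grid_sign; case: odd; [right|left]. Qed.

Lemma scale_itv (R : realFieldType) (s t a : R) : 0 < s ->
  (s * a <= t * s < s * a + s) = (a <= t < a + 1).
Proof.
move=> s0; have -> : s * a + s = (a + 1) * s by ring.
by rewrite mulrC ler_pM2r// ltr_pM2r.
Qed.

Section grid.
Context {R : realType} {n : nat}.
Implicit Types (k : int) (m p q : {ffun 'I_n -> int}) (x y : 'rV[R]_n).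

Definition side k : R := 2 ^ k.

Lemma side_gt0 k : 0 < side k.
Proof. by rewrite exprz_gt0. Qed.

Lemma side_ge0 k : 0 <= side k.
Proof. exact/ltW/side_gt0. Qed.

Lemma side_neq0 k : side k != 0.
Proof. by rewrite gt_eqF// side_gt0. Qed.

Lemma sideS k : side (k + 1) = 2 * side k.
Proof. by rewrite /side exprzDr ?unitfE// expr1z mulrC. Qed.

Lemma sideD k (j : nat) : side (k + j%:Z) = 2 ^+ j * side k.
Proof. by rewrite /side exprzDr ?unitfE// mulrC. Qed.

(** The grid cube of generation k and index m has side 2 ^ k and is shifted by
a third of its side.  The origin then sits at distance at least 2 ^ k / 3 from
the faces of the cube that contains it, so the cubes around the origin exhaust
the space. *)
Definition grid_corner k m : 'rV[R]_n :=
  \row_i (side k * ((m i)%:~R + (grid_sign k)%:~R / 3)).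

Definition grid_cube (w : nat) k m : set 'rV[R]_n :=
  cube (grid_corner k m) (w%:R * side k).

Definition dcube k m := grid_cube 1 k m.

(** The triple of a grid cube, that is, the union of the cube and its
neighbours in its generation. *)
Definition tcube k m := grid_cube 3 k [ffun i => m i - 1].

(** The index of the cube of generation k that contains x.  Membership in grid
cubes and their triples becomes integer arithmetic on indices
([dcubeP], [tcubeP]). *)
Definition idx k x : {ffun 'I_n -> int} :=
  [ffun i => Num.floor (x 0 i / side k - (grid_sign k)%:~R / 3)].

Lemma idxP k x i (a : int) : idx k x i = a <->
  side k * (a%:~R + (grid_sign k)%:~R / 3) <= x 0 i <
  side k * (a%:~R + (grid_sign k)%:~R / 3) + side k.
Proof.
rewrite ffunE; have s0 := side_gt0 k.
have -> : x 0 i = (x 0 i / side k) * side k by rewrite divfK// side_neq0.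
rewrite mulfK ?side_neq0//; move: (x 0 i / side k) => t; split.
  move=> <-; have := floor_itv (t - (grid_sign k)%:~R / 3).
  by rewrite intrD scale_itv// => /andP[h1 h2]; apply/andP; split; lra.
rewrite scale_itv// => /andP[h1 h2].
by apply: floor_def; rewrite intrD; apply/andP; split; lra.
Qed.

Lemma idx_itv k x i :
  side k * ((idx k x i)%:~R + (grid_sign k)%:~R / 3) <= x 0 i <
  side k * ((idx k x i)%:~R + (grid_sign k)%:~R / 3) + side k.
Proof. by apply/idxP. Qed.

Lemma grid_cubeP w k m x :
  grid_cube w k m x <-> forall i, (m i <= idx k x i < m i + w%:Z)%R.
Proof.
have s0 := side_gt0 k.
rewrite /grid_cube /cube/=; split=> h i; move: (h i);
  have /andP[] := idx_itv k x i; rewrite ?mxE;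
  move: (idx k x i) (m i) => a b h1 h2 /andP[h3 h4].
  have {}h3 := le_lt_trans h3 h2.
  have {}h4 := le_lt_trans h1 h4.
  rewrite -[X in _ < _ + X](mulr1) -mulrDr ltr_pM2l// in h3.
  rewrite [w%:R * _]mulrC -mulrDr ltr_pM2l// in h4.
  have h5 : b%:~R < (a + 1)%:~R :> R by rewrite intrD; lra.
  have h6 : a%:~R < (b + w%:Z)%:~R :> R by rewrite intrD; lra.
  rewrite ltr_int in h5; rewrite ltr_int in h6; lia.
apply/andP; split.
  apply: le_trans h1; rewrite ler_pM2l//.
  by have : b%:~R <= a%:~R :> R; [rewrite ler_int|lra].
apply: (lt_le_trans h2).
rewrite [w%:R * _]mulrC -[X in _ + X <= _](mulr1) -!mulrDr ler_pM2l//.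
have : (a + 1)%:~R <= (b + w%:Z)%:~R :> R; first by rewrite ler_int; lia.
rewrite !intrD; lra.
Qed.

Lemma dcubeP k m x : dcube k m x <-> idx k x = m.
Proof.
rewrite /dcube grid_cubeP; split=> [h|<- i]; last by lia.
by apply/ffunP => i; move: (h i); move: (idx k x i) (m i) => a b; lia.
Qed.

Lemma dcube_idx k x : dcube k (idx k x) x.
Proof. exact/dcubeP. Qed.

Lemma tcubeP k m x :
  tcube k m x <-> forall i, (m i - 1 <= idx k x i <= m i + 1)%R.
Proof. by rewrite /tcube grid_cubeP; split=> h i; move: (h i);
  rewrite ?ffunE; move: (Num.floor _) (m i) => a b; lia. Qed.

Lemma dcube_sub_tcube k m : dcube k m `<=` tcube k m.
Proof. by move=> x /dcubeP <-; apply/tcubeP => i; move: (idx k x i) => a; lia. Qed.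

(** The index of the parent depends on the index of the child only, which is
what makes the generations nested. *)
Lemma idxS k x i : idx (k + 1) x i = ((idx k x i + grid_sign k) %/ 2)%Z.
Proof.
apply/idxP; have s0 := side_gt0 k.
have /andP[] := idx_itv k x i.
set a := idx k x i; set q := ((a + grid_sign k) %/ 2)%Z.
have [h1 h2] : q + q <= a + grid_sign k /\ a + grid_sign k <= q + q + 1 by rewrite /q; lia.
have {}h1 : q%:~R + q%:~R <= a%:~R + (grid_sign k)%:~R :> R by rewrite -!intrD ler_int.
have {}h2 : a%:~R + (grid_sign k)%:~R <= q%:~R + q%:~R + 1 :> R.
  by rewrite -[1 in X in _ <= X]/(1%:~R) -!intrD ler_int.
rewrite sideS grid_signS rmorphN/=.
move: h1 h2; move: (side k) s0 ((grid_sign k)%:~R : R) (q%:~R : R) (a%:~R : R).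
move=> s s0 e Q A h1 h2 h3 h4.
have p1 : 0 <= s * (A + e - (Q + Q)) by apply: mulr_ge0; [exact: ltW|lra].
have p2 : 0 <= s * (Q + Q + 1 - A - e) by apply: mulr_ge0; [exact: ltW|lra].
apply/andP; split; lra.
Qed.

Lemma idx_anc k x y (j : nat) : idx k x = idx k y ->
  idx (k + j%:Z) x = idx (k + j%:Z) y.
Proof.
move=> h; elim: j => [|j IH]; first by rewrite addr0.
apply/ffunP => i; have -> : k + j.+1%:Z = k + j%:Z + 1 by lia.
by rewrite !idxS IH.
Qed.

(** A ball around the origin lies in one cube of each large generation. *)
Lemma idx_near0 k x i : `|x 0 i| < side k / 3 ->
  idx k x i = if grid_sign k == 1 then -1 else 0.
Proof.
rewrite ltr_norml => /andP[h1 h2]; apply/idxP; have s0 := side_gt0 k.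
case: (grid_sign_cases k) => ->/=; apply/andP; split; rewrite ?rmorphN/=; lra.
Qed.

Lemma exists_side (M : R) : exists k0 : int, forall k, k0 <= k -> M < side k / 3.
Proof.
exists (Num.trunc (3 * `|M|)).+1%:Z => k hk.
have h : 3 * `|M| < side k.
  have h0 : 0 <= 3 * `|M| by rewrite mulr_ge0.
  have h1 := truncnS_gt (3 * `|M|).
  apply: (lt_le_trans h1).
  apply: (@le_trans _ _ (2 ^ (Num.trunc (3 * `|M|)).+1%:Z)).
    by rewrite -exprnP -natrX ler_nat ltnW// ltn_expl.
  by rewrite ler_weXz2l// ler1n.
have := ler_norm M; lra.
Qed.

Lemma norm_coord x i : `|x 0 i| <= `|x|.
Proof.
rewrite [X in _ <= X]/Num.norm/= mx_normrE.
by rewrite (le_trans _ (le_bigmax _ _ (0, i))).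
Qed.

(** Any two points have a common cube: this would fail for the standard grid,
where points of different orthants never meet. *)
Lemma idx_cofinal x y : exists k0, forall k, k0 <= k -> idx k x = idx k y.
Proof.
have [k0 h] := exists_side (Num.max `|x| `|y|).
exists k0 => k /h; rewrite gt_max => /andP[hx hy].
apply/ffunP => i; rewrite !idx_near0//.
  by apply: le_lt_trans hy; apply: norm_coord.
by apply: le_lt_trans hx; apply: norm_coord.
Qed.

End grid.

(** * The dyadic lattices of tripled cubes *)

Section lattice.
Context {R : realType} {n : nat}.
Implicit Types (k : int) (m p q : {ffun 'I_n -> int}) (x y : 'rV[R]_n).
Implicit Types j : {ffun 'I_n -> 'I_3}.

Lemma cube_inj (a a' : 'rV[R]_n) (h h' : R) : (0 < n)%N -> 0 < h -> 0 < h' ->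
  cube a h = cube a' h' -> a = a' /\ h = h'.
Proof.
move=> n0 h0 h0' E.
have key (b b' : 'rV[R]_n) (g g' : R) : 0 < g -> cube b g = cube b' g' -> forall i, b' 0 i <= b 0 i.
  move=> g0 e i; have : cube b g b by move=> l; lra.
  by rewrite e => /(_ i) /andP[].
have aa' : a = a'.
  apply/rowP => i; apply/eqP.
  by rewrite eq_le (key _ _ _ _ h0 E)// (key _ _ _ _ h0' (esym E)).
split=> //; subst a'.
have key2 (g g' : R) : 0 < g -> 0 < g' -> cube a g = cube a g' -> g <= g'.
  move=> g0 g0' e; rewrite leNgt; apply/negP => gg.
  have : cube a g (a + const_mx g') by move=> l; rewrite !mxE; lra.
  by rewrite e => /(_ (Ordinal n0)); rewrite !mxE; lra.
by apply/eqP; rewrite eq_le !key2.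
Qed.

Lemma grid_corner_inj k m m' : grid_corner (R := R) k m = grid_corner k m' -> m = m'.
Proof.
move=> /rowP e; apply/ffunP => i; move: (e i); rewrite !mxE.
move=> /(mulfI (side_neq0 k)) /addIr /eqP; rewrite eqr_int => /eqP//.
Qed.

Lemma side_inj k k' : side k = side k' :> R -> k = k'.
Proof. by apply: ieexprIz => //; rewrite gt_eqF// ltr1n. Qed.

Lemma tcube_inj k m k' m' : (0 < n)%N ->
  tcube (R := R) k m = tcube k' m' -> k = k' /\ m = m'.
Proof.
move=> n0 /(cube_inj n0); rewrite !mulr_gt0 ?side_gt0// => /(_ isT isT)[+ s].
have {s}-> : k = k' by apply/side_inj/(mulfI _ s); rewrite pnatr_eq0.
move=> /grid_corner_inj /ffunP e; split=> //; apply/ffunP => i.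
by move: (e i); rewrite !ffunE => /addIr.
Qed.

(** Triples of the same generation whose corners differ by multiples of 3 tile
the space.  The twist by the sign and by the generation is chosen so that the
class of the parent is that of the child: modulo 3, halving an index is
changing its sign. *)
Definition mod3_class j k p :=
  forall i, ((grid_sign k * p i - k) %% 3)%Z = (j i : nat)%:Z.

Definition tlattice j : set (set 'rV[R]_n) :=
  [set Q | exists k p, mod3_class j k p /\ Q = grid_cube 3 k p].

Lemma exists_mod3_class k p : exists j, mod3_class j k p.
Proof.
exists [ffun i => inord `|((grid_sign k * p i - k) %% 3)%Z|%N] => i.
rewrite ffunE inordK; lia.
Qed.

Lemma is_cube_grid_cube w k p : (0 < w)%N -> is_cube (@grid_cube R n w k p).
Proof.
move=> w0; exists (grid_corner k p), (w%:R * side k); split=> //.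
by rewrite mulr_gt0 ?side_gt0// ltr0n.
Qed.

(** The parity of the shifted index decides, in each coordinate, in which half
of its parent the triple lies. *)
Lemma tlattice_parent j k p : mod3_class j k p ->
  exists2 q, mod3_class j (k + 1) q &
    child (grid_cube (R := R) 3 (k + 1) q) (grid_cube 3 k p).
Proof.
move=> jp; pose e i := ((p i + grid_sign k) %% 2)%Z == 1.
pose q := [ffun i => ((p i + grid_sign k - (e i : nat)%:Z * 3) %/ 2)%Z].
have pq i : p i = q i + q i - grid_sign k + (e i : nat)%:Z * 3.
  rewrite ffunE /e; move: (p i) (grid_sign k) (grid_sign_cases k) => a s ?.
  by case: eqVneq => /= ?; lia.
exists q.
  move=> i; rewrite -(jp i) (pq i) grid_signS.
  by case: (grid_sign_cases k) => ->; move: (q i) (e i : nat) => a b; lia.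
exists (grid_corner (k + 1) q), (3 * side (k + 1)), e; split => //.
  by rewrite mulr_gt0// side_gt0.
rewrite /grid_cube sideS; congr cube; last by field.
apply/rowP => i; rewrite !mxE pq sideS grid_signS.
rewrite rmorphN/= !(intrD,rmorphM,rmorphB,rmorphN)/=.
by case: (e i) => /=; field.
Qed.

Lemma tlattice_child j k q Q' : (0 < n)%N -> mod3_class j (k + 1) q ->
  child (grid_cube (R := R) 3 (k + 1) q) Q' ->
  exists2 p, mod3_class j k p & Q' = grid_cube 3 k p.
Proof.
move=> n0 jq [a [h [e [h0 /(cube_inj n0)]]]].
rewrite mulr_gt0 ?side_gt0// => /(_ isT h0)[<- <-] ->.
exists [ffun i => q i + q i - grid_sign k + (e i : nat)%:Z * 3].
  move=> i; rewrite -(jq i) ffunE grid_signS.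
  by case: (grid_sign_cases k) => ->; move: (q i) (e i : nat) => a' b; lia.
rewrite /grid_cube sideS; congr cube; last by field.
apply/rowP => i; rewrite !mxE ffunE sideS grid_signS.
rewrite rmorphN/= !(intrD,rmorphM,rmorphB,rmorphN)/=.
by case: (e i) => /=; field.
Qed.

Lemma child_sub (Q Q' : set 'rV[R]_n) : child Q Q' -> Q' `<=` Q.
Proof.
move=> [a [h [e [h0 -> ->]]]] x h1 i; move: (h1 i); rewrite !mxE.
by case: (e i) => /=; lra.
Qed.

Lemma dyadic_sub (Q Q' : set 'rV[R]_n) : dyadic Q Q' -> Q' `<=` Q.
Proof.
move=> d; induction d as [|Q1 Q2 _ IH c]; first by [].
exact: subset_trans (child_sub c) IH.
Qed.

Lemma dyadic_trans (Q1 Q2 Q3 : set 'rV[R]_n) :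
  dyadic Q1 Q2 -> dyadic Q2 Q3 -> dyadic Q1 Q3.
Proof.
move=> d12 d; induction d as [|Q Q' _ d1 c]; first by [].
exact: dyadic_child d1 c.
Qed.

Lemma tlattice_anc j k p (N : nat) : mod3_class j k p ->
  exists2 q, mod3_class j (k + N%:Z) q &
    dyadic (grid_cube (R := R) 3 (k + N%:Z) q) (grid_cube 3 k p).
Proof.
move=> jp; elim: N => [|N [q jq dq]].
  by rewrite addr0; exists p => //; apply/dyadic_self/is_cube_grid_cube.
have [q' jq' cq'] := tlattice_parent jq.
have -> : k + N.+1%:Z = k + N%:Z + 1 by lia.
exists q' => //; apply: dyadic_trans dq.
by apply: dyadic_child cq'; apply/dyadic_self/is_cube_grid_cube.
Qed.

Lemma mod3_class_uniq j k p q x : mod3_class j k p -> mod3_class j k q ->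
  grid_cube 3 k p x -> grid_cube 3 k q x -> p = q.
Proof.
move=> jp jq /grid_cubeP hp /grid_cubeP hq; apply/ffunP => i.
move: (jp i) (jq i) (hp i) (hq i).
move: (p i) (q i) (idx k x i) (j i : nat) => a b c d.
by case: (grid_sign_cases k) => ->; lia.
Qed.

Lemma tlattice_laminar j k p k' p' x : mod3_class j k p -> mod3_class j k' p' ->
  grid_cube 3 k p x -> grid_cube 3 k' p' x -> k <= k' ->
  grid_cube (R := R) 3 k p `<=` grid_cube 3 k' p'.
Proof.
move=> jp jp' xp xp' kk'.
have [q jq dq] := tlattice_anc `|k' - k|%N jp.
have ek : k + `|k' - k|%:Z = k' by lia.
rewrite ek in jq dq; have s := dyadic_sub dq.
by have <- := mod3_class_uniq jq jp' (s _ xp) xp'.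
Qed.

Lemma grid_cube_corner w k p : (0 < w)%N -> grid_cube (R := R) w k p (grid_corner k p).
Proof.
move=> w0 i; have := side_gt0 (R := R) k; set s := side k => s0.
have : 0 < w%:R * s by rewrite mulr_gt0// ltr0n.
lra.
Qed.

(** Three-lattice theorem: the triples of the grid cubes, sorted by the residue
of their corner, form 3 ^ n dyadic lattices.  Common ancestors exist because
any two points share a grid cube; a compact set is covered because in each
class some triple contains the large cube around the origin. *)
Theorem dyadic_lattice_tlattice j : (0 < n)%N -> dyadic_lattice (tlattice j).
Proof.
move=> n0; split.
- by move=> _ [k [p [_ ->]]]; apply: is_cube_grid_cube.
- move=> _ Q' [k [p [jp ->]]].
  have ek : k = (k - 1) + 1 by lia.
  rewrite ek in jp *.
  by move=> /(tlattice_child n0 jp)[q jq ->]; exists (k - 1), q.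
- move=> _ _ [k [p [jp ->]]] [k' [p' [jp' ->]]].
  have [K0 h] := idx_cofinal (grid_corner (R := R) k p) (grid_corner k' p').
  pose K := Num.max K0 (Num.max k k').
  have [kK [k'K K0K]] : k <= K /\ k' <= K /\ K0 <= K by rewrite /K; lia.
  have [q jq dq] := tlattice_anc `|K - k|%N jp.
  have [q' jq' dq'] := tlattice_anc `|K - k'|%N jp'.
  have e1 : k + `|K - k|%:Z = K by lia.
  have e2 : k' + `|K - k'|%:Z = K by lia.
  rewrite e1 in jq dq; rewrite e2 in jq' dq'.
  have qq' : q = q'.
    apply: (mod3_class_uniq (x := grid_corner (R := R) k p) jq jq').
      by apply: (dyadic_sub dq); exact: grid_cube_corner.
    apply/grid_cubeP; rewrite (h _ K0K); apply/grid_cubeP.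
    by apply: (dyadic_sub dq'); exact: grid_cube_corner.
  subst q'; exists (grid_cube 3 K q); split=> //.
  by exists K, q.
- move=> A /compact_bounded [M [_ hM]].
  have [k hk] := exists_side (`|M| + 1).
  have {hk}hk := hk _ (lexx k).
  pose c : int := if grid_sign k == 1 then -1 else 0.
  pose q : {ffun 'I_n -> int} :=
    [ffun i => c - ((grid_sign k * (grid_sign k * c - k - (j i : nat)%:Z)) %% 3)%Z].
  exists (grid_cube 3 k q); split.
    exists k, q; split=> // i; rewrite ffunE.
    have := ltn_ord (j i); move: (c) (j i : nat) => a b.
    by case: (grid_sign_cases k) => ->; lia.
  move=> x Ax; apply/grid_cubeP => i.
  have -> : idx k x i = c.
    apply: idx_near0; apply: le_lt_trans hk; apply: le_trans (norm_coord _ _) _.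
    by apply: hM => //; have := ler_norm M; lra.
  rewrite ffunE; move: (grid_sign k * _) => a; lia.
Qed.

Lemma tcube_tlattice j k m : mod3_class j k [ffun i => m i - 1] -> tlattice j (tcube k m).
Proof. by move=> h; exists k, [ffun i => m i - 1]. Qed.

Lemma tcubeS k x : tcube (R := R) k (idx k x) `<=` tcube (k + 1) (idx (k + 1) x).
Proof.
move=> y /tcubeP h; apply/tcubeP => i; move: (h i); rewrite !idxS.
by move: (idx k x i) (idx k y i) (grid_sign k) => a b s; lia.
Qed.

Lemma tcube_anc k x (i j : nat) : (i <= j)%N ->
  tcube (R := R) (k + i%:Z) (idx (k + i%:Z) x) `<=`
  tcube (k + j%:Z) (idx (k + j%:Z) x).
Proof.
elim: j => [|j IH]; first by rewrite leqn0 => /eqP->.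
rewrite leq_eqVlt => /predU1P[->//|/IH/subset_trans]; apply.
have -> : k + j.+1%:Z = k + j%:Z + 1 by lia.
exact: tcubeS.
Qed.

(** Siblings are neighbours, hence lie in the triple of each other. *)
Lemma sibling_tcube k x y : idx (k + 1) x = idx (k + 1) y ->
  tcube k (idx k x) y.
Proof.
move=> /ffunP h; apply/tcubeP => i; move: (h i); rewrite !idxS.
by move: (idx k x i) (idx k y i) (grid_sign k) => a b s; lia.
Qed.

Lemma tcube_exhaust k x y : exists i : nat, tcube (k + i%:Z) (idx (k + i%:Z) x) y.
Proof.
have [k0 h] := idx_cofinal x y.
exists `|k0 - k|%N; apply/tcubeP => i; rewrite h; last by lia.
by move: (idx _ y i) => a; lia.
Qed.

Lemma dcube_dist k x y i : idx k x = idx k y -> `|x 0 i - y 0 i| < side k.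
Proof.
move=> h; have /andP[] := idx_itv k x i; have /andP[] := idx_itv k y i.
rewrite h ltr_norml; move: (_ * _) => a *; apply/andP; split; lra.
Qed.

Lemma notin_tcube_dist k x y : ~ tcube k (idx k x) y ->
  exists i, side k < `|x 0 i - y 0 i|.
Proof.
move=> h; have [i hi] : exists i, ~ (idx k x i - 1 <= idx k y i <= idx k x i + 1)%R.
  by apply/existsNP => h'; apply/h/tcubeP.
exists i; have /andP[] := idx_itv k x i; have /andP[] := idx_itv k y i.
have s0 := side_gt0 (R := R) k.
move: hi; move: (idx k x i) (idx k y i) => a b hi.
rewrite lter_normr.
have [ab|ab] : (a + 2 <= b \/ b + 2 <= a)%R by move/negP: hi; lia.
- have {}ab : a%:~R + 2 <= b%:~R :> R by rewrite -[2]/(2%:~R) -intrD ler_int.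
  have : side k * (a%:~R + 2) <= side k * b%:~R :> R by rewrite ler_pM2l.
  move=> *; apply/orP; right; lra.
- have {}ab : b%:~R + 2 <= a%:~R :> R by rewrite -[2]/(2%:~R) -intrD ler_int.
  have : side k * (b%:~R + 2) <= side k * a%:~R :> R by rewrite ler_pM2l.
  move=> *; apply/orP; left; lra.
Qed.

End lattice.

(** * Unions of cubes, outer regularity and density points *)

Lemma bigcup_seqE (T : Type) (I : eqType) (F : I -> set T) (s : seq I) (x : T) :
  (\big[setU/set0]_(i <- s) F i) x <-> exists2 i, i \in s & F i x.
Proof.
elim: s => [|i s IH]; first by rewrite big_nil; split => // -[].
rewrite big_cons; split.
  move=> [Fi|/IH[j js Fj]]; first by exists i => //; rewrite mem_head.
  by exists j => //; rewrite inE js orbT.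
move=> [j]; rewrite inE => /predU1P[->|js] Fj; first by left.
by right; apply/IH; exists j.
Qed.

(** In a family where two members are nested or disjoint, the union is the
disjoint union of the maximal members; so an inequality between a subadditive
and a superadditive set function passes from the members to the union.  Both
the density theorem and the maximal inequality are applications, with the roles
of Lebesgue measure and of a second measure exchanged. *)
Lemma laminar_bigsetU_le d (T : measurableType d) (R : realType) (I : eqType)
    (F : I -> set T) (nu1 nu2 : set T -> \bar R) (s : seq I) :
  (forall i, measurable (F i)) ->
  (forall i j, i \in s -> j \in s ->
    [\/ F i `<=` F j, F j `<=` F i | F i `&` F j = set0]) ->
  (nu1 set0 <= 0)%E -> (0 <= nu2 set0)%E ->
  (forall A B, measurable A -> measurable B -> A `&` B = set0 ->
    (nu1 (A `|` B) <= nu1 A + nu1 B)%E) ->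
  (forall A B, measurable A -> measurable B -> A `&` B = set0 ->
    (nu2 A + nu2 B <= nu2 (A `|` B))%E) ->
  (forall i, i \in s -> (nu1 (F i) <= nu2 (F i))%E) ->
  (nu1 (\big[setU/set0]_(i <- s) F i) <= nu2 (\big[setU/set0]_(i <- s) F i))%E.
Proof.
move=> mF + n10 n20 sub1 sup2.
elim: {s}(size s).+1 {-2}s (ltnSn (size s)) => // N IH [|i s] /= sN lam le12.
  by rewrite !big_nil (le_trans n10).
have [[j [js ij]]|nij] := pselect (exists j, j \in s /\ F i `<=` F j).
  rewrite big_cons setUidr; last first.
    by move=> x /ij Fjx; apply/bigcup_seqE; exists j.
  apply: IH => //.
  - by move=> a b sa sb; apply: lam; rewrite inE ?sa ?sb orbT.
  - by move=> a sa; apply: le12; rewrite inE sa orbT.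
(* F i is maximal: drop the members that it contains. *)
pose s' := [seq j <- s | ~~ `[< F j `<=` F i >]].
have -> : \big[setU/set0]_(j <- i :: s) F j =
    F i `|` \big[setU/set0]_(j <- s') F j.
{ rewrite big_cons; apply/seteqP; split => x [Fx|/bigcup_seqE[j js Fx]].
  - by left.
  - have [ji|/asboolP ji] := pselect (F j `<=` F i); first by left; exact: ji.
    by right; apply/bigcup_seqE; exists j => //; rewrite mem_filter -asbool_neg ji.
  - by left.
  - right; apply/bigcup_seqE; exists j => //.
    by move: js; rewrite mem_filter => /andP[]. }
have mU : measurable (\big[setU/set0]_(j <- s') F j).
  by apply: bigsetU_measurable => j _.
have dis : F i `&` \big[setU/set0]_(j <- s') F j = set0.
  apply/seteqP; split => // x [Fix /bigcup_seqE[j]].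
  rewrite mem_filter => /andP[/asboolP ji js] Fjx.
  have ii : i \in i :: s by rewrite mem_head.
  have jj : j \in i :: s by rewrite inE js orbT.
  have [ij|//|] := lam i j ii jj; first by case: nij; exists j.
  by move=> /seteqP[/(_ x) h _]; apply: h.
apply: (le_trans (sub1 _ _ _ _ dis)) => //.
apply: (le_trans _ (sup2 _ _ _ _ dis)) => //.
apply: leeD; first by apply: le12; rewrite mem_head.
apply: IH.
- by rewrite (leq_ltn_trans (size_subseq (filter_subseq _ _))).
- move=> a b; rewrite !mem_filter => /andP[_ sa] /andP[_ sb].
  by apply: lam; rewrite inE ?sa ?sb orbT.
- by move=> a; rewrite mem_filter => /andP[_ sa]; apply: le12; rewrite inE sa orbT.
Qed.

(** Continuity from below, in a form that reduces a bound on a countable union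
to the finite unions. *)
Lemma measure_bigcup_le d (T : measurableType d) (R : realType) (I : countType)
    (F : I -> set T) (D : set I) (m : {measure set T -> \bar R}) (C : \bar R) :
  (forall i, measurable (F i)) ->
  (forall s : seq I, (forall i, i \in s -> D i) ->
     (m (\big[setU/set0]_(i <- s) F i) <= C)%E) ->
  (m (\bigcup_(i in D) F i) <= C)%E.
Proof.
move=> mF h.
pose F' N := if unpickle N is Some i then if `[< D i >] then F i else set0 else set0.
pose G N := \big[setU/set0]_(l < N) F' l.
have mG N : measurable (G N).
  apply: bigsetU_measurable => l _; rewrite /F'; case: unpickle => // i.
  by case: asbool.
have -> : \bigcup_(i in D) F i = \bigcup_N G N.
  apply/seteqP; split => x.
    move=> [i Di Fi]; exists (pickle i).+1 => //; rewrite /G big_ord_recr/=.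
    by right; rewrite /F' pickleK (asboolT Di).
  move=> [N _]; rewrite /G -(big_mkord xpredT F') => /bigcup_seqE[l _].
  by rewrite /F'; case: unpickle => // i; case: asboolP => // Di Fi; exists i.
have ndG : nondecreasing_seq G.
  by apply/nondecreasing_seqP => N; rewrite /G big_ord_recr/=; apply/subsetPset; left.
have mUG : measurable (\bigcup_N G N) by exact: bigcup_measurable.
have cv := nondecreasing_cvg_mu (mu := m) mG mUG ndG.
rewrite -(cvg_lim _ cv)//; apply: lime_le; first by apply/cvg_ex; eexists; exact: cv.
apply: nearW => N /=.
suff [s sD ->] : exists2 s : seq I, (forall i, i \in s -> D i) &
    G N = \big[setU/set0]_(i <- s) F i by exact: h.
elim: N => [|N [s sD sE]]; first by exists [::] => //; rewrite /G big_ord0 big_nil.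
rewrite /G big_ord_recr/= -/(G N) sE /F'; case: unpickle => [i|]; last first.
  by exists s => //; rewrite setU0.
case: asboolP => Di; last by exists s => //; rewrite setU0.
exists (i :: s); last by rewrite big_cons setUC.
by move=> j; rewrite inE => /predU1P[->//|/sD].
Qed.

Lemma cvge0_lt (R : realType) (u : nat -> \bar R) (e : R) :
  u @ \oo --> 0%E -> 0 < e -> exists N, forall m, (N <= m)%N -> (u m < e%:E)%E.
Proof.
move=> cu e0; have : nbhs (0%E : \bar R) [set y | (y < e%:E)%E].
  by apply: open_nbhs_nbhs; split; [exact: open_ereal_lt_ereal|rewrite /= lte_fin].
by move=> /cu [N _ hN]; exists N => m; exact: hN.
Qed.

Section lebesgue_grid.
Context {R : realType} {n : nat}.
Implicit Types (k : int) (m p q : {ffun 'I_n -> int}) (x y : 'rV[R]_n).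
Local Notation mu := (lebesgue_rV R n).

Lemma measurable_grid_cube w k m : measurable (grid_cube (R := R) w k m).
Proof. exact: measurable_cube. Qed.

Lemma mu_grid_cube w k m : mu (grid_cube w k m) = ((w%:R * side k) ^+ n)%:E.
Proof. by rewrite lebesgue_rV_cube// mulr_ge0// side_ge0. Qed.

Lemma mu_dcube k m : mu (dcube k m) = (side k ^+ n)%:E.
Proof. by rewrite mu_grid_cube mul1r. Qed.

Lemma mu_tcube k m : mu (tcube k m) = ((3 * side k) ^+ n)%:E.
Proof. by rewrite mu_grid_cube. Qed.

Lemma dcube_laminar k m k' m' :
  [\/ dcube (R := R) k m `<=` dcube k' m', dcube (R := R) k' m' `<=` dcube k m |
      dcube (R := R) k m `&` dcube k' m' = set0].
Proof.
have [E|/set0P[x [/dcubeP xm /dcubeP xm']]] :=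
  eqVneq (dcube (R := R) k m `&` dcube k' m') set0; first by constructor 3.
have [kk|kk] := leP k k'; [constructor 1|constructor 2] => y /dcubeP ym;
  apply/dcubeP.
- have ek : k' = k + `|k' - k|%:Z by lia.
  by rewrite -xm' ek; apply: idx_anc; rewrite ym.
- have ek : k = k' + `|k - k'|%:Z by lia.
  by rewrite -xm ek; apply: idx_anc; rewrite ym.
Qed.

Lemma small_side (e : R) : 0 < e -> exists k0, side k0 < e.
Proof.
move=> e0; have [k0 /(_ _ (lexx k0)) h] := @exists_side R (e^-1).
exists (- k0); rewrite /side -invr_expz invf_plt ?posrE ?side_gt0//.
by have := side_gt0 (R := R) k0; rewrite /side in h *; lra.
Qed.

Lemma open_dcube (U : set 'rV[R]_n) x : open U -> U x ->
  exists k0, dcube k0 (idx k0 x) `<=` U.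
Proof.
move=> oU Ux; have /nbhs_ballP[e /= e0 he] := open_nbhs_nbhs (conj oU Ux).
have [k hk] := small_side e0; exists k => y /dcubeP yx; apply: he.
split=> // i j; rewrite ord1 /ball/=; apply: lt_trans hk.
exact: dcube_dist.
Qed.

(** The sigma-algebra is generated by coordinates, and an open set is the
countable union of the grid cubes that it contains. *)
Lemma open_measurable_rV (U : set 'rV[R]_n) : open U -> measurable U.
Proof.
move=> oU; pose F (q : int * {ffun 'I_n -> int}) :=
  if `[< dcube (R := R) q.1 q.2 `<=` U >] then dcube (R := R) q.1 q.2 else set0.
have -> : U = \bigcup_q F q.
  apply/seteqP; split => x.
    move=> /(open_dcube oU)[k0 h]; exists (k0, idx k0 x) => //.
    by rewrite /F/= (asboolT h); exact: dcube_idx.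
  by move=> [q _]; rewrite /F; case: asboolP => // h /h.
apply: countable_bigcupT_measurable => [|q]; first exact: countableP.
by rewrite /F; case: asbool => //; exact: measurable_grid_cube.
Qed.

Definition outer_regular_in (C A : set 'rV[R]_n) := forall e : R, 0 < e ->
  exists U, [/\ open U, A `<=` U & (mu (C `&` (U `\` A)) <= e%:E)%E].

Lemma outer_regular_bigcup C (A : nat -> set 'rV[R]_n) : measurable C ->
  (forall i, measurable (A i)) ->
  (forall i, outer_regular_in C (A i)) -> outer_regular_in C (\bigcup_i A i).
Proof.
move=> mC mA h e e0.
have /choice[U hU] : forall i, exists U, [/\ open U, A i `<=` U &
    (mu (C `&` (U `\` A i)) <= (e / (2 ^ i.+1)%:R)%:E)%E].
  by move=> i; apply: h; rewrite divr_gt0// ltr0n expn_gt0.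
exists (\bigcup_i U i); split.
- by apply: bigcup_open => i _; have [] := hU i.
- by move=> x [i _ Aix]; exists i => //; have [_ s _] := hU i; exact: s.
- have mU i : measurable (U i) by apply: open_measurable_rV; have [] := hU i.
  apply: (@le_trans _ _ (\sum_(0 <= i <oo) mu (C `&` (U i `\` A i)))%E).
    apply: measure_sigma_subadditive.
    - by move=> i; apply: measurableI => //; apply: measurableD.
    - apply: measurableI => //; apply: measurableD; exact: bigcup_measurable.
    - move=> x [Cx [[i _ Uix] nA]]; exists i => //; split => //; split => //.
      by move=> Aix; apply: nA; exists i.
  apply: (@le_trans _ _ (\sum_(0 <= i <oo) (e / (2 ^ i.+1)%:R)%:E)%E).
    by apply: lee_nneseries => i // _; have [] := hU i.
  exact: epsilon_trick0 (ltW e0).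
Qed.

Lemma outer_regular_open C U : open U -> outer_regular_in C U.
Proof.
by move=> oU e e0; exists U; split=> //; rewrite setDv setI0 measure0 lee_fin ltW.
Qed.

Lemma outer_regular_bigcap C (A : nat -> set 'rV[R]_n) : measurable C ->
  (mu C < +oo)%E -> (forall i, measurable (A i)) ->
  (forall i, outer_regular_in C (A i)) -> outer_regular_in C (\bigcap_i A i).
Proof.
move=> mC Coo mA h e e0.
pose B N := \big[setI/setT]_(i < N) A i.
have mB N : measurable (B N).
  by apply: big_ind => // X Y; exact: measurableI.
(* The partial intersections decrease to the intersection, and C has finite
   measure, so one of them is close to the intersection in measure. *)
have BE N x : B N x <-> forall i, (i < N)%N -> A i x.
  rewrite /B; elim: N => [|N IH]; first by rewrite big_ord0.
  rewrite big_ord_recr/=; split.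
    move=> [/IH h1 h2] i; rewrite ltnS leq_eqVlt => /predU1P[->//|]; exact: h1.
  by move=> h1; split; [apply/IH => i iN; apply: h1; exact: ltnW|exact: h1].
have orB N : outer_regular_in C (B N).
  rewrite /B; elim: N => [|N IH].
    by rewrite big_ord0; apply: outer_regular_open; exact: openT.
  rewrite big_ord_recr/= -/(B N) => d d0.
  have d2 : 0 < d / 2 by rewrite divr_gt0.
  have [U [oU BU Ue]] := IH _ d2; have [V [oV AV Ve]] := h N _ d2.
  have mU := open_measurable_rV oU; have mV := open_measurable_rV oV.
  exists (U `&` V); split; [exact: openI|exact: setISS|].
  apply: (@le_trans _ _ (mu (C `&` (U `\` B N)) + mu (C `&` (V `\` A N)))%E).
    have mUB : measurable (C `&` (U `\` B N)).
      by apply: measurableI => //; exact: measurableD.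
    have mVA : measurable (C `&` (V `\` A N)).
      by apply: measurableI => //; exact: measurableD.
    apply: le_trans (measureU2 _ _ _) => //.
    apply: le_measure; rewrite ?inE; last first.
    - move=> x [Cx [[Ux Vx] nBA]].
      have [Bx|nBx] := pselect (B N x); last by left.
      by right; split=> //; split=> // Ax; apply: nBA.
    - exact: measurableU.
    - by apply: measurableI => //; apply: measurableD; apply: measurableI => //; exact: mB.
  by rewrite [d in leRHS]splitr EFinD leeD.
have BA : \bigcap_i A i = \bigcap_N B N.
  apply/seteqP; split => x Ax.
    by move=> N _; apply/BE => i _; apply: Ax.
  by move=> i _; have /BE := Ax i.+1 I; apply.
have mIA : measurable (\bigcap_i A i) by exact: bigcap_measurable.
have e2 : 0 < e / 2 by rewrite divr_gt0.
have [N hN] : exists N, (mu (C `&` (B N `\` \bigcap_i A i)) <= (e / 2)%:E)%E.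
  pose D N := C `&` (B N `\` \bigcap_i A i).
  have mD N : measurable (D N) by apply: measurableI => //; exact: measurableD.
  have cap0 : \bigcap_N D N = set0.
    apply/seteqP; split => // x Dx; have [_ [_ nA]] := Dx 0%N I.
    by apply: nA; rewrite BA => N _; have [_ []] := Dx N I.
  have nid : nonincreasing_seq D.
    apply/nonincreasing_seqP => N; apply/subsetPset => x [Cx [Bx nA]].
    by split => //; split=> //; move/BE: Bx => Bx; apply/BE => i iN; apply: Bx; exact: ltnW.
  have := nonincreasing_cvg_mu (mu := mu) (F := D) _ mD _ nid.
  rewrite cap0 measure0 => /(_ _ measurable0) cv.
  have {}cv : mu \o D @ \oo --> 0%E.
    apply: cv; apply: le_lt_trans Coo; apply: le_measure; rewrite ?inE//.
    by move=> x [].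
  have [N hN] := cvge0_lt cv e2.
  by exists N; apply: ltW; exact: (hN N (leqnn _)).
have [U [oU BU Ue]] := orB N _ e2.
exists U; split => //.
  by move=> x Ax; apply: BU; apply/BE => i _; apply: Ax.
apply: (@le_trans _ _ (mu (C `&` (U `\` B N)) +
    mu (C `&` (B N `\` \bigcap_i A i)))%E); last first.
  by rewrite [e in leRHS]splitr EFinD leeD.
have mU := open_measurable_rV oU.
apply: le_trans (measureU2 _ _ _).
- apply: le_measure; rewrite ?inE.
  + by apply: measurableI => //; exact: measurableD.
  + by apply: measurableU; apply: measurableI => //; exact: measurableD.
  + move=> x [Cx [Ux nA]].
    by have [Bx|nBx] := pselect (B N x); [right|left].
- by apply: measurableI => //; exact: measurableD.
- by apply: measurableI => //; exact: measurableD.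
Qed.

(** The sets that are outer regular together with their complement form a
sigma-algebra, which contains the half-spaces. *)
Lemma outer_regular C (A : set 'rV[R]_n) : measurable C -> (mu C < +oo)%E ->
  measurable A -> outer_regular_in C A.
Proof.
move=> mC Coo mA.
pose G : set (set 'rV[R]_n) :=
  [set B | [/\ measurable B, outer_regular_in C B & outer_regular_in C (~` B)]].
suff : G A by case.
have sG : sigma_algebra setT G.
  split.
  - split; [exact: measurable0|exact/outer_regular_open/open0|].
    by rewrite setC0; exact/outer_regular_open/openT.
  - move=> B [mB oB oB']; split; rewrite setTD ?setCK//.
    exact: measurableC.
  - move=> F hF; split.
    + by apply: bigcup_measurable => i _; case: (hF i).
    + by apply: outer_regular_bigcup => // i; case: (hF i).
    + rewrite setC_bigcup; apply: outer_regular_bigcap => // i.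
        by apply: measurableC; case: (hF i).
      by case: (hF i).
move: A mA; apply: smallest_sub => //.
rewrite -bigcup_seq/=; apply: bigcup_sub => i _ _ [Y mY <-]; rewrite setTI.
have : <<s @measurable_realfun.RGenOInfty.G R >> Y.
  exact: (eq_ind _ (fun M => M Y) mY _ (measurable_realfun.RGenOInfty.measurableE R)).
move: Y {mY}; apply: smallest_sub => //.
  split.
  - by rewrite /= preimage_set0; case: sG.
  - by move=> B /= GB; rewrite setTD preimage_setC -setTD; case: sG => _ + _; apply.
  - by move=> F GF /=; rewrite preimage_bigcup; case: sG => _ _; apply.
have cc : continuous (fun x : 'rV[R]_n => x 0 i) by exact: coord_continuous.
move=> _ [a ->].
have og (b : R) : open (@rVcoord R n i @^-1` [set` `]b, +oo[%R]).
  by have /continuousP := cc; apply; exact: interval_open.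
have ol (b : R) : open (@rVcoord R n i @^-1` [set` `]-oo, b[%R]).
  by have /continuousP := cc; apply; exact: interval_open.
split.
- exact: open_measurable_rV.
- exact: outer_regular_open.
- rewrite (_ : ~` _ = \bigcap_j (@rVcoord R n i @^-1` [set` `]-oo, a + j.+1%:R^-1[%R])).
    apply: outer_regular_bigcap => // j; first exact: open_measurable_rV.
    exact: outer_regular_open.
  apply/seteqP; split => x /=.
    move=> h j _ /=; rewrite in_itv/=.
    move/negP: h; rewrite in_itv/= andbT -leNgt => h.
    by rewrite (le_lt_trans h)// ltrDl invr_gt0.
  move=> h; apply/negP; rewrite in_itv/= andbT -leNgt; apply/ler_addgt0Pr => e e0.
  have [j _ hj] := near_infty_natSinv_lt (PosNum e0).
  have := h j I; rewrite /= in_itv/= => /ltW /le_trans; apply.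
  by rewrite lerD2l ltW//; exact: (hj j (leqnn _)).
Qed.

End lebesgue_grid.

Lemma measure_bigsetU_le d (T : measurableType d) (R : realType) (I : eqType)
    (F : I -> set T) (m : {measure set T -> \bar R}) (s : seq I) :
  (forall i, measurable (F i)) ->
  (m (\big[setU/set0]_(i <- s) F i) <= \sum_(i <- s) m (F i))%E.
Proof.
move=> mF; elim: s => [|i s IH]; first by rewrite !big_nil measure0.
rewrite !big_cons; apply: le_trans (measureU2 _ _ _) _ => //.
  by apply: bigsetU_measurable.
by rewrite leeD2l.
Qed.

Lemma measure_bigcup0 d (T : measurableType d) (R : realType) (I : countType)
    (F : I -> set T) (m : {measure set T -> \bar R}) (D : set I) :
  (forall i, measurable (F i)) -> (forall i, D i -> m (F i) = 0%E) ->
  m (\bigcup_(i in D) F i) = 0%E.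
Proof.
move=> mF F0; apply/eqP; rewrite eq_le measure_ge0 andbT.
apply: measure_bigcup_le => // s sD.
apply: (le_trans (measure_bigsetU_le _ _ mF)).
by rewrite big1_seq// => i /andP[_ /sD/F0].
Qed.

Lemma ae_forall_countable d (T : measurableType d) (R : realType) (I : countType)
    (m : {measure set T -> \bar R}) (P : I -> T -> Prop) :
  (forall i, {ae m, forall x, P i x}) -> {ae m, forall x, forall i, P i x}.
Proof.
move=> h; pose Q N x := if unpickle N is Some i then P i x else True.
have {}h N : {ae m, forall x, Q N x}.
  by rewrite /Q; case: unpickle => [i|]; [exact: h|exact: aeW].
have := ae_foralln h; apply: filterS => x hx i.
by have := hx (pickle i); rewrite /Q pickleK.
Qed.

Lemma bigcup_measurable_countable d (T : measurableType d) (I : countType)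
    (F : I -> set T) (D : set I) :
  (forall i, measurable (F i)) -> measurable (\bigcup_(i in D) F i).
Proof.
move=> mF; rewrite bigcup_mkcond; apply: countable_bigcupT_measurable => [|i].
  exact: countableP.
by case: ifP.
Qed.

Section density.
Context {R : realType} {n : nat}.
Implicit Types (k : int) (m p q : {ffun 'I_n -> int}) (x y : 'rV[R]_n).
Local Notation mu := (lebesgue_rV R n).
Local Notation dcubeq q := (@dcube R n q.1 q.2).

Lemma dcube_mono k k' x : k <= k' ->
  dcube (R := R) k (idx k x) `<=` dcube k' (idx k' x).
Proof.
move=> kk y /dcubeP yx; apply/dcubeP.
have -> : k' = k + `|k' - k|%:Z by lia.
exact: idx_anc.
Qed.

(** Weak form of the Lebesgue density theorem.  If U is an open set around F
whose measure is close to that of F, the cubes inside U that meet F cover F,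
hence |F| <= t |U|. *)
Lemma dyadic_density (F : set 'rV[R]_n) (t : R) : measurable F -> 0 <= t < 1 ->
  (forall k m, dcube k m `&` F !=set0 ->
     (mu (dcube k m `&` F) <= (t * side k ^+ n)%:E)%E) ->
  mu F = 0%E.
Proof.
move=> mF /andP[t0 t1] hF.
have -> : F = \bigcup_(m in setT) (F `&` dcube 0 m).
  apply/seteqP; split => x; last by move=> [m _ []].
  by move=> Fx; exists (idx 0 x) => //; split=> //; exact: dcube_idx.
apply: measure_bigcup0 => [m|m0 _].
  by apply: measurableI => //; exact: measurable_grid_cube.
set C := dcube 0 m0.
have mC : measurable C by exact: measurable_grid_cube.
have muC : (mu C < +oo)%E by rewrite mu_dcube ltry.
have mFC : measurable (F `&` C) by exact: measurableI.
set v := mu (F `&` C).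
have voo : (v < +oo)%E by apply: le_lt_trans muC; exact: measureIr.
have v0 : (0 <= v)%E by exact: measure_ge0.
have vE : v = (fine v)%:E by rewrite fineK// ge0_fin_numE.
have {}v0 : 0 <= fine v by rewrite fine_ge0.
(* Letting e tend to 0 gives v <= t v, so v = 0. *)
suff vle (e : R) : 0 < e -> fine v <= t * (fine v + e).
  change (v = 0%E); rewrite vE; congr EFin; apply/eqP; rewrite eq_le v0 andbT leNgt.
  apply/negP => vp; have := vle ((1 - t) * fine v).
  rewrite mulr_gt0 ?subr_gt0// => /(_ isT) h.
  have : 0 < fine v * ((1 - t) * (1 - t)) by rewrite !mulr_gt0 ?subr_gt0.
  by lra.
move=> e0; have [U [oU FU Ue]] := outer_regular mC muC mFC e0.
pose D := [set q | dcubeq q `<=` U `&` C /\ dcubeq q `&` F !=set0].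
pose W := \bigcup_(q in D) dcubeq q.
have FW : F `&` C `<=` W.
  move=> x [Fx Cx]; have [k1 hk] := open_dcube oU (FU _ (conj Fx Cx)).
  (* The cube must also be contained in C, of generation 0. *)
  pose k := Num.min k1 0; exists (k, idx k x); last exact: dcube_idx.
  split=> /=; last by exists x; split=> //; exact: dcube_idx.
  rewrite subsetI; split.
    by apply: subset_trans hk; apply: dcube_mono; rewrite /k; lia.
  have -> : C = dcube 0 (idx 0 x) by rewrite /C; move/dcubeP : Cx => ->.
  by apply: dcube_mono; rewrite /k; lia.
have UC : (mu (U `&` C) <= (fine v + e)%:E)%E.
  have mU := open_measurable_rV oU.
  have mUC : measurable (C `&` (U `\` (F `&` C))).
    by apply: measurableI => //; exact: measurableD.
  rewrite EFinD -vE; apply: le_trans (leeD2l _ Ue).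
  apply: le_trans (measureU2 _ mFC mUC); apply: le_measure; rewrite ?inE.
  - exact: measurableI.
  - exact: measurableU.
  - move=> x [Ux Cx]; have [Fx|Fx] := pselect (F x); first by left.
    by right; split => //; split=> // -[].
have : (mrestr mu mF W <= (t * (fine v + e))%:E)%E.
  apply: measure_bigcup_le => [q|s sD]; first exact: measurable_grid_cube.
  apply: (@le_trans _ _ (t%:E * mu (\big[setU/set0]_(q <- s) dcubeq q))%E).
    apply: (@laminar_bigsetU_le _ _ _ _ _ _ (fun A => t%:E * mu A)%E).
    - by move=> q; exact: measurable_grid_cube.
    - by move=> q q' _ _; exact: dcube_laminar.
    - by rewrite measure0.
    - by rewrite measure0 mule0.
    - by move=> A B mA mB AB; rewrite measureU.
    - by move=> A B mA mB AB; rewrite measureU// ge0_muleDr.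
    - move=> q /sD[_ qF]; rewrite mu_dcube; exact: hF.
  rewrite EFinM.
  apply: lee_wpmul2l; first by rewrite lee_fin.
  apply: le_trans UC; apply: le_measure; rewrite ?inE.
  - by apply: bigsetU_measurable => q _; exact: measurable_grid_cube.
  - by apply: measurableI => //; exact: open_measurable_rV.
  - by move=> x /bigcup_seqE[q /sD[h _]]; exact: h.
move=> /(le_trans _) h; rewrite -lee_fin -vE; apply: h.
apply: le_measure; rewrite ?inE//.
- apply: measurableI => //; apply: bigcup_measurable_countable => q.
  exact: measurable_grid_cube.
- by move=> x [Fx Cx]; split => //; exact: FW.
Qed.

End density.

(** * Stopping cubes and the maximal function *)

Section level_sets.
Context d (T : measurableType d) (R : realType) (f : T -> R) (a : R).
Hypothesis mf : measurable_fun setT f.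

Lemma measurable_gt_set : measurable [set x | a < f x].
Proof.
have := mf measurableT (measurable_itv `]a, +oo[); rewrite setTI.
by congr measurable; apply/seteqP; split => x /=; rewrite in_itv/= andbT.
Qed.

Lemma measurable_ge_set : measurable [set x | a <= f x].
Proof.
have := mf measurableT (measurable_itv `[a, +oo[); rewrite setTI.
by congr measurable; apply/seteqP; split => x /=; rewrite in_itv/= andbT.
Qed.

End level_sets.

Section cz_decomposition.
Context {R : realType} {n : nat} (n0 : (0 < n)%N).
Implicit Types (k : int) (m : {ffun 'I_n -> int}) (x y : 'rV[R]_n).
Local Notation mu := (lebesgue_rV R n).
Local Notation dcubeq q := (@dcube R n q.1 q.2).

Variable phi : 'rV[R]_n -> R.
Hypothesis mphi : measurable_fun setT phi.
Hypothesis phi0 : forall x, 0 <= phi x.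

Definition mass (A : set 'rV[R]_n) : \bar R := (\int[mu]_(x in A) (phi x)%:E)%E.

Let mphiE (A : set 'rV[R]_n) : measurable_fun A (fun x => (phi x)%:E).
Proof. by apply/measurable_EFinP; exact: measurable_funS mphi. Qed.

Lemma mass_le A B : measurable A -> measurable B -> A `<=` B ->
  (mass A <= mass B)%E.
Proof.
move=> mA mB AB; apply: ge0_subset_integral => //.
by move=> x _; rewrite lee_fin.
Qed.

Lemma massU A B : measurable A -> measurable B -> A `&` B = set0 ->
  mass (A `|` B) = (mass A + mass B)%E.
Proof.
move=> mA mB AB; apply: ge0_integral_setU => //.
- by move=> x _; rewrite lee_fin.
- by apply/disj_set2P.
Qed.

Lemma mass_ge0 A : (0 <= mass A)%E.
Proof. by apply: integral_ge0 => x _; rewrite lee_fin. Qed.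

Lemma mass_ge (A : set 'rV[R]_n) (a : R) : measurable A -> 0 <= a -> (forall x, A x -> a <= phi x) ->
  (a%:E * mu A <= mass A)%E.
Proof.
move=> mA a0 h; rewrite -integral_cst//; apply: ge0_le_integral => // x Ax.
Qed.

Variables (N a : R).
Hypothesis a0 : 0 < a.
Hypothesis mass_bound : (mass setT <= N%:E)%E.

Let bad k m := ((a * side k ^+ n)%:E < mass (dcube k m))%E.

(** The maximal cubes over which the average of phi exceeds a.  Maximality is
expressed through the ancestors of the cube, none of which is bad. *)
Definition stopping : set (int * {ffun 'I_n -> int}) :=
  [set q | bad q.1 q.2 /\ forall (j : nat) x, dcube q.1 q.2 x ->
     ~ bad (q.1 + j.+1%:Z) (idx (q.1 + j.+1%:Z) x)].

Lemma stopping_disj q q' x : stopping q -> stopping q' ->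
  dcubeq q x -> dcubeq q' x -> q = q'.
Proof.
clear n0 a0 mass_bound mphi phi0.
move: q q' => [k m] [k' m'] [/= b nb] [/= b' nb'] xm xm'.
have em := xm; have em' := xm'; move/dcubeP in em; move/dcubeP in em'.
have [kk|kk|kk] := ltgtP k k'.
- have ek : k' = k + (`|k' - k|.-1.+1)%:Z by lia.
  by have := nb (`|k' - k|.-1)%N _ xm; rewrite -ek em'.
- have ek : k = k' + (`|k - k'|.-1.+1)%:Z by lia.
  by have := nb' (`|k - k'|.-1)%N _ xm'; rewrite -ek em.
- by move: em em'; rewrite kk => -> ->.
Qed.

Lemma stopping_lb q : stopping q -> ((a * side q.1 ^+ n)%:E < mass (dcubeq q))%E.
Proof. by case. Qed.

(** The parent of a stopping cube is not bad, and is 2 ^ n times larger. *)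
Lemma stopping_ub q : stopping q ->
  (mass (dcubeq q) <= (2 ^+ n * a * side q.1 ^+ n)%:E)%E.
Proof.
clear n0 a0 mass_bound.
move=> [_ nb]; have xq := grid_cube_corner (R := R) q.1 q.2 (isT : (0 < 1)%N).
have := nb 0%N _ xq; rewrite /bad => /negP; rewrite -leNgt sideS exprMn.
rewrite mulrCA mulrA; apply: le_trans; apply: mass_le; [exact: measurable_grid_cube..|].
have e : q.2 = idx q.1 (grid_corner (R := R) q.1 q.2) by apply/esym/dcubeP.
by rewrite {1}e; apply: dcube_mono; lia.
Qed.

(** Large cubes are not bad since phi has finite mass: this gives maximal bad
cubes. *)
Lemma bad_bounded k x (j : nat) : bad (k + j%:Z) (idx (k + j%:Z) x) ->
  (j <= Num.trunc (N / (a * side k ^+ n)))%N.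
Proof.
move=> b; have sk : 0 < a * side k ^+ n by rewrite mulr_gt0// exprn_gt0// side_gt0.
have h : a * side (k + j%:Z) ^+ n < N.
  rewrite -lte_fin; apply: lt_le_trans b _; apply: le_trans mass_bound.
  by apply: mass_le => //; exact: measurable_grid_cube.
rewrite sideD exprMn mulrCA -ltr_pdivlMr// in h.
have h2 : (j%:R : R) <= (2 ^+ j) ^+ n.
  apply: (@le_trans _ _ (2 ^+ j)).
    by rewrite -natrX ler_nat ltnW// ltn_expl.
  by rewrite -[leLHS]expr1 ler_weXn2l// exprn_ege1// ler1n.
have {h2}h : j%:R < N / (a * side k ^+ n) by exact: le_lt_trans h.
by rewrite truncn_ge_nat ?(ltW h)//; apply: le_trans (ltW h); exact: ler0n.
Qed.

Lemma bad_stopping k x : bad k (idx k x) ->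
  exists2 q, stopping q & dcubeq q x /\ dcube k (idx k x) `<=` dcubeq q.
Proof.
move=> b; pose P j := `[< bad (k + j%:Z) (idx (k + j%:Z) x) >].
have P0 : exists j, P j by exists 0%N; apply/asboolP; rewrite addr0.
have Pb j : P j -> (j <= Num.trunc (N / (a * side k ^+ n)))%N.
  by move/asboolP; exact: bad_bounded.
case: (ex_maxnP P0 Pb) => j /asboolP bj hj.
exists (k + j%:Z, idx (k + j%:Z) x).
  split=> //= i y /dcubeP ey bi.
  have : P (j + i.+1)%N.
    apply/asboolP; have -> : k + (j + i.+1)%N%:Z = k + j%:Z + i.+1%:Z by lia.
    by rewrite (idx_anc _ (esym ey)).
  by move/hj; lia.
split; first exact: dcube_idx.
by apply: dcube_mono => /=; lia.
Qed.

(** Outside the stopping cubes all averages of phi are at most a; so phi is at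
most a almost everywhere there, by the density theorem applied to the sets
where phi > a + 1 / (i + 1). *)
Lemma stopping_ae :
  {ae mu, forall x, (forall q, stopping q -> ~ dcubeq q x) -> phi x <= a}.
Proof.
pose O := \bigcup_(q in stopping) dcubeq q.
have mO : measurable O.
  by apply: bigcup_measurable_countable => q; exact: measurable_grid_cube.
pose F i := [set x | a + i.+1%:R^-1 <= phi x] `\` O.
have mF i : measurable (F i).
  by apply: measurableD => //; exact: measurable_ge_set.
have F0 i : mu (F i) = 0%E.
  pose d : R := i.+1%:R^-1; have d0 : 0 < d by rewrite invr_gt0.
  apply: (@dyadic_density _ _ _ (a / (a + d))) => //.
    by rewrite divr_ge0 ?ltW ?addr_gt0//= ltr_pdivrMr ?addr_gt0// mul1r ltrDl.
  move=> k m [x [/dcubeP xm [_ nO]]].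
  have nb : ~ bad k m.
    rewrite -xm => /bad_stopping[q sq [xq _]]; apply: nO; by exists q.
  move: nb => /negP; rewrite -leNgt => nb.
  have mI : measurable (dcube k m `&` F i).
    by apply: measurableI => //; exact: measurable_grid_cube.
  have h : ((a + d)%:E * mu (dcube k m `&` F i) <= (a * side k ^+ n)%:E)%E.
    apply: le_trans nb; apply: le_trans (mass_le _ _ (@subIsetl _ _ (F i))) => //.
      by apply: mass_ge => //; [rewrite addr_ge0 ?ltW|move=> y [_ [? _]]].
    exact: measurable_grid_cube.
  by rewrite mulrAC EFinM lee_pdivlMr ?addr_gt0// muleC.
exists (\bigcup_i F i); split.
- exact: bigcup_measurable.
- exact: measure_bigcup0 mF (fun i _ => F0 i).
- move=> x /= /not_implyP[nO /negP]; rewrite -ltNge => ax.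
  have d0 : 0 < phi x - a by rewrite subr_gt0.
  have [i _ hi] := near_infty_natSinv_lt (PosNum d0).
  exists i => //; split; last by move=> [q sq xq]; exact: nO xq.
  by have /ltW := hi i (leqnn _); rewrite /= lerBrDl.
Qed.

End cz_decomposition.

Section maximal.
Context {R : realType} {n : nat} (n0 : (0 < n)%N).
Implicit Types (k : int) (m : {ffun 'I_n -> int}) (x y : 'rV[R]_n).
Local Notation mu := (lebesgue_rV R n).

Variable phi : 'rV[R]_n -> R.
Hypothesis mphi : measurable_fun setT phi.
Hypothesis phi0 : forall x, 0 <= phi x.
Variables (N a : R).
Hypothesis a0 : 0 < a.
Hypothesis mass_bound : (mass phi setT <= N%:E)%E.

(** The set where the maximal function of phi over triples of grid cubes
exceeds a. *)
Definition maximal_above : set 'rV[R]_n :=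
  [set x | exists k, ((a * (3 * side k) ^+ n)%:E < mass phi (tcube k (idx k x)))%E].

Lemma measurable_maximal_above : measurable maximal_above.
Proof.
pose D := [set q : int * {ffun 'I_n -> int} |
  ((a * (3 * side q.1) ^+ n)%:E < mass phi (tcube q.1 q.2))%E].
rewrite (_ : maximal_above = \bigcup_(q in D) dcube q.1 q.2).
  by apply: bigcup_measurable_countable => q; exact: measurable_grid_cube.
apply/seteqP; split => x.
  by move=> [k h]; exists (k, idx k x) => //; exact: dcube_idx.
by move=> [[k m] h /dcubeP/= xm]; exists k; rewrite xm.
Qed.

(** Within one lattice the triples are laminar, so the weak type inequality
holds there with constant 1; there are 3 ^ n lattices. *)
Lemma weak_type_maximal : (mu maximal_above <= ((3 ^ n)%:R * (N / a))%:E)%E.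
Proof.
pose D (j : {ffun 'I_n -> 'I_3}) := [set q : int * {ffun 'I_n -> int} |
  mod3_class j q.1 [ffun i => q.2 i - 1] /\
  ((a * (3 * side q.1) ^+ n)%:E < mass phi (tcube q.1 q.2))%E].
pose W j := \bigcup_(q in D j) tcube (R := R) q.1 q.2.
have mW j : measurable (W j).
  by apply: bigcup_measurable_countable => q; exact: measurable_grid_cube.
have muW j : (mu (W j) <= (N / a)%:E)%E.
  apply: measure_bigcup_le => [q|s sD]; first exact: measurable_grid_cube.
  rewrite EFinM lee_pdivlMr// muleC; apply: le_trans mass_bound.
  have mU : measurable (\big[setU/set0]_(q <- s) tcube (R := R) q.1 q.2).
    by apply: bigsetU_measurable => q _; exact: measurable_grid_cube.
  apply: (@le_trans _ _ (mass phi (\big[setU/set0]_(q <- s) tcube q.1 q.2))).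
    apply: (@laminar_bigsetU_le _ _ _ _ _ (fun A => a%:E * mu A)%E (mass phi)).
    - by move=> q; exact: measurable_grid_cube.
    - move=> q q' /sD[jq _] /sD[jq' _].
      have [E|/set0P[x [xq xq']]] :=
        eqVneq (tcube (R := R) q.1 q.2 `&` tcube q'.1 q'.2) set0.
        by constructor 3.
      have [kk|kk] := leP q.1 q'.1; [constructor 1|constructor 2].
        exact: (tlattice_laminar jq jq' xq xq').
      exact: (tlattice_laminar jq' jq xq' xq (ltW kk)).
    - by rewrite measure0 mule0.
    - exact: mass_ge0.
    - by move=> A B mA mB AB; rewrite measureU// ge0_muleDr.
    - by move=> A B mA mB AB; rewrite massU.
    - by move=> q /sD[_ /ltW]; rewrite mu_tcube EFinM.
  by apply: mass_le.
have sub : maximal_above `<=` \big[setU/set0]_(j <- enum {ffun 'I_n -> 'I_3}) W j.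
  move=> x [k h]; have [j jp] := exists_mod3_class k [ffun i => idx k x i - 1].
  apply/bigcup_seqE; exists j; first by rewrite mem_enum.
  exists (k, idx k x) => //; exact/dcube_sub_tcube/dcube_idx.
apply: (@le_trans _ _ (mu (\big[setU/set0]_(j <- enum {ffun 'I_n -> 'I_3}) W j))).
  apply: le_measure; rewrite ?inE//; first exact: measurable_maximal_above.
  by apply: bigsetU_measurable.
apply: (le_trans (measure_bigsetU_le _ _ mW)).
apply: (@le_trans _ _ (\sum_(j <- enum {ffun 'I_n -> 'I_3}) (N / a)%:E)%E).
  by apply: lee_sum => j _; exact: muW.
rewrite sumEFin big_const_seq count_predT -cardE card_ffun !card_ord iter_addr_0.
by rewrite mulr_natl.
Qed.

End maximal.

(** * Kernels under the Dini condition *)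

Section euclidean_norm.
Context {R : realType} {n : nat}.
Implicit Types z : 'rV[R]_n.

Lemma enorm_ge0 z : 0 <= enorm z.
Proof. exact: sqrtr_ge0. Qed.

Lemma enormN z : enorm (- z) = enorm z.
Proof. by congr Num.sqrt; apply: eq_bigr => i _; rewrite mxE sqrrN. Qed.

Lemma enormBC (x y : 'rV[R]_n) : enorm (x - y) = enorm (y - x).
Proof. by rewrite -enormN opprB. Qed.

Lemma coord_le_enorm z i : `|z 0 i| <= enorm z.
Proof.
rewrite -sqrtr_sqr; apply: ler_wsqrtr; rewrite (bigD1 i)//= lerDl.
by apply: sumr_ge0 => j _; exact: sqr_ge0.
Qed.

Lemma enorm_le z (M : R) : 0 <= M -> (forall i, `|z 0 i| <= M) ->
  enorm z <= n%:R * M.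
Proof.
move=> M0 h; have nM : 0 <= n%:R * M by rewrite mulr_ge0.
rewrite -[leRHS]ger0_norm// -sqrtr_sqr; apply: ler_wsqrtr.
apply: (@le_trans _ _ (\sum_(i < n) M ^+ 2)).
  by apply: ler_sum => i _; rewrite -real_normK ?num_real// lerXn2r// nnegrE.
rewrite sumr_const card_ord -[leLHS]mulr_natl exprMn; apply: ler_wpM2r; first exact: sqr_ge0.
by rewrite -natrX ler_nat; case: n => // m; rewrite expnS expn1 leq_pmulr.
Qed.

Lemma enorm_gt0 z i : z 0 i != 0 -> 0 < enorm z.
Proof. by move=> zi; apply: lt_le_trans (coord_le_enorm z i); rewrite normr_gt0. Qed.

End euclidean_norm.

Section dini_sum.
Context {R : realType}.
Variables (omega : R -> R).
Hypothesis momega : modulus_of_continuity omega.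
Local Notation leb := (@lebesgue_measure R).

Let w j : R := omega (2 ^- j.+1).

Lemma exp_half_itv j : (2 ^- j : R) \in `[0, 1].
Proof. by rewrite in_itv/= invr_ge0 exprn_ge0//= invf_le1 ?exprn_gt0// exprn_ege1// ler1n. Qed.

Lemma omega_half_ge0 j : 0 <= w j.
Proof. by case: momega => _ _ _ _; apply; exact: exp_half_itv. Qed.

(** The sum over dyadic scales is compared with the integral on each
[2 ^-(j + 1), 2 ^-j], where omega (t) / t >= omega (2 ^-(j + 1)) / 2 ^-j. *)
Lemma dini_sum : (\sum_(0 <= j <oo) (w j)%:E <= 2%:E * dini omega)%E.
Proof.
case: momega => cont mono _ _ nneg.
pose I j : set R := `]2 ^- j.+1, 2 ^- j]%classic.
have mI j : measurable (I j) by exact: measurable_itv.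
have halfS j : (2 ^- j.+1 : R) = 2 ^- j / 2 by rewrite exprS invfM mulrC.
have hp j : 0 < (2 ^- j : R) by rewrite invr_gt0 exprn_gt0.
have h1 j : (2 ^- j : R) <= 1 by have := exp_half_itv j; rewrite in_itv/= => /andP[].
have I01 j t : I j t -> 0 < t <= 1.
  rewrite /I/= in_itv/= => /andP[a b]; rewrite (lt_trans (hp _) a)/=.
  exact: le_trans b (h1 _).
have mf : measurable_fun (`]0%R, 1%R]%classic : set R) (fun t : R => (omega t / t)%:E).
  apply/measurable_EFinP; apply: measurable_funM; last first.
    apply: (eq_measurable_fun (fun t : R => t `^ (-1))).
      by move=> t; rewrite inE/= in_itv/= => /andP[/ltW/powR_inv1 ->].
    by apply: measurable_funTS; exact: measurable_powR.
  apply: (@measurable_funS _ _ _ _ (`[0%R, 1%R]%classic : set R)) => //.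
    by move=> t /=; rewrite !in_itv/= => /andP[/ltW -> ->].
  by apply: subspace_continuous_measurable_fun => //; exact: measurable_itv.
have f0 (t : R) : `]0%R, 1%R]%classic t -> (0 <= (omega t / t)%:E)%E.
  rewrite /= in_itv/= => /andP[t0 t1]; rewrite lee_fin.
  apply: divr_ge0; last exact: ltW.
  by apply: nneg; rewrite in_itv/= ltW.
rewrite -lee_pdivrMl// -nneseriesZl; last first.
  by move=> j _; rewrite lee_fin omega_half_ge0.
apply: lime_le; first by apply: is_cvg_nneseries => j _ _; rewrite -EFinM lee_fin mulr_ge0 ?omega_half_ge0.
apply: nearW => N.
pose U := \big[setU/set0]_(j <- iota 0 N) I j.
have U01 : U `<=` `]0%R, 1%R]%classic.
  by move=> t /bigcup_seqE[j _ /I01]; rewrite /= in_itv.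
have mU : measurable U by exact: bigsetU_measurable.
apply: (@le_trans _ _ (\int[leb]_(t in U) (omega t / t)%:E)%E); last first.
  by apply: ge0_subset_integral => //; exact: measurable_itv.
rewrite ge0_integral_bigsetU//; last 4 first.
- exact: iota_uniq.
- apply/trivIsetP => i j _ _ ij; apply/seteqP; split => // t.
  wlog lij : i j ij / (i < j)%N.
    by move: ij; rewrite neq_ltn => /orP[] ij h [a b]; [apply: (h i j)|apply: (h j i)]; rewrite ?ltn_eqF ?gtn_eqF//.
  rewrite /I/= !in_itv/= => -[/andP[a _] /andP[_ b]].
  have : (2 ^- j : R) <= 2 ^- i.+1.
    by rewrite lef_pV2 ?posrE ?exprn_gt0// ler_eXn2l// ltr1n.
  by have := lt_le_trans a b; rewrite ltNge => /negP.
- exact: measurable_funS mf.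
- by move=> t /U01; exact: f0.
rewrite /index_iota subn0; apply: lee_sum => j _.
apply: (@le_trans _ _ (\int[leb]_(t in I j) (cst (w j / 2 ^- j)%:E t))%E).
  have hj : 2 ^- j / 2 < 2 ^- j :> R by have := hp j; lra.
  have e : lebesgue_measure (I j) = (2 ^- j / 2)%:E.
    by rewrite /I lebesgue_measure_itv/= lte_fin halfS hj -EFinB; congr EFin; lra.
  rewrite integral_cst; last exact: mI.
  apply: (@le_trans _ _ ((w j / 2 ^- j)%:E * (2 ^- j / 2)%:E)%E); last first.
    by rewrite -e; exact: lexx.
  rewrite -!EFinM lee_fin le_eqVlt; apply/orP; left; apply/eqP.
  have := hp j; rewrite -[2 ^- j]/((2 ^+ j)^-1) invr_gt0 => h2.
  by field; rewrite gt_eqF.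
apply: ge0_le_integral => //; first exact: mI.
- by move=> t /I01 /andP[t0 t1] ; rewrite lee_fin; apply: divr_ge0; [exact: omega_half_ge0|exact: ltW].
- by apply: measurable_funS mf => // t /I01; rewrite /= in_itv.
- move=> t It; have /andP[t0 t1] := I01 _ _ It.
  move: It; rewrite /I/= in_itv/= => /andP[a b].
  rewrite lee_fin; apply: ler_pM.
  + exact: omega_half_ge0.
  + by rewrite invr_ge0 ltW.
  + by apply: mono; rewrite ?exp_half_itv ?in_itv/= ?(ltW t0)//; exact: ltW.
  + by rewrite lef_pV2 ?posrE.
Qed.

Lemma omega_half_small (D e : R) : (dini omega <= D%:E)%E -> 0 < e ->
  exists N, w N < e.
Proof.
move=> hD e0; have hS := le_trans dini_sum (lee_wpmul2l _ hD).
have {}hS : (\sum_(0 <= j <oo) (w j)%:E <= (2 * D)%:E)%E.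
  by rewrite EFinM; apply: hS.
case: momega => _ mono _ _ _.
have wle i j : (i <= j)%N -> w j <= w i.
  move=> ij; apply: mono; rewrite ?exp_half_itv//.
  by rewrite lef_pV2 ?posrE ?exprn_gt0// ler_eXn2l// ltr1n.
pose N := Num.trunc (2 * D / e).
exists N; rewrite ltNge; apply/negP => eN.
have : ((e * N.+1%:R)%:E <= (2 * D)%:E)%E.
  apply: le_trans hS.
  apply: (@le_trans _ _ (\sum_(0 <= j < N.+1) (w j)%:E)%E); last first.
    by apply: nneseries_lim_ge => j _; rewrite lee_fin omega_half_ge0.
  rewrite sumEFin lee_fin big_mkord mulr_natr -[in leLHS](card_ord N.+1) -sumr_const.
  by apply: ler_sum => i _; apply: (le_trans eN); apply: wle; rewrite -ltnS.
rewrite lee_fin -ler_pdivlMl// => h.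
by have := lt_le_trans (truncnS_gt (2 * D / e)) h; rewrite [ltRHS]mulrC ltxx.
Qed.

End dini_sum.

Section kernel.
Context {R : realType} {n : nat} (n0 : (0 < n)%N).
Variables (omega : R -> R) (CK D : R) (K : 'rV[R]_n -> 'rV[R]_n -> R).
Hypothesis momega : modulus_of_continuity omega.
Hypothesis hD : (dini omega <= D%:E)%E.
Hypothesis hK : cz_kernel omega CK K.
Implicit Types (k : int) (m : {ffun 'I_n -> int}) (x y : 'rV[R]_n).
Local Notation mu := (lebesgue_rV R n).

Lemma CK_ge0 : 0 <= CK.
Proof.
pose x : 'rV[R]_n := const_mx 1.
have xx : x != 0.
  apply/eqP => /rowP /(_ (Ordinal n0)); rewrite !mxE => /eqP.
  by rewrite oner_eq0.
have e0 : 0 < enorm (x - 0).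
  by apply: (enorm_gt0 (i := Ordinal n0)); rewrite !mxE subr0 oner_eq0.
have [/(_ _ _ xx) h _] := hK.
have := le_trans (normr_ge0 _) h.
by rewrite pmulr_lge0// invr_gt0 exprn_gt0.
Qed.

Lemma D_ge0 : 0 <= D.
Proof.
have [_ _ _ _ nneg] := momega.
rewrite -lee_fin; apply: le_trans hD; apply: integral_ge0 => t /=.
rewrite in_itv/= => /andP[t0 t1]; rewrite lee_fin divr_ge0 ?(ltW t0)//.
by apply: nneg; rewrite in_itv/= (ltW t0).
Qed.

(** The regularity estimate makes K x continuous off x; this is the source of
the measurability of the kernel. *)
Lemma kernel_open x (a : R) : open [set y | y != x /\ a < K x y].
Proof.
have [_ hreg] := hK; have [_ mono _ _ _] := momega.
rewrite openE => y [yx aK].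
have [i yi] : exists i, y 0 i != x 0 i.
  have [//|h] := pselect (exists i, y 0 i != x 0 i).
  case/eqP: yx; apply/rowP => i.
  by apply/eqP/negPn/negP => hi; apply: h; exists i.
have r0 : 0 < enorm (y - x) by apply: (enorm_gt0 (i := i)); rewrite !mxE subr_eq0.
set r := enorm (y - x) in r0.
have e0 : 0 < (K x y - a) * r ^+ n by rewrite mulr_gt0 ?exprn_gt0// subr_gt0.
have [N hN] := omega_half_small momega hD e0.
have n1 : 0 < (n%:R : R) by rewrite ltr0n.
(* Balls are those of the sup norm; the factor n compares it with enorm. *)
pose d := r * 2 ^- N.+1 / (n%:R * 2).
have p2 : 0 < (2 ^- N.+1 : R) by rewrite invr_gt0 exprn_gt0.
have d0 : 0 < d by rewrite divr_gt0 ?mulr_gt0.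
apply/nbhs_ballP; exists d => //= z [_ yz].
have hz : enorm (y - z) <= r * 2 ^- N.+1 / 2.
  have -> : r * 2 ^- N.+1 / 2 = n%:R * d.
    rewrite /d; move: (2 ^- N.+1 : R) => q; field; lra.
  apply: enorm_le; first exact: ltW.
  by move=> l; rewrite !mxE; apply: ltW; exact: (yz 0 l).
set q : R := 2 ^- N.+1 in p2 d d0 hz yz.
have q1 : q <= 1 / 2.
  by rewrite /q exprS invfM div1r ler_piMr ?invr_ge0// invf_le1 ?exprn_gt0// exprn_ege1// ler1n.
have rq : r * q <= r / 2 by rewrite ler_pM2l//; lra.
have rq0 : 0 < r * q by rewrite mulr_gt0.
have hzr : 2 * enorm (y - z) <= r * q by lra.
have zx : z != x.
  by apply/eqP => zx; move: hzr rq r0; rewrite zx -/r; lra.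
split=> //=.
have /hreg : 2 * enorm (y - z) < enorm (y - x) by rewrite -/r; lra.
rewrite -/r => h.
have h2 : omega (enorm (y - z) / r) <= omega q.
  have e1 : enorm (y - z) / r <= q by rewrite ler_pdivrMr// mulrC; lra.
  apply: mono => //.
    rewrite in_itv/= divr_ge0 ?enorm_ge0 ?(ltW r0)//=.
    by apply: (le_trans e1); lra.
  by rewrite in_itv/=; apply/andP; split; lra.
have {}h2 : omega (enorm (y - z) / r) / r ^+ n < K x y - a.
  by rewrite ltr_pdivrMr ?exprn_gt0//; apply: le_lt_trans h2 hN.
have := ler_norm (K x y - K x z); have := normr_ge0 (K y x - K z x).
move: h h2; move: (omega _ / _) `|_| `|_| => *; lra.
Qed.

Lemma measurable_setC1 x : measurable (~` [set x]).
Proof.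
apply: open_measurable_rV; apply: closed_openC.
exact/accessible_closed_set1/hausdorff_accessible/norm_hausdorff.
Qed.

Lemma measurable_kernel x : measurable_fun (~` [set x]) (K x).
Proof.
have mD := measurable_setC1 x.
apply: (measurability _ (RGenOInfty.measurableE R)) => //.
move=> _ [_ [a ->] <-].
rewrite (_ : _ `&` _ = [set y | y != x /\ a < K x y]).
  apply: open_measurable_rV; exact: kernel_open.
by apply/seteqP; split => y /=; rewrite in_itv/= andbT => -[yx h]; split=> //; exact/eqP.
Qed.

(** The triple of the i-th dyadic ancestor of the cube (k, m). *)
Definition anc k m (i : nat) : set 'rV[R]_n :=
  tcube (k + i%:Z) (idx (k + i%:Z) (grid_corner (R := R) k m)).

Lemma anc_idx k m i x : dcube k m x -> anc k m i = tcube (k + i%:Z) (idx (k + i%:Z) x).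
Proof.
move=> /dcubeP xm; rewrite /anc; congr tcube; apply: idx_anc.
by rewrite xm; apply/dcubeP; exact: grid_cube_corner.
Qed.

Lemma anc0 k m : anc k m 0 = tcube k m.
Proof. by rewrite /anc addr0; congr tcube; apply/dcubeP; exact: grid_cube_corner. Qed.

Lemma measurable_anc k m i : measurable (anc k m i).
Proof. exact: measurable_grid_cube. Qed.

Lemma anc_sub k m i j : (i <= j)%N -> anc k m i `<=` anc k m j.
Proof. exact: tcube_anc. Qed.

Lemma notin_anc_dist k m i x y : dcube k m x -> ~ anc k m i y ->
  side (k + i%:Z) < enorm (x - y).
Proof.
move=> xm; rewrite (anc_idx _ xm) => /notin_tcube_dist[l hl].
by apply: (lt_le_trans hl); have := coord_le_enorm (x - y) l; rewrite !mxE.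
Qed.

Lemma dcube_enorm k m x y : dcube k m x -> dcube k m y -> enorm (x - y) <= n%:R * side k.
Proof.
move=> /dcubeP xm /dcubeP ym; apply: enorm_le; first exact: side_ge0.
by move=> i; rewrite !mxE; apply/ltW/dcube_dist; rewrite xm ym.
Qed.

Lemma kernel_near k m x y : dcube k m x -> ~ tcube k m y ->
  `|K x y| <= CK / side k ^+ n /\ `|K y x| <= CK / side k ^+ n.
Proof.
move=> xm; rewrite -anc0 => /(notin_anc_dist xm); rewrite addr0 => h.
have [hs _] := hK.
have s0 := side_gt0 (R := R) k.
have xy : x != y.
  apply/eqP => xy; move: h; rewrite xy subrr.
  have -> : enorm (0 : 'rV[R]_n) = 0.
    by rewrite /enorm big1 ?sqrtr0// => i _; rewrite mxE expr0n.
  by rewrite ltNge side_ge0.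
have yx : y != x by rewrite eq_sym.
have := hs _ _ xy; have := hs _ _ yx; rewrite enormBC => h1 h2.
suff le : CK / enorm (x - y) ^+ n <= CK / side k ^+ n.
  by split; apply: le_trans le.
rewrite ler_wpM2l ?CK_ge0//.
rewrite lef_pV2 ?posrE ?exprn_gt0// ?(lt_trans s0)//.
by rewrite lerXn2r// ?nnegrE ?enorm_ge0 ?(ltW s0) ?(ltW h).
Qed.

(** On the j-th annulus, points x, x' of the cube of generation k are closer to
each other than 2 ^-(j + 1) times the distance to y.  The first n + 1 tripled
ancestors are left out, to absorb the ratio n <= 2 ^ n between the Euclidean
and the sup norm. *)
Definition annulus_bound k (j : nat) : R := omega (2 ^- j.+1) / side (k + (n + j.+1)%N%:Z) ^+ n.

Definition annulus k m j := anc k m (n + j.+2) `\` anc k m (n + j.+1).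

(** A majorant, in the variable y, of the variation of K x y and K y x as x runs
over the cube (k, m): see [kernel_le_majorant]. *)
Definition osc_majorant k m y : \bar R := (\sum_(0 <= j <oo) (annulus_bound k j * \1_(annulus k m j) y)%:E)%E.

Lemma annulus_bound_ge0 k j : 0 <= annulus_bound k j.
Proof. by rewrite divr_ge0 ?(omega_half_ge0 momega)// exprn_ge0// side_ge0. Qed.

Lemma kernel_annulus k m j x x' y : dcube k m x -> dcube k m x' ->
  ~ anc k m (n + j.+1) y ->
  `|K x y - K x' y| + `|K y x - K y x'| <= annulus_bound k j.
Proof.
move=> xm xm' /(notin_anc_dist xm) h.
have [_ hreg] := hK; have [_ mono _ _ nneg] := momega.
set r := enorm (x - y) in h *; set s := side _ in h.
have s0 : 0 < s by exact: side_gt0.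
have hs : s = 2 ^+ (n + j.+1) * side k by rewrite /s sideD.
have k0 : 0 < side k :> R by exact: side_gt0.
have hx := dcube_enorm xm xm'.
have nn : (n%:R : R) <= 2 ^+ n by rewrite -natrX ler_nat ltnW// ltn_expl.
have j0 : 0 < (2 ^+ j.+1 : R) by rewrite exprn_gt0.
have hx2 : enorm (x - x') * 2 ^+ j.+1 <= s.
  rewrite hs exprD; apply: le_trans (_ : n%:R * side k * 2 ^+ j.+1 <= _).
    by rewrite ler_pM2r.
  by rewrite mulrAC ler_pM2r// ler_pM2r.
have hx3 : enorm (x - x') / r <= 2 ^- j.+1.
  rewrite ler_pdivrMr ?(lt_trans s0)// -ler_pdivrMl ?invr_gt0// invrK mulrC.
  by apply: (le_trans hx2); exact: ltW.
have hlt : 2 * enorm (x - x') < r.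
  apply: le_lt_trans h; apply: le_trans hx2; rewrite mulrC ler_wpM2l ?enorm_ge0//.
  by rewrite exprS -[leLHS]mulr1 ler_pM2l// exprn_ege1// ler1n.
apply: (le_trans (hreg _ _ _ hlt)); apply: ler_pM.
- apply: nneg; rewrite in_itv/= divr_ge0 ?enorm_ge0//=.
  by apply: (le_trans hx3); have := exp_half_itv (R := R) j.+1; rewrite in_itv/= => /andP[].
- by rewrite invr_ge0 exprn_ge0// enorm_ge0.
- apply: mono => //; last exact: exp_half_itv.
  rewrite in_itv/= divr_ge0 ?enorm_ge0//=.
  by apply: (le_trans hx3); have := exp_half_itv (R := R) j.+1; rewrite in_itv/= => /andP[].
- rewrite lef_pV2 ?posrE ?exprn_gt0// ?(lt_trans s0)//.
  by rewrite lerXn2r// ?nnegrE ?enorm_ge0 ?(ltW s0) ?(ltW h).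
Qed.

Lemma kernel_le_majorant k m x x' y : dcube k m x -> dcube k m x' -> ~ anc k m n.+1 y ->
  ((`|K x y - K x' y| + `|K y x - K y x'|)%:E <= osc_majorant k m y)%E.
Proof.
move=> xm xm' ny.
(* The least tripled ancestor containing y determines its annulus. *)
have [i hi] := tcube_exhaust k (grid_corner (R := R) k m) y.
have ex : exists j, `[< anc k m (n + j.+2) y >].
  by exists i; apply/asboolP; apply: anc_sub hi; lia.
case: (ex_minnP ex) => j /asboolP hj hmin.
have nj : ~ anc k m (n + j.+1) y.
  case: j hj hmin => [|j] hj hmin; first by rewrite addn1.
  by move=> h; have := hmin j (asboolT h); rewrite ltnn.
apply: (@le_trans _ _ (annulus_bound k j * \1_(annulus k m j) y)%:E).
  rewrite indicE mem_set// mulr1 lee_fin; exact: (kernel_annulus xm xm').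
have nn l : (0 <= (annulus_bound k l * \1_(annulus k m l) y)%:E)%E.
  by rewrite lee_fin mulr_ge0// annulus_bound_ge0.
rewrite /osc_majorant; apply: (@le_trans _ _ (\sum_(0 <= l < j.+1) (annulus_bound k l * \1_(annulus k m l) y)%:E)%E).
  rewrite big_nat_recr//= leeDr// sume_ge0// => l _; exact: nn.
by apply: nneseries_lim_ge => l _.
Qed.

Lemma measurable_annulus k m j : measurable (annulus k m j).
Proof. by apply: measurableD; exact: measurable_anc. Qed.

Lemma osc_majorant_ge0 k m y : (0 <= osc_majorant k m y)%E.
Proof. by apply: nneseries_ge0 => j _ _; rewrite lee_fin mulr_ge0// annulus_bound_ge0. Qed.

Lemma measurable_osc_majorant k m : measurable_fun setT (osc_majorant k m).
Proof.
apply: ge0_emeasurable_sum => // j; first by move=> x _ _; rewrite lee_fin mulr_ge0// annulus_bound_ge0.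
move=> _; apply/measurable_EFinP; apply: measurable_funM => //.
by apply: measurable_indic; exact: measurable_annulus.
Qed.

(** The j-th annulus contributes omega (2 ^-(j + 1)) times the average of phi
over a tripled ancestor, and the Dini condition sums these contributions. *)
Lemma integral_majorant_le k m (phi : 'rV[R]_n -> R) (B : R) : measurable_fun setT phi -> (forall y, 0 <= phi y) ->
  (forall i, (mass phi (anc k m i) <= (B * (3 * side (k + i%:Z)) ^+ n)%:E)%E) ->
  (\int[mu]_y (osc_majorant k m y * (phi y)%:E) <= (2 * 6 ^+ n * D * B)%:E)%E.
Proof.
move=> mphi phi0 hB.
have B0 : 0 <= B.
  have := le_trans (mass_ge0 phi0 _) (hB 0%N); rewrite lee_fin.
  by rewrite pmulr_lge0// exprn_gt0// mulr_gt0// side_gt0.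
have nn j y : (0 <= (annulus_bound k j * \1_(annulus k m j) y * phi y)%:E)%E.
  rewrite lee_fin; apply: mulr_ge0 => //; apply: mulr_ge0 => //; exact: annulus_bound_ge0.
have -> : (\int[mu]_y (osc_majorant k m y * (phi y)%:E) =
  \sum_(0 <= j <oo) \int[mu]_y (annulus_bound k j * \1_(annulus k m j) y * phi y)%:E)%E.
  rewrite -integral_nneseries//; last 1 first.
  - move=> j; apply/measurable_EFinP; apply: measurable_funM => //.
    apply: measurable_funM => //.
    by apply: measurable_indic; exact: measurable_annulus.
  apply: eq_integral => y _; rewrite muleC /osc_majorant -nneseriesZl.
    by apply: eq_eseriesr => j _; rewrite -EFinM mulrC.
  by move=> j _; rewrite lee_fin mulr_ge0// annulus_bound_ge0.
apply: (@le_trans _ _ (\sum_(0 <= j <oo) ((B * 6 ^+ n)%:E * (omega (2 ^- j.+1))%:E))%E).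
  apply: lee_nneseries => j; first by move=> *; apply: integral_ge0 => y _; exact: nn.
  move=> _; apply: (@le_trans _ _ ((annulus_bound k j)%:E * mass phi (annulus k m j))%E).
    rewrite /mass [in leRHS]integral_mkcond -ge0_integralZl//.
    - apply: ge0_le_integral => //.
      + apply/measurable_EFinP; apply: measurable_funM => //.
        apply: measurable_funM => //.
        by apply: measurable_indic; exact: measurable_annulus.
      + apply: measurable_funeM; apply/(measurable_restrictT _ (measurable_annulus k m j)).
        by apply/measurable_EFinP; exact: measurable_funTS.
      + move=> y _; rewrite patchE indicE; case: ifPn => _; rewrite ?mulr1 ?mulr0 ?mul0r ?mule0//.
    - apply/(measurable_restrictT _ (measurable_annulus k m j)).
      by apply/measurable_EFinP; exact: measurable_funTS.
    - by move=> y _; rewrite erestrict_ge0// => z _; rewrite lee_fin.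
    - by rewrite lee_fin annulus_bound_ge0.
  have h : (mass phi (annulus k m j) <= (B * (3 * side (k + (n + j.+2)%N%:Z)) ^+ n)%:E)%E.
    apply: le_trans (hB _); apply: mass_le => //;
      [exact: measurable_annulus|exact: measurable_anc|by move=> y []].
  apply: (le_trans (lee_wpmul2l _ h)); first by rewrite lee_fin annulus_bound_ge0.
  rewrite -!EFinM lee_fin /annulus_bound.
  have -> : k + (n + j.+2)%N%:Z = k + (n + j.+1)%N%:Z + 1 by lia.
  rewrite sideS mulrA -natrM !exprMn.
  have : side (k + (n + j.+1)%N%:Z) ^+ n != 0 :> R by rewrite expf_neq0// side_neq0.
  move: (side _ ^+ n) => s s0.
  rewrite le_eqVlt; apply/orP; left; apply/eqP.
  by move: (_ ^+ n) (omega _) => *; field.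
rewrite nneseriesZl; last by move=> j _; rewrite lee_fin (omega_half_ge0 momega).
have hS := dini_sum momega.
apply: (@le_trans _ _ ((B * 6 ^+ n)%:E * (2%:E * D%:E))%E).
  apply: lee_wpmul2l; first by rewrite lee_fin mulr_ge0// exprn_ge0.
  by apply: (le_trans hS); apply: lee_wpmul2l.
by rewrite -!EFinM lee_fin; lra.
Qed.

End kernel.

Definition absf (T : Type) (R : realType) (h : T -> R) : T -> R := fun y => `|h y|.

Section kernel_integrals.
Context {R : realType} {n : nat} (n0 : (0 < n)%N).
Variables (omega : R -> R) (CK D : R) (K : 'rV[R]_n -> 'rV[R]_n -> R).
Hypothesis momega : modulus_of_continuity omega.
Hypothesis hD : (dini omega <= D%:E)%E.
Hypothesis hK : cz_kernel omega CK K.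
Implicit Types (k : int) (m : {ffun 'I_n -> int}) (x y : 'rV[R]_n).
Implicit Types h : 'rV[R]_n -> R.
Local Notation mu := (lebesgue_rV R n).

Lemma kernel_integrable_gen (G : set 'rV[R]_n) (M : R) x h :
  measurable G -> ~ G x -> 0 <= M -> (forall y, G y -> `|K x y| <= M) ->
  mu.-integrable setT (EFin \o h) -> (forall y, ~ G y -> h y = 0) ->
  mu.-integrable setT (fun y => (K x y * h y)%:E) /\
  (\int[mu]_y `|K x y * h y|%:E <= M%:E * \int[mu]_y `|h y|%:E)%E.
Proof.
move=> mG Gx M0 KM ih h0.
have mK : measurable_fun setT (K x \_ G).
  apply/(measurable_restrictT _ mG).
  apply: (@measurable_funS _ _ _ _ (~` [set x])); [exact: measurable_setC1| |].
    by move=> y Gy /= yx; apply: Gx; rewrite -yx.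
  exact: (measurable_kernel n0 momega hD hK).
have KE y : K x y * h y = (K x \_ G) y * h y.
  rewrite patchE; case: ifPn => // /negP; rewrite inE => /h0 ->.
  by rewrite !mulr0.
have mh : measurable_fun setT h.
  by case/integrableP: ih => /measurable_EFinP.
have mKh : measurable_fun setT (fun y => K x y * h y).
  by under eq_fun => y do rewrite KE; exact: measurable_funM.
have le y : `|K x y * h y| <= M * `|h y|.
  have [Gy|/h0 ->] := pselect (G y); last by rewrite mulr0 normr0 mulr0.
  by rewrite normrM ler_wpM2r// KM.
split.
  apply: (@le_integrable _ _ _ _ _ _ _ (fun y => (M * h y)%:E)) => //.
  - exact/measurable_EFinP.
  - by move=> y _; rewrite /= lee_fin [leRHS]normrM (ger0_norm M0).
  - by under eq_fun => y do rewrite EFinM; exact: integrableZl.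
rewrite -ge0_integralZl//; last first.
  by apply/measurable_EFinP; exact: measurableT_comp.
apply: ge0_le_integral => //.
- by apply/measurable_EFinP; exact: measurableT_comp.
- by apply: measurable_funeM; apply/measurable_EFinP; exact: measurableT_comp.
- by move=> y _; rewrite -EFinM lee_fin; exact: le.
Qed.

Lemma le_normr_RintegralT (g : 'rV[R]_n -> R) (M : R) :
  mu.-integrable setT (EFin \o g) ->
  (\int[mu]_y `|g y|%:E <= M%:E)%E -> `|\int[mu]_y g y| <= M.
Proof.
move=> ig hM; rewrite -lee_fin EFin_normr_Rintegral//.
apply: le_trans hM; apply: le_abse_integral => //.
by case/integrableP: ig.
Qed.

Section away.
Variables (k : int) (m : {ffun 'I_n -> int}) (h : 'rV[R]_n -> R).
Hypothesis ih : mu.-integrable setT (EFin \o h).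
Hypothesis h0 : forall y, tcube k m y -> h y = 0.

Lemma kernel_away x : dcube k m x ->
  mu.-integrable setT (fun y => (K x y * h y)%:E) /\
  (\int[mu]_y `|K x y * h y|%:E <= (CK / side k ^+ n)%:E * \int[mu]_y `|h y|%:E)%E.
Proof.
move=> xm; apply: (@kernel_integrable_gen (~` tcube k m)) => //.
- by apply: measurableC; exact: measurable_grid_cube.
- by apply; exact: dcube_sub_tcube.
- by rewrite divr_ge0 ?(CK_ge0 n0 hK)// exprn_ge0// side_ge0.
- by move=> y ny; have [] := kernel_near n0 hK xm ny.
- by move=> y /contrapT; exact: h0.
Qed.

(** The oscillation property for the kernel integral.  Close to the cube, that
is, on the tripled ancestor of order n + 1, the size of the kernel is enough;
beyond it the regularity is used, through the majorant. *)
Lemma kernel_osc (B : R) x x' : dcube k m x -> dcube k m x' ->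
  (forall i, (mass (absf h) (anc k m i) <= (B * (3 * side (k + i%:Z)) ^+ n)%:E)%E) ->
  `|\int[mu]_y (K x y * h y) - \int[mu]_y (K x' y * h y)| <=
  2 * (6 * 2 ^+ n) ^+ n * (CK + D) * B.
Proof.
move=> xm xm' hB.
have mh : measurable_fun setT h by case/integrableP: ih => /measurable_EFinP.
have mnh : measurable_fun setT (absf h) by exact: measurableT_comp.
have nh0 y : 0 <= absf h y by exact: normr_ge0.
have B0 : 0 <= B.
  have := le_trans (mass_ge0 nh0 _) (hB 0%N); rewrite lee_fin.
  by rewrite pmulr_lge0// exprn_gt0// mulr_gt0// side_gt0.
have [ix _] := kernel_away xm; have [ix' _] := kernel_away xm'.
have sk : 0 < side k ^+ n :> R by rewrite exprn_gt0// side_gt0.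
have CK0 := CK_ge0 n0 hK; have D0 := D_ge0 momega hD.
rewrite -RintegralB//.
have ig : mu.-integrable setT (EFin \o (fun y => K x y * h y - K x' y * h y)).
  exact: (integrableB measurableT ix ix').
apply: le_normr_RintegralT => //.
pose c : R := CK / side k ^+ n + CK / side k ^+ n.
have c0 : 0 <= c by rewrite addr_ge0// divr_ge0// ltW.
pose A := anc (R := R) k m n.+1.
have mA : measurable A by exact: measurable_anc.
have mV : measurable_fun setT (fun y => osc_majorant omega k m y * (`|h y|%:E))%E.
  apply: emeasurable_funM; last exact/measurable_EFinP.
  exact: (measurable_osc_majorant momega).
have mcA : measurable_fun setT (fun y => (c * \1_A y * `|h y|)%:E).
  apply/measurable_EFinP; apply: measurable_funM => //.
  by apply: measurable_funM => //; exact: measurable_indic.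
apply: (@le_trans _ _ (\int[mu]_y ((c * \1_A y * `|h y|)%:E + osc_majorant omega k m y * (`|h y|%:E))%E)%E).
  apply: ge0_le_integral => //.
  - apply/measurable_EFinP; apply: measurableT_comp => //.
    by case/integrableP: ig => /measurable_EFinP.
  - exact: emeasurable_funD.
  - move=> y _.
    have [ty|nty] := pselect (tcube k m y).
      rewrite (h0 ty) !mulr0 subrr normr0 mulr0 mule0 adde0//.
    have [Ay|nAy] := pselect (A y).
      apply: (@le_trans _ _ (c * \1_A y * `|h y|)%:E); last first.
        by rewrite leeDl// mule_ge0// (osc_majorant_ge0 momega).
      rewrite lee_fin indicE mem_set// mulr1 -mulrBl normrM ler_wpM2r//.
      apply: (le_trans (ler_normB _ _)).
      have [l1 _] := kernel_near n0 hK xm nty; have [l2 _] := kernel_near n0 hK xm' nty.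
      exact: lerD.
    apply: (@le_trans _ _ (osc_majorant omega k m y * `|h y|%:E)%E); last first.
      by rewrite leeDr// lee_fin !mulr_ge0.
    rewrite -mulrBl normrM EFinM; apply: lee_wpmul2r; first by rewrite lee_fin.
    apply: le_trans (kernel_le_majorant n0 momega hD hK xm xm' nAy).
    by rewrite lee_fin lerDl.
rewrite ge0_integralD//; last 2 first.
- by move=> y _; rewrite lee_fin !mulr_ge0.
- by move=> y _; rewrite mule_ge0// (osc_majorant_ge0 momega).
have hV := integral_majorant_le n0 momega hD mnh nh0 hB.
apply: (le_trans (leeD2l _ hV)).
have hA : (\int[mu]_y (c * \1_A y * `|h y|)%:E <= (c * (B * (3 * side (k + n.+1%:Z)) ^+ n))%:E)%E.
  rewrite EFinM; apply: le_trans (lee_wpmul2l _ (hB n.+1)); last by rewrite lee_fin.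
  rewrite /mass [in leRHS]integral_mkcond -ge0_integralZl//.
  - apply: ge0_le_integral => //.
    + by move=> y _; rewrite lee_fin; apply: mulr_ge0 => //; apply: mulr_ge0.
    + apply: measurable_funeM; apply/(measurable_restrictT _ mA).
      by apply/measurable_EFinP; exact: measurable_funTS.
    + move=> y _; rewrite patchE indicE -/A; case: ifPn => _; rewrite ?mulr1 ?mulr0 ?mul0r ?mule0//.
  - apply/(measurable_restrictT _ mA).
    by apply/measurable_EFinP; exact: measurable_funTS.
  - by move=> y _; rewrite erestrict_ge0// => z _; rewrite lee_fin.
apply: (le_trans (leeD2r _ hA)).
have eX : (3 * side (k + n.+1%:Z)) ^+ n = (6 * 2 ^+ n) ^+ n * side k ^+ n :> R.
  by rewrite sideD -exprMn; congr (_ ^+ n); rewrite exprS; ring.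
rewrite -EFinD lee_fin eX /c.
set s := side k ^+ n in sk *.
have : 6 ^+ n <= (6 * 2 ^+ n) ^+ n :> R.
  rewrite lerXn2r// ?nnegrE// ?mulr_ge0// ?exprn_ge0// -[leLHS]mulr1.
  by rewrite ler_pM2l// exprn_ege1// ler1n.
set P := (6 * 2 ^+ n) ^+ n; set Q := 6 ^+ n => PQ.
have : 0 <= D * B * (P - Q).
  by apply: mulr_ge0; [exact: mulr_ge0|rewrite subr_ge0].
have -> : (CK / s + CK / s) * (B * (P * s)) = 2 * CK * B * P.
  by field; rewrite gt_eqF.
lra.
Qed.

End away.

(** Since h has integral zero, the kernel may be replaced by its difference with
the value at a fixed point of the cube. *)
Lemma kernel_cancel k m h x : mu.-integrable setT (EFin \o h) ->
  (forall y, ~ dcube k m y -> h y = 0) -> \int[mu]_y h y = 0 ->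
  ~ anc k m n.+1 x ->
  (`|\int[mu]_y (K x y * h y)|%:E <= osc_majorant omega k m x * \int[mu]_y `|h y|%:E)%E.
Proof.
move=> ih h0 hint nx.
have ntx : ~ tcube k m x.
  by move=> tx; apply: nx; apply: (anc_sub (i := 0)) => //; rewrite anc0.
have mh : measurable_fun setT h by case/integrableP: ih => /measurable_EFinP.
have ndx : ~ dcube k m x by move=> /dcube_sub_tcube.
have [iK _] : mu.-integrable setT (fun y => (K x y * h y)%:E) /\
    (\int[mu]_y `|K x y * h y|%:E <= (CK / side k ^+ n)%:E * \int[mu]_y `|h y|%:E)%E.
  apply: (@kernel_integrable_gen (dcube k m)) => //.
  - exact: measurable_grid_cube.
  - by rewrite divr_ge0 ?(CK_ge0 n0 hK)// exprn_ge0// side_ge0.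
  - by move=> y ym; have [] := kernel_near n0 hK ym ntx.
pose c := grid_corner (R := R) k m; have cm : dcube k m c by exact: grid_cube_corner.
have ic : mu.-integrable setT (EFin \o (fun y => K x c * h y)).
  exact: (integrableZl measurableT (K x c) ih).
have -> : \int[mu]_y (K x y * h y) = \int[mu]_y (K x y * h y - K x c * h y).
  by rewrite RintegralB// RintegralZl// hint mulr0 subr0.
have ig : mu.-integrable setT (EFin \o (fun y => K x y * h y - K x c * h y)).
  exact: (integrableB measurableT iK ic).
have mah : measurable_fun setT (fun y => `|h y|%:E).
  by apply/measurable_EFinP; exact: measurableT_comp.
rewrite EFin_normr_Rintegral//.
apply: (le_trans (le_abse_integral _ _ _)) => //; first by case/integrableP: ig.
rewrite -ge0_integralZl//; last exact: (osc_majorant_ge0 momega).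
apply: ge0_le_integral => //.
- by apply: measurableT_comp => //; case/integrableP: ig.
- exact: measurable_funeM.
- move=> y _ /=; rewrite -mulrBl normrM EFinM.
  have [ym|/h0 ->] := pselect (dcube k m y); last by rewrite normr0 !mule0.
  apply: lee_wpmul2r; first by rewrite lee_fin.
  apply: le_trans (kernel_le_majorant n0 momega hD hK ym cm nx).
  by rewrite lee_fin lerDr.
Qed.

End kernel_integrals.

(** * Square-integrable functions and bounded operators *)

Section density_measure.
Context {R : realType} {n : nat}.
Local Notation mu := (lebesgue_rV R n).
Variable phi : 'rV[R]_n -> R.
Hypothesis mphi : measurable_fun setT phi.
Hypothesis phi0 : forall x, 0 <= phi x.

(** The measure with density phi.  The proofs are arguments of the definition
so that the measure structure can be inferred from the term. *)
Definition dens (_ : measurable_fun setT phi) (_ : forall x, 0 <= phi x) :=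
  mass phi.

Let dens0 : dens mphi phi0 set0 = 0%E.
Proof. by rewrite /dens /mass integral_set0. Qed.

Let dens_ge0 A : (0 <= dens mphi phi0 A)%E.
Proof. exact: mass_ge0. Qed.

Let dens_sigma_additive : semi_sigma_additive (dens mphi phi0).
Proof.
move=> F mF tF mUF; rewrite /dens /mass ge0_integral_bigcup//.
- apply: is_cvg_ereal_nneg_natsum_cond => i _ _.
  by apply: integral_ge0 => x _; rewrite lee_fin.
- by apply/measurable_EFinP; exact: measurable_funTS.
- by move=> x _; rewrite lee_fin.
Qed.

HB.instance Definition _ := isMeasure.Build _ _ _ (dens mphi phi0)
  dens0 dens_ge0 dens_sigma_additive.

End density_measure.

Section l2.
Context {R : realType} {n : nat}.
Local Notation mu := (lebesgue_rV R n).
Implicit Types f g : 'rV[R]_n -> R.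

(** The square of the L^2 norm, which avoids real powers in computations. *)
Definition sqn f : \bar R := (\int[mu]_x (f x ^+ 2)%:E)%E.

Lemma sqn_ge0 f : (0 <= sqn f)%E.
Proof. by apply: integral_ge0 => x _; rewrite lee_fin sqr_ge0. Qed.

Lemma Lnorm2E f : ('N[mu]_2%:E[EFin \o f] = (sqn f) `^ (2^-1))%E.
Proof.
rewrite unlock /Lnorm; congr (_ `^ _)%E; apply: eq_integral => x _ /=.
by rewrite powR_mulrn// real_normK// num_real.
Qed.

Lemma Lnorm2_sqrt f s : sqn f = s%:E -> ('N[mu]_2%:E[EFin \o f] = (Num.sqrt s)%:E)%E.
Proof.
move=> fs; have : (0 <= s%:E)%E by rewrite -fs sqn_ge0.
by rewrite lee_fin Lnorm2E fs poweR_EFin => s0; rewrite powR12_sqrt.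
Qed.

Lemma L2_measurable f (p : \bar R) : f \in Lfun mu p -> measurable_fun setT f.
Proof. by rewrite inE => /andP[+ _]; rewrite inE. Qed.

Lemma L2_sqn f : f \in Lfun mu 2%:E -> exists s, sqn f = s%:E.
Proof.
move=> /Lfun2_integrable_sqr/integrable_fin_num => /(_ measurableT) h.
by exists (fine (sqn f)); rewrite fineK.
Qed.

Lemma sqn_L2 f : measurable_fun setT f -> (sqn f < +oo)%E -> f \in Lfun mu 2%:E.
Proof.
move=> mf foo; rewrite inE; apply/andP; split; rewrite inE//=.
by rewrite /finite_norm Lnorm2E poweR_lty.
Qed.

Lemma L2_0 : (fun=> 0) \in Lfun mu 2%:E.
Proof.
apply: sqn_L2 => //; rewrite /sqn; under eq_integral do rewrite expr0n.
by rewrite integral0.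
Qed.

Lemma sqn_scale c f : measurable_fun setT f ->
  sqn (fun x => c * f x) = ((c ^+ 2)%:E * sqn f)%E.
Proof.
move=> mf; rewrite /sqn -ge0_integralZl_EFin//.
- by apply: eq_integral => x _; rewrite exprMn.
- by move=> x _; rewrite lee_fin sqr_ge0.
- by apply/measurable_EFinP; exact: measurable_funX.
- exact: sqr_ge0.
Qed.

Lemma sqn_eq0 f : measurable_fun setT f -> sqn f = 0%E ->
  {ae mu, forall x, f x = 0}.
Proof.
move=> mf f0.
have mf2 : measurable_fun setT (fun x => (f x ^+ 2)%:E).
  by apply/measurable_EFinP; exact: measurable_funX.
have /(ae_eq_integral_abs _ measurableT mf2) : (\int[mu]_x `|(f x ^+ 2)%:E| = 0)%E.
  by rewrite -f0; apply: eq_integral => x _; rewrite gee0_abs// lee_fin sqr_ge0.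
apply: filterS => x /(_ I) /= [] /eqP.
by rewrite sqrf_eq0 => /eqP.
Qed.

Lemma sqn_ae f g : measurable_fun setT f -> measurable_fun setT g ->
  {ae mu, forall x, f x = g x} -> sqn f = sqn g.
Proof.
move=> mf mg fg; apply: ge0_ae_eq_integral => //.
- by apply/measurable_EFinP; exact: measurable_funX.
- by apply/measurable_EFinP; exact: measurable_funX.
- by move=> x _; rewrite lee_fin sqr_ge0.
- by move=> x _; rewrite lee_fin sqr_ge0.
- by apply: filterS fg => x -> _.
Qed.

Lemma L2_lin c f g : f \in Lfun mu 2%:E -> g \in Lfun mu 2%:E ->
  (fun x => c * f x + g x) \in Lfun mu 2%:E.
Proof.
move=> f2 g2.
have cf2 : (fun x => c * f x) \in Lfun mu 2%:E.
  have -> : (fun x => c * f x) = c \o* f by apply/funext => x /=; rewrite mulrC.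
  by apply: Lfun_scale; rewrite ?ler1n.
exact: ((Lfun_addr_closed mu (lee1n 2)).2 _ _ cf2 g2).
Qed.

Lemma opnorm_L2_ge0 (T : ('rV[R]_n -> R) -> 'rV[R]_n -> R) : (0 <= opnorm_L2 T)%E.
Proof.
apply: le_trans (Lnorm_ge0 mu 2%:E (EFin \o T (fun=> 0))) _.
apply: ereal_sup_ubound; exists (fun=> 0) => //; split; first exact: L2_0.
rewrite (Lnorm2_sqrt (s := 0)) ?sqrtr0// /sqn.
by under eq_integral do rewrite expr0n; rewrite integral0.
Qed.

Section bounded_operator.
Variables (T : ('rV[R]_n -> R) -> 'rV[R]_n -> R) (A : R).
Hypothesis hT : bounded_linear_L2 T.
Hypothesis hA : (opnorm_L2 T <= A%:E)%E.

Lemma T_L2 f : f \in Lfun mu 2%:E -> T f \in Lfun mu 2%:E.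
Proof. by case: hT => + _ _; apply. Qed.

Lemma A_ge0 : 0 <= A.
Proof. by rewrite -lee_fin; exact: le_trans (opnorm_L2_ge0 T) hA. Qed.

Lemma T_null f : f \in Lfun mu 2%:E -> sqn f = 0%E -> {ae mu, forall x, T f x = 0}.
Proof.
move=> f2 f0; have [t ht] := L2_sqn (T_L2 f2).
apply: sqn_eq0; first exact: L2_measurable (T_L2 f2).
have [_ _ [B hB]] := hT; have := hB _ f2.
rewrite (Lnorm2_sqrt ht) (Lnorm2_sqrt f0) sqrtr0 mule0 lee_fin => h.
have : 0 <= t by rewrite -lee_fin -ht sqn_ge0.
by rewrite le_eqVlt => /predU1P[t0|]; [rewrite ht -t0|rewrite -sqrtr_gt0 ltNge h].
Qed.

(** Linearity in the form given applies to c f + g; taking g = 0 requires that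
T 0 vanish almost everywhere, which follows from boundedness. *)
Lemma T_scale c f : f \in Lfun mu 2%:E ->
  {ae mu, forall x, T (fun y => c * f y) x = c * T f x}.
Proof.
move=> f2; have [_ lin _] := hT.
have z0 : {ae mu, forall x, T (fun=> 0) x = 0}.
  apply: T_null; first exact: L2_0.
  by rewrite /sqn; under eq_integral do rewrite expr0n; rewrite integral0.
have := lin c _ _ f2 L2_0; apply: filterS2 z0 => x -> /=.
by rewrite addr0 => <-; congr T; apply/funext => y; rewrite addr0.
Qed.

(** The operator norm is a supremum over the unit ball; a general function is
normalized first, and a null function is sent to a null function. *)
Lemma T_sq f s : f \in Lfun mu 2%:E -> sqn f = s%:E ->
  (sqn (T f) <= (A ^+ 2 * s)%:E)%E.
Proof.
move=> f2 fs; have [t ht] := L2_sqn (T_L2 f2).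
have mf := L2_measurable f2; have mTf := L2_measurable (T_L2 f2).
have : 0 <= s by rewrite -lee_fin -fs sqn_ge0.
rewrite le_eqVlt => /predU1P[s0|s0].
  have T0 : sqn (T f) = 0%E.
    transitivity (sqn (fun=> 0)).
      apply: sqn_ae => //; apply: T_null => //.
      by rewrite fs -s0.
    by rewrite /sqn; under eq_integral do rewrite expr0n; rewrite integral0.
  by rewrite T0 -s0 mulr0.
pose c := (Num.sqrt s)^-1.
have c2 : c ^+ 2 = s^-1 by rewrite exprVn sqr_sqrtr// ltW.
pose g := fun x => c * f x.
have mg : measurable_fun setT g by exact: measurable_funM.
have gs : sqn g = 1%:E.
  by rewrite sqn_scale// fs c2 -EFinM mulVf// gt_eqF.
have g2 : g \in Lfun mu 2%:E by apply: sqn_L2 => //; rewrite gs ltry.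
have Tg : sqn (T g) = (t / s)%:E.
  rewrite (@sqn_ae _ (fun x => c * T f x)).
  - by rewrite sqn_scale// ht c2 -EFinM mulrC.
  - exact: L2_measurable (T_L2 g2).
  - exact: measurable_funM.
  - exact: T_scale.
have h : ((Num.sqrt (t / s))%:E <= A%:E)%E.
  rewrite -(Lnorm2_sqrt Tg); apply: le_trans hA; apply: ereal_sup_ubound.
  by exists g => //; split => //; rewrite (Lnorm2_sqrt gs) sqrtr1.
have t0 : 0 <= t by rewrite -lee_fin -ht sqn_ge0.
rewrite ht lee_fin -ler_pdivrMr// -[leLHS]sqr_sqrtr ?divr_ge0 ?(ltW s0)//.
by rewrite lerXn2r ?nnegrE ?sqrtr_ge0 ?A_ge0// -lee_fin.
Qed.

Lemma T_chebyshev f (s l : R) : f \in Lfun mu 2%:E -> (sqn f <= s%:E)%E -> 0 < l ->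
  (mu [set x | (l < `|T f x|)%R] <= (A ^+ 2 * s / l ^+ 2)%:E)%E.
Proof.
move=> f2 fs l0; have mTf := L2_measurable (T_L2 f2).
have [s' fs'] := L2_sqn f2.
have ss' : s' <= s by move: fs; rewrite fs' lee_fin.
rewrite EFinM lee_pdivlMr ?exprn_gt0// muleC.
apply: (@le_trans _ _ (A ^+ 2 * s')%:E); last first.
  by rewrite lee_fin ler_wpM2l// sqr_ge0.
apply: le_trans (T_sq f2 fs').
have mS : measurable [set x | l < `|T f x|].
  by apply: measurable_gt_set; exact: measurableT_comp.
have m2 : measurable_fun setT (fun x => T f x ^+ 2) by exact: measurable_funX.
have p0 x : 0 <= T f x ^+ 2 by exact: sqr_ge0.
apply: le_trans (mass_le m2 p0 mS measurableT (@subsetT _ _)).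
apply: mass_ge => //; first by rewrite exprn_ge0// ltW.
by move=> x /= lx; rewrite -[leRHS]real_normK ?num_real// lerXn2r// ?nnegrE// ltW.
Qed.

Lemma T_sum (I : eqType) (s : seq I) (F : I -> 'rV[R]_n -> R) f :
  f \in Lfun mu 2%:E -> (forall i, F i \in Lfun mu 2%:E) ->
  {ae mu, forall x, T (fun y => f y + \sum_(i <- s) F i y) x =
                    T f x + \sum_(i <- s) T (F i) x}.
Proof.
move=> f2 F2; have [_ lin _] := hT.
elim: s f f2 => [|i s IH] f f2.
  apply: aeW => x; rewrite big_nil addr0; congr T.
  by apply/funext => y; rewrite big_nil addr0.
have fi2 : (fun y => 1 * f y + F i y) \in Lfun mu 2%:E.
  exact: L2_lin.
have := IH _ fi2; have := lin 1 _ _ f2 (F2 i); apply: filterS2 => x h1 h2.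
rewrite big_cons addrA.
have -> : (fun y => f y + \sum_(j <- i :: s) F j y) =
          (fun y => 1 * f y + F i y + \sum_(j <- s) F j y).
  by apply/funext => y; rewrite big_cons mul1r addrA.
by rewrite h2 h1 mul1r.
Qed.

End bounded_operator.
End l2.

(** * The weak type inequality on L2 *)

Lemma ae_measure_le d (T : measurableType d) (R : realType)
    (m : {measure set T -> \bar R}) (A B : set T) :
  measurable A -> measurable B -> {ae m, forall x, A x -> B x} -> (m A <= m B)%E.
Proof.
move=> mA mB [N [mN N0 hN]].
apply: (@le_trans _ _ (m (B `|` N))).
  apply: le_measure; rewrite ?inE//; first exact: measurableU.
  move=> x Ax; have [Bx|nB] := pselect (B x); first by left.
  by right; apply: hN => /= /(_ Ax).
apply: (le_trans (measureU2 _ mB mN)).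
by rewrite [X in (_ + X)%E](_ : _ = 0%E) ?adde0.
Qed.

Section supports.
Context {R : realType} {n : nat}.
Implicit Types (k : int) (m : {ffun 'I_n -> int}) (x y : 'rV[R]_n).

Lemma not_supp_ball (h : 'rV[R]_n -> R) x k :
  (forall y, (forall i, `|x 0 i - y 0 i| < side k) -> h y = 0) -> ~ supp h x.
Proof.
move=> h0 sx; have /sx[y [/= /eqP hy [_ xy]]] := nbhsx_ballx x (side k) (side_gt0 k).
by apply: hy; apply: h0 => i; exact: (xy 0 i).
Qed.

Lemma not_supp_dcube (h : 'rV[R]_n -> R) k m x :
  (forall y, ~ dcube k m y -> h y = 0) -> ~ tcube k m x -> ~ supp h x.
Proof.
move=> h0 nx; apply: (@not_supp_ball _ _ k) => y xy; apply: h0 => /dcubeP ym.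
move: nx; rewrite -ym => /notin_tcube_dist[i].
by rewrite distrC ltNge ltW.
Qed.

Lemma not_supp_tcube (h : 'rV[R]_n -> R) k m x :
  (forall y, tcube k m y -> h y = 0) -> dcube k m x -> ~ supp h x.
Proof.
move=> h0 /dcubeP xm; apply: (@not_supp_ball _ _ k) => y xy; apply: h0.
apply: contrapT; rewrite -xm => /notin_tcube_dist[i].
by rewrite ltNge ltW.
Qed.

End supports.

Section weak_type.
Context {R : realType} {n : nat} (n0 : (0 < n)%N).
Local Notation mu := (lebesgue_rV R n).
Local Notation dcubeq q := (@dcube R n q.1 q.2).
Implicit Types (k : int) (m : {ffun 'I_n -> int}) (x y : 'rV[R]_n).
Implicit Types q : int * {ffun 'I_n -> int}.

(** Infinitely many stopping cubes are reduced to finitely many at the price of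
a small mass.  Bad parts are then summed over a finite family only, where
linearity of the operator on L^2 suffices. *)
Lemma bigcup_fin_approx (phi : 'rV[R]_n -> R) (S : set (int * {ffun 'I_n -> int})) (e : R) :
  measurable_fun setT phi -> (forall x, 0 <= phi x) -> (mass phi setT < +oo)%E ->
  0 < e -> exists s, [/\ uniq s, forall q, q \in s -> S q &
    (mass phi ((\bigcup_(q in S) dcubeq q) `\` \big[setU/set0]_(q <- s) dcubeq q) <= e%:E)%E].
Proof.
move=> mphi phi0 phioo e0; set O := \bigcup_(q in S) _.
have mO : measurable O.
  by apply: bigcup_measurable_countable => q; exact: measurable_grid_cube.
have mU (s : seq (int * {ffun 'I_n -> int})) : measurable (\big[setU/set0]_(q <- s) dcubeq q).
  by apply: bigsetU_measurable => q _; exact: measurable_grid_cube.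
have : (mass phi O <= mass phi setT)%E by apply: mass_le.
move=> /le_lt_trans/(_ phioo) Ooo.
have OE : mass phi O = (fine (mass phi O))%:E by rewrite fineK// ge0_fin_numE// mass_ge0.
apply: contrapT => h.
suff : (dens mphi phi0 O <= (fine (mass phi O) - e)%:E)%E.
  by rewrite /dens OE lee_fin/=; lra.
apply: measure_bigcup_le => [q|s sS]; first exact: measurable_grid_cube.
set U := \big[setU/set0]_(q <- s) _.
change (mass phi U <= (fine (mass phi O) - e)%:E)%E.
have UO : U `<=` O by move=> x /bigcup_seqE[q /sS Sq xq]; exists q.
have hU : (e%:E < mass phi (O `\` U))%E.
  rewrite ltNge; apply/negP => hle; apply: h; exists (undup s); split.
  - exact: undup_uniq.
  - by move=> q; rewrite mem_undup; exact: sS.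
  - rewrite (_ : \big[setU/set0]_(q <- undup s) dcubeq q = U)//.
    by apply/seteqP; split => x /bigcup_seqE[q qs xq]; apply/bigcup_seqE; exists q;
       rewrite ?mem_undup in qs *.
have mOU : measurable (O `\` U) by apply: measurableD => //; exact: mU.
have : mass phi O = (mass phi (O `\` U) + mass phi U)%E.
  rewrite -(massU mphi phi0 mOU (mU s)); first by rewrite setDKU.
  by apply/seteqP; split=> // x [[]].
have := mass_ge0 phi0 U; have := mass_ge0 phi0 (O `\` U); rewrite OE.
move: hU; case: (mass phi (O `\` U)) => [a| |]//; case: (mass phi U) => [b| |]//.
rewrite !lte_fin !lee_fin -EFinD => ea a1 b1 [E]; lra.
Qed.

Variables (omega : R -> R) (CK D A : R) (K : 'rV[R]_n -> 'rV[R]_n -> R).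
Variable (T : ('rV[R]_n -> R) -> 'rV[R]_n -> R).
Hypothesis momega : modulus_of_continuity omega.
Hypothesis hD : (dini omega <= D%:E)%E.
Hypothesis hT : cz_operator omega CK K T.
Hypothesis hA : (opnorm_L2 T <= A%:E)%E.

Let hTl : bounded_linear_L2 T. Proof. by case: hT. Qed.
Let hK : cz_kernel omega CK K. Proof. by case: hT. Qed.

(** The three summands come from the good part, from the enlarged stopping
cubes, and from the bad part off these cubes. *)
Definition weak_const : R := 4 * ((2 ^+ n) ^+ 2 + 2) + (6 * 2 ^+ n) ^+ n + 8 * 6 ^+ n.

Section decomposition.
Variables (C N l : R) (g : 'rV[R]_n -> R).
Hypotheses (C0 : 0 < C) (AC : A <= C) (DC : D <= C) (N0 : 0 < N) (l0 : 0 < l).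
Hypothesis g2 : g \in Lfun mu 2%:E.
Hypothesis gN : (mass (absf g) setT <= N%:E)%E.

Let a := l / C.
Let a0 : 0 < a. Proof. by rewrite divr_gt0. Qed.

Let mg : measurable_fun setT g. Proof. exact: L2_measurable g2. Qed.
Let mag : measurable_fun setT (absf g). Proof. exact: measurableT_comp. Qed.
Let ag0 x : 0 <= absf g x. Proof. exact: normr_ge0. Qed.
Let ig : mu.-integrable setT (EFin \o g).
Proof.
apply/integrableP; split; first exact/measurable_EFinP.
by apply: le_lt_trans gN _; exact: ltry.
Qed.

Let St := stopping (absf g) a.
Let O := \bigcup_(q in St) dcubeq q.
Let mdq q : measurable (dcubeq q). Proof. exact: measurable_grid_cube. Qed.
Let mO : measurable O. Proof. exact: bigcup_measurable_countable. Qed.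

Let v q : R := fine (mass (absf g) (dcubeq q)).
Let vE q : mass (absf g) (dcubeq q) = (v q)%:E.
Proof.
rewrite fineK// ge0_fin_numE ?mass_ge0//.
apply: (@le_lt_trans _ _ N%:E); last exact: ltry.
by apply: le_trans gN; apply: mass_le.
Qed.
Let vol q : R := side q.1 ^+ n.
Let vol0 q : 0 < vol q. Proof. by rewrite exprn_gt0// side_gt0. Qed.

Let avg q : R := (\int[mu]_(y in dcubeq q) g y) / vol q.
Let B q y : R := (g y - avg q) * \1_(dcubeq q) y.

Let igq q : mu.-integrable (dcubeq q) (EFin \o g).
Proof. exact: integrableS ig. Qed.

Let avg_le q : `|avg q| * vol q <= v q.
Proof.
rewrite normrM normfV (gtr0_norm (vol0 q)) divfK ?gt_eqF//.
rewrite -lee_fin -vE EFin_normr_Rintegral//.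
by apply: le_abse_integral => //; case/integrableP: (igq q).
Qed.

Let B2 q : B q \in Lfun mu 2%:E.
Proof.
have i2 : (fun y => \1_(dcubeq q) y : R) \in Lfun mu 2%:E.
  apply: sqn_L2; first exact: measurable_indic.
  rewrite [X in (X < _)%E](_ : _ = (\int[mu]_x (\1_(dcubeq q) x)%:E)%E); last first.
    apply: eq_integral => x _; congr EFin.
    by rewrite indicE; case: (x \in _); rewrite ?expr1n ?expr0n.
  by rewrite integral_indic// setIT [X in (X < _)%E](mu_dcube q.1 q.2) ltry.
have gi2 : (fun y => g y * \1_(dcubeq q) y : R) \in Lfun mu 2%:E.
  apply: sqn_L2; first by apply: measurable_funM => //; exact: measurable_indic.
  have [s gs] := L2_sqn g2.
  apply: (@le_lt_trans _ _ (sqn g)); last by rewrite gs ltry.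
  apply: ge0_le_integral => //.
  - by move=> x _; rewrite lee_fin sqr_ge0.
  - by apply/measurable_EFinP; apply: measurable_funX; apply: measurable_funM => //; exact: measurable_indic.
  - by apply/measurable_EFinP; exact: measurable_funX.
  - move=> x _; rewrite lee_fin exprMn indicE.
    by case: (x \in _); rewrite ?expr1n ?mulr1// expr0n mulr0 sqr_ge0.
have -> : B q = (fun y => - avg q * \1_(dcubeq q) y + g y * \1_(dcubeq q) y).
  by apply/funext => y; rewrite /B mulrBl mulNr addrC.
exact: L2_lin.
Qed.

Let Bpatch q : B q = (fun y => g y - avg q) \_ (dcubeq q).
Proof.
apply/funext => y; rewrite /B patchE indicE.
by case: (y \in _); rewrite ?mulr1 ?mulr0.
Qed.

Let icst q (c : R) : mu.-integrable (dcubeq q) (EFin \o cst c).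
Proof.
apply/integrableP; split; first exact/measurable_EFinP.
rewrite (_ : (fun x => _) = cst (`|c|%:E))//.
rewrite integral_cst// [X in (_ * X)%E](mu_dcube q.1 q.2) -EFinM ltry//.
Qed.

Let B_int0 q : \int[mu]_y B q y = 0.
Proof.
rewrite Bpatch -Rintegral_mkcond RintegralB//; last exact: icst.
by rewrite Rintegral_cst// [X in fine X](mu_dcube q.1 q.2)/= /avg divfK ?subrr// gt_eqF ?vol0.
Qed.

Let mB q : measurable_fun setT (B q).
Proof. exact: L2_measurable (B2 q). Qed.

Let B_L1 q : (\int[mu]_y `|B q y|%:E <= (2 * v q)%:E)%E.
Proof.
apply: (@le_trans _ _ (\int[mu]_(y in dcubeq q) (`|g y|%:E + `|avg q|%:E))%E).
  rewrite [leRHS]integral_mkcond; apply: ge0_le_integral => //.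
  - by apply/measurable_EFinP; exact: measurableT_comp.
  - apply/(measurable_restrictT _ (mdq q)); apply: emeasurable_funD => //.
    by apply/measurable_EFinP; exact: measurable_funTS.
  - move=> y _; rewrite /B patchE indicE; case: (y \in _).
      by rewrite mulr1 -EFinD lee_fin ler_normB.
    by rewrite mulr0 normr0.
rewrite ge0_integralD//; last first.
  by apply/measurable_EFinP; exact: measurable_funTS.
rewrite -[X in (X + _)%E]/(mass (absf g) (dcubeq q)) vE integral_cst// [X in (_ + _ * X)%E](mu_dcube q.1 q.2).
rewrite -EFinM -EFinD lee_fin; have := avg_le q; rewrite /vol; lra.
Qed.

Let B_int q : mu.-integrable setT (EFin \o B q).
Proof.
apply/integrableP; split; first exact/measurable_EFinP.
by apply: le_lt_trans (B_L1 q) _; exact: ltry.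
Qed.

(** Calderon-Zygmund decomposition at height l / C, where C dominates the
operator norm and the Dini integral.  The good part G = g - sum of the B q is
handled by the L^2 bound; the bad parts B q have integral zero, so off the
tripled ancestors of order n + 1 their images are bounded by the kernel
majorant, whose integral is at most a constant times C. *)
Lemma weak_type_stopping : (mu [set x | (l < `|T g x|)%R] <= (weak_const * C * N / l)%:E)%E.
Proof.
have [s' gs'] := L2_sqn g2.
have mg2 : measurable_fun setT (fun x => g x ^+ 2) by exact: measurable_funX.
have g20 x : 0 <= g x ^+ 2 by exact: sqr_ge0.
have aN0 : 0 < a * N by rewrite mulr_gt0.
have [|s [us sSt hs]] := bigcup_fin_approx St mg2 g20 _ aN0.
  by rewrite -[X in (X < _)%E]/(sqn g) gs' ltry.
set U := \big[setU/set0]_(q <- s) dcubeq q in hs.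
have mU : measurable U by exact: bigsetU_measurable.
have sum_v : \sum_(q <- s) v q <= N.
  rewrite -lee_fin -sumEFin; apply: le_trans gN.
  under eq_bigr => q _ do rewrite -vE.
  rewrite -ge0_integral_bigsetU//.
  - by apply: mass_le.
  - apply/trivIsetP => q q' /= /sSt Sq /sSt Sq' /eqP qq'.
    apply/seteqP; split => // x [xq xq']; apply: qq'.
    exact: (stopping_disj Sq Sq' xq xq').
  - by apply/measurable_EFinP; exact: measurable_funTS.
  - by move=> x _; rewrite lee_fin.
have v_lb q : q \in s -> a * vol q <= v q.
  by move=> /sSt/stopping_lb; rewrite vE lte_fin => /ltW.
have v_ub q : q \in s -> v q <= 2 ^+ n * a * vol q.
  by move=> /sSt/(stopping_ub mag ag0); rewrite vE lee_fin.
have sum_vol : \sum_(q <- s) vol q <= N / a.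
  rewrite ler_pdivlMr// mulrC mulr_sumr; apply: le_trans sum_v.
  by rewrite big_seq [leRHS]big_seq; apply: ler_sum => q; exact: v_lb.
have muU : (mu U <= (N / a)%:E)%E.
  apply: (le_trans (measure_bigsetU_le _ _ mdq)).
  rewrite (eq_bigr (fun q => (vol q)%:E)); last by move=> q _; exact: mu_dcube.
  by rewrite sumEFin lee_fin.
pose G y := g y - \sum_(q <- s) B q y.
have mG : measurable_fun setT G.
  by apply: measurable_funB => //; exact: measurable_sum.
have G_out x : ~ U x -> G x = g x.
  move=> Ux; rewrite /G big1_seq ?subr0// => q /andP[_ qs].
  rewrite /B indicE memNset ?mulr0// => xq; apply: Ux.
  by apply/bigcup_seqE; exists q.
have G_in x q : q \in s -> dcubeq q x -> G x = avg q.
  move=> qs xq; rewrite /G (bigD1_seq q)//= big1_seq ?addr0.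
    by rewrite /B indicE mem_set// mulr1 subKr.
  move=> q' /andP[/eqP qq' q's]; rewrite /B indicE memNset ?mulr0// => xq'.
  by apply: qq'; exact: stopping_disj (sSt _ q's) (sSt _ qs) xq' xq.
have avg_a q : q \in s -> `|avg q| <= 2 ^+ n * a.
  move=> qs; rewrite -(ler_pM2r (vol0 q)).
  exact: le_trans (avg_le q) (v_ub _ qs).
pose p2 : R := 2 ^+ n.
have p20 : 0 < p2 by rewrite exprn_gt0.
(* |G|^2 is at most (2^n a)^2 on the chosen cubes, small in mean on the others,
   and a |g| off all stopping cubes. *)
have sqG : (sqn G <= ((p2 ^+ 2 + 2) * (a * N))%:E)%E.
  pose f1 x : \bar R := ((p2 * a) ^+ 2 * \1_U x)%:E.
  pose f2 x : \bar R := (g x ^+ 2 * \1_(O `\` U) x)%:E.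
  pose f3 x : \bar R := (a * absf g x)%:E.
  have mOU : measurable (O `\` U) by exact: measurableD.
  have mf1 : measurable_fun setT f1.
    by apply/measurable_EFinP; apply: measurable_funM => //; exact: measurable_indic.
  have mf2 : measurable_fun setT f2.
    by apply/measurable_EFinP; apply: measurable_funM => //; exact: measurable_indic.
  have mf3 : measurable_fun setT f3.
    by apply/measurable_EFinP; exact: measurable_funM.
  have f10 x : (0 <= f1 x)%E by rewrite lee_fin mulr_ge0// sqr_ge0.
  have f20 x : (0 <= f2 x)%E by rewrite lee_fin mulr_ge0// sqr_ge0.
  have f30 x : (0 <= f3 x)%E by rewrite lee_fin mulr_ge0// ltW.
  apply: (@le_trans _ _ (\int[mu]_x (f1 x + (f2 x + f3 x)))%E).
    apply: ae_ge0_le_integral => //.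
    - by move=> x _; rewrite lee_fin sqr_ge0.
    - by apply/measurable_EFinP; exact: measurable_funX.
    - by move=> x _; rewrite !adde_ge0.
    - by apply: emeasurable_funD => //; exact: emeasurable_funD.
    - have := stopping_ae n0 mag ag0 a0 gN; apply: filterS => x hx _.
      have [/bigcup_seqE[q qs xq]|nU] := pselect (U x).
        apply: (@le_trans _ _ (f1 x)); last by rewrite leeDl// adde_ge0.
        rewrite (G_in _ _ qs xq) /f1 indicE mem_set; last by apply/bigcup_seqE; exists q.
        rewrite mulr1 lee_fin -[leLHS]real_normK ?num_real//.
        by rewrite lerXn2r ?nnegrE ?avg_a// mulr_ge0// ltW.
      rewrite (G_out _ nU); have [Ox|nO] := pselect (O x).
        apply: (@le_trans _ _ (f2 x)); last by rewrite addeCA leeDl// adde_ge0.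
        by rewrite /f2 indicE mem_set// mulr1.
      apply: (@le_trans _ _ (f3 x)); last by rewrite addeA leeDr// adde_ge0.
      rewrite /f3 lee_fin -real_normK ?num_real// expr2 ler_wpM2r//.
      by apply: hx => q Sq xq; apply: nO; exists q.
  rewrite ge0_integralD//; [|by move=> x _; rewrite adde_ge0|exact: emeasurable_funD].
  rewrite ge0_integralD//.
  have I1 : (\int[mu]_x f1 x <= ((p2 ^+ 2) * (a * N))%:E)%E.
    rewrite /f1; under eq_integral do rewrite EFinM.
    rewrite ge0_integralZl_EFin ?sqr_ge0//; last first.
      by apply/measurable_EFinP; exact: measurable_indic.
    rewrite integral_indic// setIT; apply: (le_trans (lee_wpmul2l _ muU)).
      by rewrite lee_fin sqr_ge0.
    rewrite -EFinM lee_fin exprMn le_eqVlt; apply/orP; left; apply/eqP.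
    by field; rewrite gt_eqF.
  have I2 : (\int[mu]_x f2 x <= (a * N)%:E)%E.
    apply: le_trans hs; rewrite /mass [leRHS]integral_mkcond.
    apply: ge0_le_integral => //.
    - apply/(measurable_restrictT _ mOU); apply/measurable_EFinP.
      exact: measurable_funTS.
    - move=> x _; rewrite /f2 patchE indicE -/O -/U.
      by case: (x \in _); rewrite ?mulr1 ?mulr0.
  have I3 : (\int[mu]_x f3 x <= (a * N)%:E)%E.
    rewrite /f3; under eq_integral do rewrite EFinM.
    rewrite ge0_integralZl_EFin ?(ltW a0)//; last 2 first.
    - by move=> x _; rewrite lee_fin.
    - exact/measurable_EFinP.
    rewrite [leRHS]EFinM; apply: lee_wpmul2l; last exact: gN.
    by rewrite lee_fin ltW.
  apply: (le_trans (leeD I1 (leeD I2 I3))).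
  by rewrite -!EFinD lee_fin; lra.
have G2 : G \in Lfun mu 2%:E.
  by apply: sqn_L2 => //; apply: le_lt_trans sqG _; exact: ltry.
have l20 : 0 < l / 2 by rewrite divr_gt0.
have S1 := T_chebyshev hTl hA G2 sqG l20.
set E1 := [set x | _] in S1.
pose E2 := \big[setU/set0]_(q <- s) anc (R := R) q.1 q.2 n.+1.
have mE2 : measurable E2.
  by apply: bigsetU_measurable => q _; exact: measurable_anc.
have S2 : (mu E2 <= ((6 * 2 ^+ n) ^+ n * (N / a))%:E)%E.
  apply: (@le_trans _ _ (\sum_(q <- s) mu (anc (R := R) q.1 q.2 n.+1))%E).
    by apply: measure_bigsetU_le => q; exact: measurable_anc.
  apply: (@le_trans _ _ (\sum_(q <- s) ((6 * 2 ^+ n) ^+ n * vol q)%:E)%E).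
    apply: lee_sum => q _; rewrite mu_tcube lee_fin sideD -exprMn.
    by rewrite exprS !mulrA -natrM.
  rewrite sumEFin lee_fin -mulr_sumr; apply: ler_wpM2l sum_vol.
  by apply: exprn_ge0; apply: mulr_ge0 => //; exact: exprn_ge0.
pose W x := (\sum_(q <- s) (osc_majorant omega q.1 q.2 x * (2 * v q)%:E))%E.
have v0 q : 0 <= v q by rewrite -lee_fin -vE mass_ge0.
have mW : measurable_fun setT W.
  apply: emeasurable_sum => q; apply: emeasurable_funM => //.
  exact: (measurable_osc_majorant momega).
have W0 x : (0 <= W x)%E.
  by apply: sume_ge0 => q _; rewrite mule_ge0 ?(osc_majorant_ge0 momega)// lee_fin mulr_ge0.
have IW : (\int[mu]_x W x <= (4 * 6 ^+ n * C * N)%:E)%E.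
  rewrite ge0_integral_sum//; last 2 first.
  - by move=> q; apply: emeasurable_funM => //; exact: (measurable_osc_majorant momega).
  - by move=> q x _; rewrite mule_ge0 ?(osc_majorant_ge0 momega)// lee_fin mulr_ge0.
  apply: (@le_trans _ _ (\sum_(q <- s) (2 * 6 ^+ n * D * 2 * v q)%:E)%E).
    apply: lee_sum => q _; rewrite ge0_integralZr//; last 3 first.
    - exact: (measurable_osc_majorant momega).
    - by move=> x _; exact: (osc_majorant_ge0 momega).
    - by rewrite lee_fin mulr_ge0.
    rewrite -mulrA [leRHS]EFinM; apply: lee_wpmul2r; first by rewrite lee_fin mulr_ge0.
    rewrite (eq_integral (fun x => (osc_majorant omega q.1 q.2 x * ((fun=> 1) x : R)%:E)%E)); last first.
      by move=> x _; rewrite mule1.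
    rewrite -[2 * 6 ^+ n * D]mulr1; apply: integral_majorant_le => // i.
    rewrite /mass integral_cst ?mul1e ?mul1r; last exact: measurable_anc.
    by rewrite [leLHS]mu_tcube.
  rewrite sumEFin lee_fin -mulr_sumr.
  have D0 := D_ge0 momega hD.
  have p6 : 0 <= 6 ^+ n :> R by rewrite exprn_ge0.
  apply: (@le_trans _ _ (2 * 6 ^+ n * D * 2 * N)).
    by rewrite ler_wpM2l// !mulr_ge0.
  have : 0 <= 6 ^+ n * N * (C - D) :> R by rewrite !mulr_ge0 ?subr_ge0// ltW.
  lra.
pose E3 := [set x | ((l / 2)%:E <= W x)%E].
have mE3 : measurable E3.
  by rewrite -[X in measurable X]setTI; exact: emeasurable_fun_c_infty.
have S3 : (mu E3 <= (8 * 6 ^+ n * C * N / l)%:E)%E.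
  have -> : 8 * 6 ^+ n * C * N / l = (4 * 6 ^+ n * C * N) / (l / 2).
    by field; rewrite gt_eqF.
  rewrite EFinM lee_pdivlMr// muleC; apply: le_trans IW.
  apply: (@le_trans _ _ (\int[mu]_(x in E3) W x)%E); last first.
    by apply: ge0_subset_integral.
  rewrite -integral_cst//; apply: ge0_le_integral => //.
  - by move=> x _; rewrite lee_fin ltW.
  - exact: measurable_funTS.
have mE1 : measurable E1.
  apply: measurable_gt_set; apply: measurableT_comp => //.
  exact: L2_measurable (T_L2 hTl G2).
have mTg : measurable [set x | (l < `|T g x|)%R].
  apply: measurable_gt_set; apply: measurableT_comp => //.
  exact: L2_measurable (T_L2 hTl g2).
have cover : {ae mu, forall x, (l < `|T g x|)%R -> (E1 `|` (E2 `|` E3)) x}.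
  have [_ _ hrep] := hT.
  have rep := ae_forall_countable (fun q => hrep _ (B2 q)).
  have := T_sum hTl s G2 B2; apply: filterS2 rep => x rep Tx lx.
  have {}Tx : T g x = T G x + \sum_(q <- s) T (B q) x.
    by rewrite -Tx; congr T; apply/funext => y; rewrite subrK.
  apply: contrapT => /not_orP[nE1 /not_orP[nE2 nE3]].
  have h1 : `|T G x| <= l / 2 by rewrite leNgt; apply/negP.
  have h3 : (W x < (l / 2)%:E)%E by rewrite ltNge; apply/negP.
  have h2 : (`|\sum_(q <- s) T (B q) x|%:E <= W x)%E.
    apply: (@le_trans _ _ (\sum_(q <- s) `|T (B q) x|%:E)%E).
      by rewrite sumEFin lee_fin ler_norm_sum.
    rewrite big_seq [leRHS]big_seq; apply: lee_sum => q qs.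
    have nx : ~ anc q.1 q.2 n.+1 x.
      by move=> hx; apply: nE2; apply/bigcup_seqE; exists q.
    have Bout y : ~ dcubeq q y -> B q y = 0.
      by move=> ny; rewrite /B indicE memNset// mulr0.
    have nt : ~ tcube q.1 q.2 x.
      by move=> tx; apply: nx; apply: (anc_sub (i := 0)) => //; rewrite anc0.
    rewrite rep; last exact: (not_supp_dcube Bout nt).
    apply: (le_trans (kernel_cancel n0 momega hD hK (B_int q) Bout (B_int0 q) nx)).
    by apply: lee_wpmul2l (B_L1 q); exact: (osc_majorant_ge0 momega).
  have := le_lt_trans h2 h3; rewrite lte_fin => h4.
  have := ler_normD (T G x) (\sum_(q <- s) T (B q) x); rewrite -Tx.
  by move: lx; lra.
apply: (le_trans (ae_measure_le mTg _ cover)).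
  by apply: measurableU => //; exact: measurableU.
apply: (le_trans (measureU2 _ mE1 (measurableU _ _ mE2 mE3))).
apply: (le_trans (leeD S1 (measureU2 _ mE2 mE3))).
apply: (le_trans (leeD2l _ (leeD S2 S3))).
rewrite -!EFinD lee_fin /weak_const /a -/p2.
have A0 := A_ge0 hA.
have C1 : C != 0 by rewrite gt_eqF.
have l1 : l != 0 by rewrite gt_eqF.
have -> : N / (l / C) = C * N / l by field; rewrite l1 C1.
have -> : A ^+ 2 * ((p2 ^+ 2 + 2) * (l / C * N)) / (l / 2) ^+ 2 =
  4 * (p2 ^+ 2 + 2) * (A ^+ 2 / C) * N / l by field; rewrite l1 C1.
have h : A ^+ 2 / C <= C.
  by rewrite ler_pdivrMr// expr2 ler_pM.
have h' : 4 * (p2 ^+ 2 + 2) * (A ^+ 2 / C) * N / l <= 4 * (p2 ^+ 2 + 2) * C * N / l.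
  rewrite -!mulrA ler_pM2l// ler_wpM2l ?addr_ge0 ?sqr_ge0// !mulrA.
  by rewrite ler_pM2r ?invr_gt0// ler_pM2r.
apply: (le_trans (lerD h' (lexx _))).
by rewrite le_eqVlt; apply/orP; left; apply/eqP; field; rewrite l1.
Qed.

End decomposition.
End weak_type.

(** * The extension to L1 *)

Lemma cvge0P (R : realType) (u : nat -> \bar R) : (forall j, (0 <= u j)%E) ->
  u @ \oo --> 0%E <->
  forall d : R, 0 < d -> exists J, forall j, (J <= j)%N -> (u j <= d%:E)%E.
Proof.
move=> u0; split=> [cu d d0|h].
  by have [J hJ] := cvge0_lt cu d0; exists J => j /hJ /ltW.
apply/cvg_abse0P; apply/fine_cvgP; split.
  have [J hJ] := h 1 ltr01; exists J => // j /= /hJ uj.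
  by rewrite abse_fin_num ge0_fin_numE// (le_lt_trans uj)// ltry.
apply/cvgrPdist_le => e e0; have [J hJ] := h _ e0.
exists J => // j /= /hJ uj; rewrite sub0r normrN gee0_abs//.
have : (u j <= e%:E)%E by [].
by have := u0 j; case: (u j) => [r| |]//; rewrite !lee_fin => r0; rewrite /= ger0_norm.
Qed.

Lemma le0_small (R : realType) (u : \bar R) : (0 <= u)%E ->
  (forall d : R, 0 < d -> (u <= d%:E)%E) -> u = 0%E.
Proof.
move=> u0 h; apply/eqP; rewrite eq_le u0 andbT; apply/lee_addgt0Pr => d d0.
by rewrite add0e; exact: h.
Qed.

(** The limit in [exists_limit_in_measure] is defined as an upper limit, which
is measurable whether or not the sequence converges; this bound locates it. *)
Lemma limn_esup_bound (R : realType) (u : nat -> \bar R) (J : nat) (a b : \bar R) :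
  (forall i, (J <= i)%N -> (a <= u i <= b)%E) -> (a <= limn_esup u <= b)%E.
Proof.
move=> h; rewrite limn_esup_lim; apply/andP; split.
  apply: lime_ge; first exact: is_cvg_esups.
  exists J => // j /= Jj; apply: (@le_trans _ _ (u j)); first by have /andP[] := h _ Jj.
  by apply: ereal_sup_ubound; exists j => //=.
apply: lime_le; first exact: is_cvg_esups.
exists J => // j /= Jj; apply: ge_ereal_sup => _ [i /= ji <-].
by have /andP[] := h _ (leq_trans Jj ji).
Qed.

Section convergence_in_measure.
Context {R : realType} {n : nat}.
Local Notation mu := (lebesgue_rV R n).
Implicit Types f g h : 'rV[R]_n -> R.
Implicit Types X Y : nat -> 'rV[R]_n -> R.

Definition dev (e : R) f g : set 'rV[R]_n := [set x | e < `|f x - g x|].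

(** Convergence in measure, with thresholds instead of limits of measures so that
two instances combine by taking a maximum. *)
Definition cvg_meas X g := forall e d : R, 0 < e -> 0 < d ->
  exists J, forall j, (J <= j)%N -> (mu (dev e (X j) g) <= d%:E)%E.

Lemma measurable_dev e f g : measurable_fun setT f -> measurable_fun setT g ->
  measurable (dev e f g).
Proof.
move=> mf mg; apply: measurable_gt_set; apply: measurableT_comp => //.
exact: measurable_funB.
Qed.

Lemma dev_le (e e' : R) f g h : measurable_fun setT f -> measurable_fun setT g ->
  measurable_fun setT h ->
  (mu (dev (e + e') f h) <= mu (dev e f g) + mu (dev e' g h))%E.
Proof.
move=> mf mg mh; have m1 := measurable_dev e mf mg.
have m2 := measurable_dev e' mg mh.
apply: le_trans (measureU2 _ m1 m2); apply: le_measure; rewrite ?inE.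
- exact: measurable_dev.
- exact: measurableU.
- move=> x; rewrite /dev /= => h1.
  have h2 : `|f x - h x| <= `|f x - g x| + `|g x - h x| by exact: ler_distD.
  have [h3|h3] := ltP e `|f x - g x|; first by left.
  by right; rewrite /=; lra.
Qed.

Lemma devC e f g : dev e f g = dev e g f.
Proof. by apply/seteqP; split => x; rewrite /dev/= distrC. Qed.

Lemma dev_eq0 f g : measurable_fun setT f -> measurable_fun setT g ->
  (forall e, 0 < e -> mu (dev e f g) = 0%E) -> {ae mu, forall x, f x = g x}.
Proof.
move=> mf mg h.
pose F i := dev i.+1%:R^-1 f g.
exists (\bigcup_i F i); split.
- by apply: bigcup_measurable => i _; exact: measurable_dev.
- apply: measure_bigcup0 => i; first exact: measurable_dev.
  by move=> _; apply: h; rewrite invr_gt0.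
- move=> x /= /eqP; rewrite -subr_eq0 -normr_gt0 => d0.
  have [i _ hi] := near_infty_natSinv_lt (PosNum d0).
  by exists i => //; exact: (hi i (leqnn _)).
Qed.

Lemma cvg_meas_unique X f g : (forall j, measurable_fun setT (X j)) ->
  measurable_fun setT f -> measurable_fun setT g ->
  cvg_meas X f -> cvg_meas X g -> {ae mu, forall x, f x = g x}.
Proof.
move=> mX mf mg Xf Xg; apply: dev_eq0 => // e e0; apply: le0_small => // d d0.
have e2 : 0 < e / 2 by rewrite divr_gt0.
have d2 : 0 < d / 2 by rewrite divr_gt0.
have [J1 h1] := Xf _ _ e2 d2; have [J2 h2] := Xg _ _ e2 d2.
have := dev_le (e / 2) (e / 2) mf (mX (maxn J1 J2)) mg.
rewrite -splitr => /le_trans; apply.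
rewrite [d in leRHS]splitr EFinD devC leeD//.
  by apply: h1; exact: leq_maxl.
by apply: h2; exact: leq_maxr.
Qed.

End convergence_in_measure.

Section truncation.
Context {R : realType} {n : nat}.
Local Notation mu := (lebesgue_rV R n).
Implicit Types f g h : 'rV[R]_n -> R.

Lemma Lnorm1_mass f : 'N[mu]_1[EFin \o f]%E = mass (absf f) setT.
Proof. by rewrite Lnorm1; apply: eq_integral => x _. Qed.

Lemma integrable_mass f : mu.-integrable setT (EFin \o f) <->
  measurable_fun setT f /\ (mass (absf f) setT < +oo)%E.
Proof.
split=> [/integrableP[/measurable_EFinP mf foo]|[mf foo]]; first by split.
by apply/integrableP; split => //; exact/measurable_EFinP.
Qed.

Definition trunc (k : nat) h x : R := h x * \1_[set y | `|h y| <= k%:R] x.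

Lemma trunc_le k h x : `|trunc k h x| <= `|h x|.
Proof.
rewrite /trunc normrM indicE; case: (x \in _); rewrite ?normr1 ?mulr1//.
by rewrite normr0 mulr0.
Qed.

Lemma trunc_leN k h x : `|trunc k h x| <= k%:R.
Proof.
rewrite /trunc normrM indicE; case: (boolP (_ \in _)) => [|_].
  by rewrite inE/= normr1 mulr1.
by rewrite normr0 mulr0.
Qed.

Lemma trunc_eq0 k h x : h x = 0 -> trunc k h x = 0.
Proof. by rewrite /trunc => ->; rewrite mul0r. Qed.

Lemma trunc_id k h x : `|h x| <= k%:R -> trunc k h x = h x.
Proof. by move=> hx; rewrite /trunc indicE mem_set// mulr1. Qed.

Lemma measurable_trunc k h : measurable_fun setT h -> measurable_fun setT (trunc k h).
Proof.
move=> mh; apply: measurable_funM => //; apply: measurable_indic.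
rewrite (_ : [set y | _] = ~` [set y | k%:R < `|h y|]).
  by apply: measurableC; apply: measurable_gt_set; exact: measurableT_comp.
by apply/seteqP; split => y /=; rewrite leNgt => /negP.
Qed.

Lemma mass_abs_le f g (A : set 'rV[R]_n) : measurable A -> measurable_fun setT f -> measurable_fun setT g ->
  (forall x, A x -> `|f x| <= `|g x|) -> (mass (absf f) A <= mass (absf g) A)%E.
Proof.
move=> mA mf mg fg; apply: ge0_le_integral => //.
- by move=> x _; rewrite lee_fin normr_ge0.
- by apply/measurable_EFinP/measurable_funTS; exact: measurableT_comp.
- by apply/measurable_EFinP/measurable_funTS; exact: measurableT_comp.
Qed.

Lemma trunc_mass k h : measurable_fun setT h ->
  (mass (absf (trunc k h)) setT <= mass (absf h) setT)%E.
Proof.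
move=> mh; apply: mass_abs_le => //; first exact: measurable_trunc.
by move=> x _; exact: trunc_le.
Qed.

Lemma trunc_L1 k h : mu.-integrable setT (EFin \o h) ->
  mu.-integrable setT (EFin \o trunc k h).
Proof.
move=> /integrable_mass[mh hoo]; apply/integrable_mass; split.
  exact: measurable_trunc.
by apply: le_lt_trans hoo; exact: trunc_mass.
Qed.

Lemma trunc_L2 k h : mu.-integrable setT (EFin \o h) -> trunc k h \in Lfun mu 2%:E.
Proof.
move=> /integrable_mass[mh hoo]; have mt := measurable_trunc k mh.
apply: sqn_L2 => //.
apply: (@le_lt_trans _ _ (k%:R%:E * mass (absf h) setT)%E); last first.
  by apply: lte_mul_pinfty => //; rewrite lee_fin.
rewrite -ge0_integralZl_EFin//; last 2 first.
- by move=> x _; rewrite lee_fin normr_ge0.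
- by apply/measurable_EFinP; exact: measurableT_comp.
apply: ge0_le_integral => //.
- by move=> x _; rewrite lee_fin sqr_ge0.
- by apply/measurable_EFinP; exact: measurable_funX.
- by apply: measurable_funeM; apply/measurable_EFinP; exact: measurableT_comp.
- move=> x _; rewrite -EFinM lee_fin -real_normK ?num_real// expr2.
  by rewrite ler_pM// ?trunc_leN ?trunc_le.
Qed.

Lemma trunc_cvg h (d : R) : mu.-integrable setT (EFin \o h) -> 0 < d ->
  exists J, forall k, (J <= k)%N -> (mass (absf (trunc k h \- h)%R) setT <= d%:E)%E.
Proof.
move=> ih d0; have [mh hoo] := (integrable_mass h).1 ih.
have := @dominated_convergence _ _ _ mu setT measurableT
  (fun k => EFin \o trunc k h) (EFin \o h) (fun x => (absf h x)%:E).
case.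
- by move=> k; apply/measurable_EFinP; exact: measurable_trunc.
- exact/measurable_EFinP.
- apply: aeW => x _; apply: cvg_near_cst; exists (Num.trunc `|h x|).+1 => // k /= hk.
  rewrite /= trunc_id// ltW// (lt_le_trans (truncnS_gt _))// ler_nat//.
- by apply/integrableP; split; [apply/measurable_EFinP; exact: measurableT_comp|
    under eq_integral do rewrite gee0_abs ?lee_fin ?normr_ge0//].
- by apply: aeW => x k _; rewrite /= lee_fin trunc_le.
move=> _ /(cvge0P _).1 + _; apply.
  by move=> j; apply: integral_ge0.
by [].
Qed.

End truncation.

Section l1_extension.
Context {R : realType} {n : nat}.
Local Notation mu := (lebesgue_rV R n).
Implicit Types f g h : 'rV[R]_n -> R.
Variables (T : ('rV[R]_n -> R) -> 'rV[R]_n -> R) (Cw : R).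
Hypothesis hT : bounded_linear_L2 T.
Hypothesis Cw0 : 0 <= Cw.
Hypothesis wt : forall g (N l : R), g \in Lfun mu 2%:E ->
  (mass (absf g) setT <= N%:E)%E -> 0 <= N -> 0 < l ->
  (mu [set x | (l < `|T g x|)%R] <= (Cw * N / l)%:E)%E.

Let mT f : f \in Lfun mu 2%:E -> measurable_fun setT (T f).
Proof. by move=> f2; exact: L2_measurable (T_L2 hT f2). Qed.

Lemma massD_le f g (M N : R) : measurable_fun setT f -> measurable_fun setT g ->
  (mass (absf f) setT <= M%:E)%E -> (mass (absf g) setT <= N%:E)%E ->
  (mass (absf (f \+ g)%R) setT <= (M + N)%:E)%E.
Proof.
move=> mf mg fM gN; rewrite EFinD; apply: le_trans (leeD fM gN).
have maf : measurable_fun setT (fun x => (absf f x)%:E).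
  by apply/measurable_EFinP; exact: measurableT_comp.
have mag : measurable_fun setT (fun x => (absf g x)%:E).
  by apply/measurable_EFinP; exact: measurableT_comp.
rewrite /mass -ge0_integralD//.
apply: ge0_le_integral => //.
- by move=> x _; rewrite lee_fin normr_ge0.
- apply/measurable_EFinP; apply: measurableT_comp => //; exact: measurable_funD.
- exact: emeasurable_funD.
- by move=> x _; rewrite lee_fin; exact: ler_normD.
all: by move=> x _; rewrite lee_fin normr_ge0.
Qed.

Lemma mass_sub_sym f g : mass (absf (f \- g)%R) setT = mass (absf (g \- f)%R) setT.
Proof. by apply: eq_integral => x _; rewrite /absf/= distrC. Qed.

(** The weak type inequality applied to u - v: T is Lipschitz from the L^1
distance to convergence in measure. *)
Lemma dev_T u v e N : u \in Lfun mu 2%:E -> v \in Lfun mu 2%:E -> 0 < e -> 0 <= N ->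
  (mass (absf (u \- v)%R) setT <= N%:E)%E ->
  (mu (dev e (T u) (T v)) <= (Cw * N / e)%:E)%E.
Proof.
move=> u2 v2 e0 N0 uvN.
have w2 : (fun y => -1 * v y + u y) \in Lfun mu 2%:E by exact: L2_lin.
have [_ lin _] := hT.
apply: (@le_trans _ _ (mu [set x | (e < `|T (fun y => -1 * v y + u y) x|)%R])).
  apply: ae_measure_le.
  - by apply: measurable_dev; exact: mT.
  - by apply: measurable_gt_set; apply: measurableT_comp => //; exact: mT.
  - have := lin (-1) _ _ v2 u2; apply: filterS => x /= -> .
    by rewrite mulN1r addrC.
apply: wt => //.
rewrite (_ : mass _ _ = mass (absf (u \- v)%R) setT)//.
by apply: eq_integral => x _; rewrite /absf/= mulN1r addrC.
Qed.

Section existence.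
Variable h : 'rV[R]_n -> R.
Hypothesis ih : mu.-integrable setT (EFin \o h).

Let mh : measurable_fun setT h. Proof. by case/integrable_mass: ih. Qed.

(** Completeness of convergence in measure.  Truncations u j with
||u j - h||_1 <= 4 ^-j give sets W j, where two consecutive images differ by
more than 2 ^-j, of summable measure; off the tails of these sets the images
form a Cauchy sequence. *)
Lemma exists_limit_in_measure : exists g, measurable_fun setT g /\
  forall e d : R, 0 < e -> 0 < d -> exists u, [/\ u \in Lfun mu 2%:E,
    measurable_fun setT u,
    (mass (absf (u \- h)%R) setT <= d%:E)%E & (mu (dev e (T u) g) <= d%:E)%E].
Proof.
have q0 j : 0 < (2 ^- j : R) by rewrite invr_gt0 exprn_gt0.
have p0 j : 0 < ((2 ^- j) ^+ 2 : R) by rewrite exprn_gt0.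
have /choice[k hk] : forall j, exists k, (mass (absf (trunc k h \- h)%R) setT <= ((2 ^- j) ^+ 2)%:E)%E.
  by move=> j; have [J hJ] := trunc_cvg ih (p0 j); exists J; exact: hJ.
pose u j := trunc (k j) h.
have u2 j : u j \in Lfun mu 2%:E by exact: trunc_L2.
have mu_ j : measurable_fun setT (u j) by exact: measurable_trunc.
pose W j := dev (2 ^- j) (T (u j.+1)) (T (u j)).
have mW j : measurable (W j) by apply: measurable_dev; exact: mT.
have halfS j : (2 ^- j.+1 : R) = 2 ^- j / 2 by rewrite exprS invfM mulrC.
have muW j : (mu (W j) <= (2 * Cw * 2 ^- j)%:E)%E.
  apply: (@le_trans _ _ (Cw * (2 * (2 ^- j) ^+ 2) / 2 ^- j)%:E).
    apply: (dev_T (u2 _) (u2 _) (q0 j)); first by rewrite mulr_ge0// ltW.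
    have := massD_le (measurable_funB (mu_ j.+1) mh) (measurable_funB mh (mu_ j)) (hk j.+1).
    rewrite mass_sub_sym => /(_ _ (hk j)).
    rewrite (_ : mass _ _ = mass (absf (u j.+1 \- u j)%R) setT); last first.
      by apply: eq_integral => x _; rewrite /absf/= addrA subrK.
    move=> /le_trans; apply; rewrite lee_fin halfS exprMn.
    by have := p0 j; lra.
  rewrite lee_fin le_eqVlt; apply/orP; left; apply/eqP.
  by have := q0 j; move: (2 ^- j : R) => q q1; field; rewrite gt_eqF.
pose F J := \bigcup_(j in [set j | (J <= j)%N]) W j.
have mF J : measurable (F J) by exact: bigcup_measurable.
have muF J : (mu (F J) <= (4 * Cw * 2 ^- J)%:E)%E.
  apply: (@le_trans _ _ (\sum_(0 <= j <oo) mu (W (j + J)%N))%E).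
    apply: measure_sigma_subadditive => // x [j /= Jj Wj].
    by exists (j - J)%N => //; rewrite subnK.
  apply: (@le_trans _ _ (\sum_(0 <= j <oo) ((4 * Cw * 2 ^- J) / (2 ^ j.+1)%:R)%:E)%E).
    apply: lee_nneseries => // j _; apply: (le_trans (muW _)).
    rewrite lee_fin exprD invfM natrX exprS invfM.
    rewrite le_eqVlt; apply/orP; left; apply/eqP.
    by move: ((2 ^+ j)^-1 : R) ((2 ^+ J)^-1 : R) => a b; lra.
  by apply: epsilon_trick0; rewrite !mulr_ge0// ltW.
pose g x := fine (limn_esup (fun j => (T (u j) x)%:E)).
have mg : measurable_fun setT g.
  apply: measurableT_comp; first exact: fine_measurable.
  by apply: measurable_fun_limn_esup => j; apply/measurable_EFinP; exact: mT.
have close J x : ~ F J x -> forall i j, (J <= j)%N ->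
    `|T (u (j + i)%N) x - T (u j) x| <= 2 * 2 ^- j - 2 * 2 ^- (j + i).
  move=> nF i j Jj; elim: i => [|i IH]; first by rewrite addn0 !subrr normr0.
  rewrite addnS; apply: le_trans (ler_distD (T (u (j + i)%N) x) _ _) _.
  have h1 : `|T (u (j + i).+1) x - T (u (j + i)%N) x| <= 2 ^- (j + i).
    rewrite leNgt; apply/negP => hW; apply: nF; exists (j + i)%N => //=.
    by rewrite (leq_trans Jj)// leq_addr.
  by rewrite halfS; lra.
have gclose J x : ~ F J x -> `|T (u J) x - g x| <= 2 * 2 ^- J.
  move=> nF; set a := T (u J) x.
  have : ((a - 2 * 2 ^- J)%:E <= limn_esup (fun j => (T (u j) x)%:E) <= (a + 2 * 2 ^- J)%:E)%E.
    apply: (@limn_esup_bound _ _ J) => i Ji.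
    have := close _ _ nF (i - J)%N J (leqnn J); rewrite subnKC// -/a !lee_fin.
    by have := q0 i; rewrite ler_norml => q1 /andP[? ?]; apply/andP; split; lra.
  rewrite /g; case: (limn_esup _) => [r| |]/=; rewrite ?leey_eq//=.
  - by rewrite !lee_fin ler_norml => /andP[? ?]; apply/andP; split; lra.
  - by rewrite andbF.
have small (C d : R) : 0 < d -> 0 <= C -> exists J, C * 2 ^- J <= d.
  move=> d0 C0; exists (Num.trunc (C / d)).+1.
  rewrite ler_pdivrMr ?exprn_gt0// mulrC -ler_pdivrMr//.
  apply: le_trans (ltW (truncnS_gt _)) _.
  by rewrite -natrX ler_nat ltnW// ltn_expl.
exists g; split => // e d e0 d0.
have [J1 hJ1] := small 2 e e0 (ler0n _ _).
have [J2 hJ2] := small (4 * Cw + 1) d d0 (addr_ge0 (mulr_ge0 (ler0n _ _) Cw0) ler01).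
pose J := maxn J1 J2.
have le2 i j : (i <= j)%N -> (2 ^- j : R) <= 2 ^- i.
  by move=> ij; rewrite lef_pV2 ?posrE ?exprn_gt0// ler_weXn2l// ler1n.
have hJ1' : 2 * 2 ^- J <= e.
  by apply: le_trans hJ1; rewrite ler_pM2l// le2// leq_maxl.
have hJ2' : (4 * Cw + 1) * 2 ^- J <= d.
  apply: le_trans hJ2; apply: ler_wpM2l; last by apply: le2; exact: leq_maxr.
  by rewrite addr_ge0// mulr_ge0.
have qJ := q0 J.
have CqJ : 0 <= Cw * 2 ^- J by rewrite mulr_ge0// ltW.
exists (u J); split => //.
- apply: (le_trans (hk J)); rewrite lee_fin.
  have : (2 ^- J : R) <= 1 by have := le2 0%N J isT; rewrite expr0 invr1.
  by rewrite expr2 => q1; have : 2 ^- J * 2 ^- J <= 2 ^- J :> R;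
     [rewrite ler_piMr// ltW|lra].
- apply: (@le_trans _ _ (mu (F J))).
    apply: le_measure; rewrite ?inE//; first by apply: measurable_dev => //; exact: mT.
    move=> x; rewrite /dev/= => ex; apply: contrapT => /gclose.
    by rewrite leNgt (le_lt_trans hJ1' ex).
  by apply: (le_trans (muF J)); rewrite lee_fin; lra.
Qed.

(** The limit does not depend on the approximating sequence, since any two
approximations are close in L^1, so their images are close in measure. *)
Lemma exists_L1_value : exists g, L1_value T h g.
Proof.
have [g [mg hg]] := exists_limit_in_measure.
exists g; split => // v vL vh e e0; apply/cvge0P => // d d0.
have e2 : 0 < e / 2 by rewrite divr_gt0.
pose d1 := Num.min (d / 2) (d * e / (8 * (Cw + 1))).
have C1 : 0 < 8 * (Cw + 1) by rewrite mulr_gt0// ltr_wpDl.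
have d10 : 0 < d1 by rewrite lt_min !divr_gt0// mulr_gt0.
have [u [u2 mu_ uh ug]] := hg _ _ e2 d10.
have nvh j : (0 <= 'N[mu]_1[EFin \o (v j \- h)%R])%E by exact: Lnorm_ge0.
have [J hJ] := (cvge0P nvh).1 vh _ d10.
exists J => j /hJ; rewrite Lnorm1_mass => vjh.
have [v1 v2] := vL j; have mv := L2_measurable v2.
have := dev_le (e / 2) (e / 2) (mT v2) (mT u2) mg; rewrite -splitr => /le_trans; apply.
rewrite [d in leRHS]splitr EFinD leeD//; last first.
  by apply: (le_trans ug); rewrite lee_fin ge_min lexx.
have vu : (mass (absf (v j \- u)%R) setT <= (d1 + d1)%:E)%E.
  have := massD_le (measurable_funB mv mh) (measurable_funB mh mu_) vjh.
  rewrite mass_sub_sym in uh; move=> /(_ _ uh).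
  rewrite (_ : mass _ _ = mass (absf (v j \- u)%R) setT)//.
  by apply: eq_integral => x _; rewrite /absf/= addrA subrK.
apply: (le_trans (dev_T v2 u2 e2 _ vu)); first by rewrite addr_ge0// ltW.
have hd1 : d1 * (8 * (Cw + 1)) <= d * e by rewrite -ler_pdivlMr// /d1 ge_min lexx orbT.
rewrite lee_fin ler_pdivrMr//.
have : 0 <= d1 by exact: ltW.
lra.
Qed.

Lemma L1_extensionP : L1_value T h (L1_extension T h).
Proof. exact: (xgetPex _ exists_L1_value). Qed.

End existence.

Local Notation T1 := (L1_extension T).

Lemma measurable_T1 h : mu.-integrable setT (EFin \o h) -> measurable_fun setT (T1 h).
Proof. by move=> /L1_extensionP[]. Qed.

Lemma T1_cvg h (v : nat -> 'rV[R]_n -> R) : mu.-integrable setT (EFin \o h) ->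
  (forall j, v j \in Lfun mu 2%:E) ->
  (forall j, mu.-integrable setT (EFin \o v j)) ->
  (forall d : R, 0 < d -> exists J, forall j, (J <= j)%N ->
     (mass (absf (v j \- h)%R) setT <= d%:E)%E) ->
  cvg_meas (fun j => T (v j)) (T1 h).
Proof.
move=> ih v2 v1 vh e d e0 d0; have [_ /(_ v)] := L1_extensionP ih.
have hv j : v j \in Lfun mu 1%E /\ v j \in Lfun mu 2%:E.
  by split=> //; apply/Lfun1_integrable.
move=> /(_ hv) H.
have := H _ e e0; move=> /(_ _)/(cvge0P _).1; apply => //.
apply/cvge0P; first by move=> j; exact: Lnorm_ge0.
by move=> d' /vh[J hJ]; exists J => j /hJ; rewrite Lnorm1_mass.
Qed.

Lemma T1_trunc h : mu.-integrable setT (EFin \o h) ->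
  cvg_meas (fun j => T (trunc j h)) (T1 h).
Proof.
move=> ih; apply: T1_cvg => //.
- by move=> j; exact: trunc_L2.
- by move=> j; exact: trunc_L1.
- by move=> d; exact: trunc_cvg.
Qed.

(** The weak type inequality holds at height l - e up to a small d along the
truncations; the strict level set then forces a limit e, d -> 0. *)
Lemma T1_weak h (N l : R) : mu.-integrable setT (EFin \o h) ->
  (mass (absf h) setT <= N%:E)%E -> 0 <= N -> 0 < l ->
  (mu [set x | (l < `|T1 h x|)%R] <= (Cw * N / l)%:E)%E.
Proof.
move=> ih hN N0 l0; have mh := measurable_T1 ih.
have mS : measurable [set x | (l < `|T1 h x|)%R].
  by apply: measurable_gt_set; exact: measurableT_comp.
have key (e d : R) : 0 < e < l -> 0 < d ->
    (mu [set x | (l < `|T1 h x|)%R] <= (Cw * N / (l - e) + d)%:E)%E.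
  move=> /andP[e0 el] d0; have le0 : 0 < l - e by rewrite subr_gt0.
  have [J /(_ J (leqnn J)) hJ] := T1_trunc ih e0 d0.
  have t2 := trunc_L2 J ih.
  have mE : measurable [set x | (l - e < `|T (trunc J h) x|)%R].
    by apply: measurable_gt_set; apply: measurableT_comp => //; exact: mT.
  have mD : measurable (dev e (T (trunc J h)) (T1 h)) by apply: measurable_dev => //; exact: mT.
  have w := wt t2 (le_trans (trunc_mass J ((integrable_mass h).1 ih).1) hN) N0 le0.
  rewrite EFinD; apply: le_trans (leeD w hJ); apply: le_trans (measureU2 _ mE mD).
  apply: le_measure; rewrite ?inE//; first exact: measurableU.
  move=> x /= lx; have [h1|h1] := ltP (l - e) `|T (trunc J h) x|; first by left.
  right; rewrite /dev/=; have := ler_distD 0 (T1 h x) (T (trunc J h) x).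
  have := lerB_dist (T1 h x) (T (trunc J h) x); rewrite distrC; lra.
have := key (l / 2) 1; rewrite divr_gt0//= => /(_ _ ltr01) hfin.
set r := mu _ in key hfin *.
have rE : r = (fine r)%:E.
  rewrite fineK// ge0_fin_numE ?measure_ge0//.
  by apply: le_lt_trans (hfin _) _; [lra|exact: ltry].
have r0 : 0 <= fine r by rewrite fine_ge0// measure_ge0.
rewrite rE lee_fin in key *.
rewrite ler_pdivlMr//; apply/ler_addgt0Pr => e e0.
have r1 : 0 < 2 * (fine r + 1) by lra.
pose d := Num.min (l / 2) (e / (2 * (fine r + 1))).
have d0 : 0 < d by rewrite lt_min !divr_gt0.
have dl : d <= l / 2 by rewrite ge_min lexx.
have de : d * (2 * (fine r + 1)) <= e by rewrite -ler_pdivlMr// /d ge_min lexx orbT.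
have ld : 0 < l - d by lra.
have e1 : 0 < e / (2 * l) by rewrite divr_gt0// mulr_gt0.
have := key d (e / (2 * l)); rewrite d0/= => /(_ _ e1).
have -> : d < l by lra.
move=> /(_ isT) h1.
have h2 : fine r * (l - d) <= Cw * N + e / (2 * l) * (l - d).
  have h3 : fine r * (l - d) <= (Cw * N / (l - d) + e / (2 * l)) * (l - d) by rewrite ler_pM2r.
  by rewrite mulrDl divfK ?gt_eqF// in h3.
have h4 : e / (2 * l) * (l - d) <= e / 2.
  have -> : e / 2 = e / (2 * l) * l by field; rewrite gt_eqF.
  by rewrite ler_pM2l//; lra.
have h5 : 0 <= fine r * d by rewrite mulr_ge0// ltW.
lra.
Qed.

(** Truncation is not additive; linearity is obtained along the sequence
c trunc j f + trunc j g, which also converges to c f + g. *)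
Lemma T1_lin c f g : mu.-integrable setT (EFin \o f) ->
  mu.-integrable setT (EFin \o g) ->
  {ae mu, forall x, T1 (fun y => c * f y + g y) x = c * T1 f x + T1 g x}.
Proof.
move=> fi gi; have [mf _] := (integrable_mass f).1 fi.
have [mg _] := (integrable_mass g).1 gi.
have lin1 (u w : 'rV[R]_n -> R) : mu.-integrable setT (EFin \o u) ->
    mu.-integrable setT (EFin \o w) ->
    mu.-integrable setT (EFin \o (fun y => c * u y + w y)).
  by move=> ui wi; exact: (integrableD measurableT (integrableZl measurableT c ui) wi).
have ih := lin1 _ _ fi gi.
pose v j y := c * trunc j f y + trunc j g y.
have v2 j : v j \in Lfun mu 2%:E by apply: L2_lin; exact: trunc_L2.
have v1 j : mu.-integrable setT (EFin \o v j) by apply: lin1; exact: trunc_L1.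
have c1 : 0 < 2 * (`|c| + 1) by rewrite mulr_gt0// ltr_wpDl.
have c3 : `|c| + 1 != 0 by rewrite gt_eqF// ltr_wpDl.
have C1 : cvg_meas (fun j => T (v j)) (T1 (fun y => c * f y + g y)).
  apply: T1_cvg => // d d0.
  have d1 : 0 < d / (2 * (`|c| + 1)) by rewrite divr_gt0.
  have d2 : 0 < d / 2 by rewrite divr_gt0.
  have [J1 h1] := trunc_cvg fi d1; have [J2 h2] := trunc_cvg gi d2.
  exists (maxn J1 J2) => j; rewrite geq_max => /andP[/h1 {}h1 /h2 {}h2].
  have mtf := measurable_trunc j mf; have mtg := measurable_trunc j mg.
  have h3 : (mass (absf (fun y => c * (trunc j f y - f y))%R) setT <= (d / 2)%:E)%E.
    rewrite (_ : mass _ _ = (`|c|%:E * mass (absf (trunc j f \- f)%R) setT)%E); last first.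
      rewrite -ge0_integralZl_EFin//.
      - by apply: eq_integral => x _; rewrite /absf normrM EFinM.
      - by move=> x _; rewrite lee_fin normr_ge0.
      - apply/measurable_EFinP; apply: measurableT_comp => //; exact: measurable_funB.
    apply: (le_trans (lee_wpmul2l _ h1)); first by rewrite lee_fin.
    rewrite -EFinM lee_fin.
    have -> : d / 2 = (`|c| + 1) * (d / (2 * (`|c| + 1))).
      by field; exact: c3.
    by rewrite ler_pM2r//; lra.
  have := massD_le _ (measurable_funB mtg mg) h3 h2; rewrite -splitr.
  rewrite (_ : mass _ _ = mass (absf (v j \- (fun y => c * f y + g y))%R) setT); last first.
    by apply: eq_integral => x _; rewrite /absf /v/=; congr (`|_|%:E); ring.
  by apply; apply: measurable_funM => //; exact: measurable_funB.
have mTf := measurable_T1 fi; have mTg := measurable_T1 gi.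
apply: (cvg_meas_unique (X := fun j => T (v j))) => //.
- by move=> j; exact: mT.
- exact: measurable_T1.
- by apply: measurable_funD => //; exact: measurable_funM.
move=> e d e0 d0.
have e1 : 0 < e / (2 * (`|c| + 1)) by rewrite divr_gt0.
have e2 : 0 < e / 2 by rewrite divr_gt0.
have d2 : 0 < d / 2 by rewrite divr_gt0.
have [J1 h1] := T1_trunc fi e1 d2; have [J2 h2] := T1_trunc gi e2 d2.
exists (maxn J1 J2) => j; rewrite geq_max => /andP[/h1 {}h1 /h2 {}h2].
rewrite [d]splitr EFinD; apply: le_trans (leeD h1 h2).
have m1 : measurable (dev (e / (2 * (`|c| + 1))) (T (trunc j f)) (T1 f)).
  by apply: measurable_dev => //; apply: mT; exact: trunc_L2.
have m2 : measurable (dev (e / 2) (T (trunc j g)) (T1 g)).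
  by apply: measurable_dev => //; apply: mT; exact: trunc_L2.
apply: le_trans (measureU2 _ m1 m2); apply: ae_measure_le.
- apply: measurable_dev; first exact: mT.
  by apply: measurable_funD => //; exact: measurable_funM.
- exact: measurableU.
have [_ lin _] := hT.
have := lin c _ _ (trunc_L2 j fi) (trunc_L2 j gi); apply: filterS => x Tx.
rewrite /dev/= /v Tx => ex; apply: contrapT => /not_orP[/negP + /negP].
rewrite -!leNgt => a1 a2.
have : `|c * T (trunc j f) x + T (trunc j g) x - (c * T1 f x + T1 g x)| <=
    `|c| * `|T (trunc j f) x - T1 f x| + `|T (trunc j g) x - T1 g x|.
  rewrite -normrM; apply: le_trans (ler_normD _ _).
  by rewrite le_eqVlt; apply/orP; left; apply/eqP; congr (`|_|); ring.
have : `|c| * `|T (trunc j f) x - T1 f x| <= e / 2.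
  have -> : e / 2 = (`|c| + 1) * (e / (2 * (`|c| + 1))).
    by field; exact: c3.
  by apply: ler_pM => //; lra.
lra.
Qed.

(** For the exceptional set in [T1_kernel], whose measurability would require that
of the kernel integral in x. *)
Lemma negligible_small (Z : set 'rV[R]_n) :
  (forall d : R, 0 < d -> exists A, [/\ measurable A, Z `<=` A & (mu A <= d%:E)%E]) ->
  mu.-negligible Z.
Proof.
move=> h; have /choice[A hA] : forall l : nat, exists A,
    [/\ measurable A, Z `<=` A & (mu A <= (l.+1%:R^-1)%:E)%E].
  by move=> l; apply: h; rewrite invr_gt0.
have mA l : measurable (A l) by have [] := hA l.
exists (\bigcap_l A l); split.
- exact: bigcap_measurable.
- apply: le0_small => // d d0; have [l _ hl] := near_infty_natSinv_lt (PosNum d0).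
  have [_ _ hm] := hA l.
  apply: (@le_trans _ _ (mu (A l))).
    apply: le_measure; rewrite ?inE//; first exact: bigcap_measurable.
    exact: bigcap_inf.
  by apply: (le_trans hm); rewrite lee_fin ltW//; exact: (hl l (leqnn _)).
- by move=> x Zx l _; have [_ + _] := hA l; apply.
Qed.

Section kernel_formula.
Variables (omega : R -> R) (CK D : R) (K : 'rV[R]_n -> 'rV[R]_n -> R).
Hypothesis n0 : (0 < n)%N.
Hypothesis momega : modulus_of_continuity omega.
Hypothesis hD : (dini omega <= D%:E)%E.
Hypothesis hcz : cz_operator omega CK K T.

(** The kernel formula on a cube P for functions vanishing on 3P.  There the
kernel is bounded, so its integrals converge uniformly on P along the
truncations, while T converges in measure. *)
Lemma T1_kernel k m h : mu.-integrable setT (EFin \o h) ->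
  (forall y, tcube k m y -> h y = 0) ->
  {ae mu, forall x, dcube k m x -> T1 h x = \int[mu]_y (K x y * h y)}.
Proof.
move=> ih h0; have [_ hK hrep] := hcz; have [mh _] := (integrable_mass h).1 ih.
pose I x := \int[mu]_y (K x y * h y).
have neg (e : R) : 0 < e ->
    mu.-negligible [set x | dcube k m x /\ 2 * e < `|T1 h x - I x|].
  move=> e0; apply: negligible_small => d d0.
  have s0 : 0 < side k ^+ n :> R by rewrite exprn_gt0// side_gt0.
  have CK0 := CK_ge0 n0 hK.
  pose c := CK / side k ^+ n; have c0 : 0 <= c by rewrite divr_ge0// ltW.
  have d1 : 0 < e / (c + 1) by rewrite divr_gt0// ltr_wpDl.
  have [J1 h1] := trunc_cvg ih d1; have [J2 h2] := T1_trunc ih e0 d0.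
  pose j := maxn J1 J2.
  have {}h1 := h1 j (leq_maxl _ _); have {}h2 := h2 j (leq_maxr _ _).
  have t0 y : tcube k m y -> trunc j h y = 0 by move=> /h0; exact: trunc_eq0.
  have [N [mN N0 hN]] := hrep _ (trunc_L2 j ih).
  exists (dev e (T (trunc j h)) (T1 h) `|` N); split.
  - apply: measurableU => //; apply: measurable_dev; first by apply: mT; exact: trunc_L2.
    exact: measurable_T1.
  - move=> x [xm ex]; have [Nx|nN] := pselect (N x); [by right|left].
    have Tx : T (trunc j h) x = \int[mu]_y (K x y * trunc j h y).
      apply: contrapT => hx; apply: nN; apply: hN => /= /(_ _) H; apply: hx; apply: H.
      exact: not_supp_tcube t0 xm.
    have [i1 _] := kernel_away n0 momega hD hK ih h0 xm.
    have [i2 _] := kernel_away n0 momega hD hK (trunc_L1 j ih) t0 xm.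
    have id : mu.-integrable setT (EFin \o (trunc j h \- h)%R).
      exact: (integrableB measurableT (trunc_L1 j ih) ih).
    have d0' y : tcube k m y -> (trunc j h \- h)%R y = 0.
      by move=> ty; rewrite /= t0// h0// subrr.
    have [i3 b3] := kernel_away n0 momega hD hK id d0' xm.
    have close : `|T (trunc j h) x - I x| <= e.
      rewrite Tx /I -RintegralB//.
      rewrite (_ : \int[mu]_y _ = \int[mu]_y (K x y * (trunc j h \- h)%R y)); last first.
        by apply: eq_Rintegral => y _; rewrite -mulrBr.
      apply: le_normr_RintegralT => //; apply: (le_trans b3).
      apply: (le_trans (lee_wpmul2l _ h1)); first by rewrite lee_fin.
      rewrite -EFinM lee_fin -/c mulrCA -[leRHS]mulr1 ler_pM2l//.
      by rewrite ler_pdivrMr ?mul1r ?ltr_wpDl//; lra.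
    rewrite /dev/=; have := ler_distD (T (trunc j h) x) (T1 h x) (I x).
    by rewrite [`|T1 h x - T _ x|]distrC; move: ex; rewrite /=; lra.
  - apply: (le_trans (measureU2 _ _ mN)).
      apply: measurable_dev; first by apply: mT; exact: trunc_L2.
      exact: measurable_T1.
    by rewrite [X in (_ + X)%E](_ : _ = 0%E) ?adde0.
have : mu.-negligible (\bigcup_i [set x | dcube k m x /\ 2 * i.+1%:R^-1 < `|T1 h x - I x|]).
  by apply: negligible_bigcup => i; apply: neg; rewrite invr_gt0.
apply: negligibleS => x /= /not_implyP[xm /eqP].
rewrite -subr_eq0 -normr_gt0 => d0.
have d2 : 0 < `|T1 h x - I x| / 2 by rewrite divr_gt0.
have [i _ hi] := near_infty_natSinv_lt (PosNum d2).
exists i => //=; split => //.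
have : i.+1%:R^-1 < `|T1 h x - I x| / 2 by exact: (hi i (leqnn _)).
by move: (_^-1 : R) => w; lra.
Qed.

End kernel_formula.
End l1_extension.

(** The two properties of an operator on L^1 from which sparse domination
follows.  In the oscillation property the set G of full measure is
quantified before the two points: in [good_set] one of them is picked in a set
of positive measure. *)
Record weak_osc {R : realType} {n : nat}
    (T1 : ('rV[R]_n -> R) -> 'rV[R]_n -> R) (C : R) : Prop := WeakOsc {
  wo_ge0 : 0 <= C ;
  wo_measurable : forall h, (lebesgue_rV R n).-integrable setT (EFin \o h) ->
    measurable_fun setT (T1 h) ;
  wo_lin : forall c f g, (lebesgue_rV R n).-integrable setT (EFin \o f) ->
    (lebesgue_rV R n).-integrable setT (EFin \o g) ->
    {ae lebesgue_rV R n, forall x,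
      T1 (fun y => c * f y + g y) x = c * T1 f x + T1 g x} ;
  wo_weak : forall h (N l : R), (lebesgue_rV R n).-integrable setT (EFin \o h) ->
    (mass (absf h) setT <= N%:E)%E -> 0 <= N -> 0 < l ->
    (lebesgue_rV R n [set x | (l < `|T1 h x|)%R] <= (C * N / l)%:E)%E ;
  wo_osc : forall k m h (B : R), (lebesgue_rV R n).-integrable setT (EFin \o h) ->
    (forall y, tcube k m y -> h y = 0) ->
    (forall i, (mass (absf h) (anc k m i) <= (B * (3 * side (k + i%:Z)) ^+ n)%:E)%E) ->
    exists G : set 'rV[R]_n, {ae lebesgue_rV R n, forall x, dcube k m x -> G x} /\
      forall x x', dcube k m x -> dcube k m x' -> G x -> G x' ->
        `|T1 h x - T1 h x'| <= C * B }.

Section cz_weak_osc.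
Context {R : realType} {n : nat} (n0 : (0 < n)%N).
Local Notation mu := (lebesgue_rV R n).
Variables (omega : R -> R) (CK D A : R) (K : 'rV[R]_n -> 'rV[R]_n -> R).
Variable (T : ('rV[R]_n -> R) -> 'rV[R]_n -> R).
Hypothesis momega : modulus_of_continuity omega.
Hypothesis hD : (dini omega <= D%:E)%E.
Hypothesis hT : cz_operator omega CK K T.
Hypothesis hA : (opnorm_L2 T <= A%:E)%E.

Let hTl : bounded_linear_L2 T. Proof. by case: hT. Qed.
Let hK : cz_kernel omega CK K. Proof. by case: hT. Qed.

Lemma weak_const_ge0 : 0 <= @weak_const R n.
Proof. by rewrite /weak_const !addr_ge0 ?mulr_ge0 ?addr_ge0 ?exprn_ge0 ?mulr_ge0 ?exprn_ge0. Qed.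

(** The decomposition needs strictly positive constants; the general case is
the limit of C + e and N + e as e tends to 0. *)
Lemma weak_type_L2 g (N l : R) : g \in Lfun mu 2%:E ->
  (mass (absf g) setT <= N%:E)%E -> 0 <= N -> 0 < l ->
  (mu [set x | (l < `|T g x|)%R] <= (@weak_const R n * (A + CK + D) * N / l)%:E)%E.
Proof.
move=> g2 gN N0 l0; set C := A + CK + D.
have A0 := A_ge0 hA; have CK0 := CK_ge0 n0 hK; have D0 := D_ge0 momega hD.
have key (e : R) : 0 < e -> (mu [set x | (l < `|T g x|)%R] <= (@weak_const R n * (C + e) * (N + e) / l)%:E)%E.
  move=> e0; apply: (weak_type_stopping n0 momega hD hT hA) => //; [rewrite /C; lra|rewrite /C; lra|rewrite /C; lra|lra|].
  by apply: (le_trans gN); rewrite lee_fin; lra.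
apply/lee_addgt0Pr => d d0.
pose M := @weak_const R n * (C + N + 1) / l.
have M0 : 0 <= M by rewrite divr_ge0 ?(ltW l0)// mulr_ge0 ?weak_const_ge0// /C; lra.
(* M bounds the slope in e of the right-hand side for e <= 1. *)
pose e := Num.min 1 (d / (M + 1)).
have e0 : 0 < e by rewrite lt_min ltr01 divr_gt0// ltr_wpDl.
have e1 : e <= 1 by rewrite ge_min lexx.
have ed : e * (M + 1) <= d by rewrite -ler_pdivlMr ?ltr_wpDl// /e ge_min lexx orbT.
apply: (le_trans (key _ e0)); rewrite -EFinD lee_fin.
have -> : @weak_const R n * (C + e) * (N + e) / l =
   @weak_const R n * C * N / l + e * (@weak_const R n * (C + N + e) / l) by field; rewrite gt_eqF.
rewrite lerD2l; apply: le_trans ed; rewrite ler_pM2l//.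
apply: (@le_trans _ _ M); last by rewrite lerDl.
rewrite /M ler_pM2r ?invr_gt0//; apply: ler_wpM2l; first exact: weak_const_ge0.
by rewrite lerD2l.
Qed.

Definition osc_const : R := 2 * (6 * 2 ^+ n) ^+ n.

(** Calderon-Zygmund operators enter the argument through this statement only. *)
Lemma cz_weak_osc : weak_osc (L1_extension T) ((@weak_const R n + osc_const) * (A + CK + D)).
Proof.
have A0 := A_ge0 hA; have CK0 := CK_ge0 n0 hK; have D0 := D_ge0 momega hD.
have C0 : 0 <= A + CK + D by rewrite !addr_ge0.
have Cw0 : 0 <= @weak_const R n * (A + CK + D) by rewrite mulr_ge0// weak_const_ge0.
have co0 : 0 <= osc_const by rewrite mulr_ge0// exprn_ge0// mulr_ge0// exprn_ge0.
split.
- by rewrite mulr_ge0// addr_ge0// weak_const_ge0.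
- by move=> h; exact: (measurable_T1 hTl Cw0 weak_type_L2).
- by move=> c f g; exact: (T1_lin hTl Cw0 weak_type_L2).
- move=> h N l ih hN N0 l0.
  apply: (le_trans (T1_weak hTl Cw0 weak_type_L2 ih hN N0 l0)).
  rewrite lee_fin ler_pM2r ?invr_gt0// ler_wpM2r// ler_wpM2r//.
  by rewrite lerDl.
- move=> k m h B ih h0 hB.
  exists [set x | dcube k m x -> L1_extension T h x = \int[mu]_y (K x y * h y)]; split.
    have := T1_kernel hTl Cw0 weak_type_L2 n0 momega hD hT ih h0.
    by apply: filterS => x /= + _; apply.
  move=> x x' xm xm' /(_ xm) -> /(_ xm') ->.
  apply: (le_trans (kernel_osc n0 momega hD hK ih h0 xm xm' hB)).
  have B0 : 0 <= B.
    have := le_trans (mass_ge0 (fun y => normr_ge0 (h y)) _) (hB 0%N); rewrite lee_fin.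
    by rewrite pmulr_lge0// exprn_gt0// mulr_gt0// side_gt0.
  rewrite -/osc_const ler_wpM2r//; apply: ler_pM => //; first by rewrite addr_ge0.
    by rewrite lerDr weak_const_ge0.
  by rewrite lerD2r lerDr.
Qed.

End cz_weak_osc.

(** * Exceptional sets and one step of the recursion *)

Section good_sets.
Context {R : realType} {n : nat} (n0 : (0 < n)%N).
Local Notation mu := (lebesgue_rV R n).
Local Notation dcubeq q := (@dcube R n q.1 q.2).
Local Notation tcubeq q := (@tcube R n q.1 q.2).
Local Notation intL1 h := (mu.-integrable setT (EFin \o h)).
Implicit Types (k : int) (m : {ffun 'I_n -> int}) (x y : 'rV[R]_n).
Implicit Types (q p : int * {ffun 'I_n -> int}) (g h : 'rV[R]_n -> R).
Variables (T1 : ('rV[R]_n -> R) -> 'rV[R]_n -> R) (C : R).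
Hypothesis W : weak_osc T1 C.

Let C0 : 0 <= C. Proof. by case: W. Qed.

(** The height is the one that gives the measure s, and it may be zero, a case
that the weak type inequality does not contain. *)
Lemma weak_type_level h (N s : R) : intL1 h -> (mass (absf h) setT <= N%:E)%E ->
  0 <= N -> 0 < s -> (mu [set x | (C * N / s < `|T1 h x|)%R] <= s%:E)%E.
Proof.
move=> ih hN N0 s0; have wk := wo_weak W ih hN N0.
have : 0 <= C * N by rewrite mulr_ge0.
rewrite le_eqVlt => /predU1P[CN|CN]; last first.
  have l0 : 0 < C * N / s by rewrite divr_gt0.
  have -> : s%:E = (C * N / (C * N / s))%:E; last exact: wk.
  by congr EFin; rewrite invf_div mulrC divfK// gt_eqF.
rewrite -CN mul0r.
have mT := wo_measurable W ih.
rewrite [X in (mu X <= _)%E](_ : _ = \bigcup_i [set x | i.+1%:R^-1 < `|T1 h x|]).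
  rewrite measure_bigcup0 ?lee_fin ?(ltW s0)// => i.
    by apply: measurable_gt_set; exact: measurableT_comp.
  move=> _; apply/eqP; rewrite eq_le measure_ge0 andbT.
  by apply: (le_trans (wk _ _)); rewrite ?invr_gt0// -CN mul0r.
apply/seteqP; split => x /=.
  move=> d0; have [i _ hi] := near_infty_natSinv_lt (PosNum d0).
  by exists i => //; exact: (hi i (leqnn _)).
by move=> [i _] /=; apply: lt_trans; rewrite invr_gt0.
Qed.

Lemma maximal_level g (N s : R) : measurable_fun setT g -> (mass (absf g) setT <= N%:E)%E ->
  0 <= N -> 0 < s -> (mu (maximal_above (absf g) ((3 ^ n)%:R * N / s)) <= s%:E)%E.
Proof.
move=> mg gN N0 s0.
have mag : measurable_fun setT (absf g) by exact: measurableT_comp.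
have ag0 x : 0 <= absf g x by exact: normr_ge0.
have p3 : 0 < (3 ^ n)%:R :> R by rewrite ltr0n expn_gt0.
move: N0; rewrite le_eqVlt => /predU1P[N0|N0]; last first.
  have a0 : 0 < (3 ^ n)%:R * N / s by rewrite divr_gt0// mulr_gt0.
  have := weak_type_maximal mag ag0 a0 gN.
  rewrite (_ : (3 ^ n)%:R * (N / _) = s)//; field.
  by rewrite !gt_eqF.
rewrite -N0 mulr0 mul0r (_ : maximal_above _ _ = set0) ?measure0 ?lee_fin ?ltW//.
apply/seteqP; split => // x [k]; rewrite mul0r ltNge => /negP; apply.
rewrite -N0 in gN; apply: le_trans gN.
by apply: mass_le => //; exact: measurable_grid_cube.
Qed.

Definition cutoff (A : set 'rV[R]_n) h y : R := h y * \1_A y.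

Lemma cutoff_in A h y : A y -> cutoff A h y = h y.
Proof. by move=> Ay; rewrite /cutoff indicE mem_set// mulr1. Qed.

Lemma cutoff_out A h y : ~ A y -> cutoff A h y = 0.
Proof. by move=> Ay; rewrite /cutoff indicE memNset// mulr0. Qed.

Lemma cutoff_le A h y : `|cutoff A h y| <= `|h y|.
Proof.
have [Ay|nAy] := pselect (A y); first by rewrite cutoff_in.
by rewrite cutoff_out// normr0.
Qed.

Lemma measurable_cutoff A h : measurable A -> measurable_fun setT h ->
  measurable_fun setT (cutoff A h).
Proof. by move=> mA mh; apply: measurable_funM => //; exact: measurable_indic. Qed.

Lemma cutoff_int A h : measurable A -> intL1 h -> intL1 (cutoff A h).
Proof.
move=> mA /integrable_mass[mh hoo]; apply/integrable_mass.
have mc := measurable_cutoff mA mh; split => //.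
by apply: le_lt_trans hoo; apply: mass_abs_le => // x _; exact: cutoff_le.
Qed.

Lemma mass_cutoff A h : measurable A -> measurable_fun setT h ->
  mass (absf (cutoff A h)) setT = mass (absf h) A.
Proof.
move=> mA mh; rewrite /mass [RHS]integral_mkcond; apply: eq_integral => x _.
rewrite patchE /absf /cutoff indicE; case: (x \in A); first by rewrite mulr1.
by rewrite mulr0 normr0.
Qed.

Lemma cutoff_split A h y : h y = cutoff A h y + cutoff (~` A) h y.
Proof.
have [Ay|nAy] := pselect (A y).
  by rewrite cutoff_in// cutoff_out ?addr0// => /(_ Ay).
by rewrite cutoff_out// cutoff_in ?add0r.
Qed.

Lemma T1_add f g h : intL1 f -> intL1 g -> (forall y, h y = f y + g y) ->
  {ae mu, forall x, T1 h x = T1 f x + T1 g x}.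
Proof.
move=> fi gi hE; have := wo_lin W 1 fi gi; apply: filterS => x.
by rewrite mul1r => <-; congr T1; apply/funext => y; rewrite hE mul1r.
Qed.

(** See the end of [good_set]: 1 for T1 g, 4 * 3 ^ n times 3 ^ n for the part
of g near P, and 3 ^ n for the oscillation of the part far from P. *)
Definition tail_const : R := 1 + (4 * 3 ^+ n + 1) * 3 ^+ n.

(** E is the set where T1 g or the maximal function of g is large.  If a cube P
meets the complement of E, the mass of g on the triples of P and its ancestors
is controlled.  If E covers at most half of P, some point x' of P is outside E
and outside the set where T1 (g 1_3P) is large, which has measure at most
|P| / 4; at x' the far part is a difference of two controlled terms, and by
oscillation it is controlled on all of P. *)
Lemma good_set g (N s : R) : intL1 g -> (mass (absf g) setT <= N%:E)%E ->
  0 <= N -> 0 < s -> exists E : set 'rV[R]_n, [/\ measurable E,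
    (mu E <= (2 * s)%:E)%E, forall x, ~ E x -> `|T1 g x| <= C * N / s &
    forall k m, (mu (E `&` dcube k m) <= (side k ^+ n / 2)%:E)%E ->
    {ae mu, forall x, dcube k m x -> `|T1 (cutoff (~` tcube k m) g) x| <= C * tail_const * N / s}].
Proof.
move=> ig gN N0 s0; have [mg _] := (integrable_mass g).1 ig.
have mT := wo_measurable W ig.
have mag : measurable_fun setT (absf g) by exact: measurableT_comp.
have ag0 x : 0 <= absf g x by exact: normr_ge0.
pose al := (3 ^ n)%:R * N / s.
have al0 : 0 <= al by rewrite divr_ge0 ?mulr_ge0// ltW.
pose E1 := [set x | (C * N / s < `|T1 g x|)%R].
pose E2 := maximal_above (absf g) al.
have mE1 : measurable E1 by apply: measurable_gt_set; exact: measurableT_comp.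
have mE2 : measurable E2 by exact: measurable_maximal_above.
exists (E1 `|` E2); split.
- exact: measurableU.
- apply: (le_trans (measureU2 _ mE1 mE2)).
  rewrite mulr_natl mulr2n EFinD leeD//; first exact: weak_type_level.
  exact: maximal_level.
- by move=> x /not_orP[/negP + _]; rewrite /E1/= -leNgt.
move=> k m; set P := dcube k m; set E := E1 `|` E2 => hP.
set tP := tcube k m.
have mtP : measurable tP by exact: measurable_grid_cube.
have mP : measurable P by exact: measurable_grid_cube.
have mE : measurable E by exact: measurableU.
have sk : 0 < side k ^+ n :> R by rewrite exprn_gt0// side_gt0.
have muP : mu P = (side k ^+ n)%:E by exact: mu_dcube.
have bnd x : P x -> ~ E x -> forall i,
    (mass (absf g) (anc k m i) <= (al * (3 * side (k + i%:Z)) ^+ n)%:E)%E.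
  move=> Px /not_orP[_ nE2] i; rewrite (anc_idx _ Px) leNgt; apply/negP => h.
  by apply: nE2; exists (k + i%:Z).
have [x0 [Px0 nEx0]] : exists x, P x /\ ~ E x.
  apply: contrapT => h.
  have PE : P `<=` E `&` P.
    by move=> x Px; split => //; apply: contrapT => nE; apply: h; exists x.
  have : (mu P <= mu (E `&` P))%E by apply: le_measure; rewrite ?inE//; exact: measurableI.
  by move=> /le_trans /(_ hP); rewrite muP lee_fin; lra.
pose gP := cutoff tP g; pose gc := cutoff (~` tP) g.
have igP : intL1 gP by exact: cutoff_int.
have mtPC : measurable (~` tP) by exact: measurableC.
have igc : intL1 gc by exact: cutoff_int.
pose N' := al * (3 * side k) ^+ n.
have N'0 : 0 <= N' by rewrite mulr_ge0// exprn_ge0// mulr_ge0// side_ge0.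
have gPN : (mass (absf gP) setT <= N'%:E)%E.
  by rewrite mass_cutoff//; have := bnd _ Px0 nEx0 0%N; rewrite anc0 addr0.
have s4 : 0 < side k ^+ n / 4 :> R by rewrite divr_gt0.
have wP := weak_type_level igP gPN N'0 s4.
set E3 := [set x | _] in wP.
have mE3 : measurable E3.
  by apply: measurable_gt_set; apply: measurableT_comp => //; exact: wo_measurable W _ igP.
have gc0 y : tP y -> gc y = 0 by move=> ty; rewrite /gc cutoff_out// => /(_ ty).
have hB i : (mass (absf gc) (anc k m i) <= (al * (3 * side (k + i%:Z)) ^+ n)%:E)%E.
  apply: le_trans (bnd _ Px0 nEx0 i); apply: mass_abs_le => //.
  - exact: measurable_anc.
  - exact: measurable_cutoff.
  - by move=> x _; exact: cutoff_le.
have [G [aeG oscG]] := wo_osc W igc gc0 hB.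
have aeadd := T1_add igP igc (cutoff_split tP g).
(* E, E3 and the null sets cover at most three quarters of P. *)
have [x' [[Px' nEx'] [nE3x' [Gx' addx']]]] : exists x, (P x /\ ~ E x) /\
    (~ E3 x /\ (G x /\ T1 g x = T1 gP x + T1 gc x)).
  apply: contrapT => h.
  have : {ae mu, forall x, P x -> ((E `&` P) `|` E3) x}.
    apply: filterS2 aeG aeadd => x Gx ax Px.
    have [Ex|nEx] := pselect (E x); first by left; split.
    right; apply: contrapT => nE3; apply: h; exists x; split => //.
    by split => //; split => //; exact: Gx.
  have mEP : measurable (E `&` P) by exact: measurableI.
  move=> /(ae_measure_le mP (measurableU _ _ mEP mE3)).
  move=> /le_trans /(_ (measureU2 _ mEP mE3)) /le_trans /(_ (leeD hP wP)).
  by rewrite [X in (X <= _)%E -> _]muP -EFinD lee_fin; lra.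
apply: filterS aeG => x Gx Px.
have h1 := oscG _ _ Px Px' (Gx Px) Gx'.
have h2 : `|T1 gP x'| <= C * N' / (side k ^+ n / 4) by rewrite leNgt; apply/negP.
have h3 : `|T1 g x'| <= C * N / s.
  by move: nEx' => /not_orP[/negP + _]; rewrite /E1/= -leNgt.
have h4 : `|T1 gc x| <= `|T1 g x'| + `|T1 gP x'| + `|T1 gc x - T1 gc x'|.
  have e : T1 gc x = T1 g x' - T1 gP x' + (T1 gc x - T1 gc x') by rewrite addx'; ring.
  rewrite {1}e.
  by apply: (le_trans (ler_normD _ _)); rewrite lerD2r ler_normB.
apply: (le_trans h4); apply: (le_trans (lerD (lerD h3 h2) h1)).
rewrite /N' /al /tail_const exprMn natrX le_eqVlt; apply/orP; left; apply/eqP.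
by field; rewrite !gt_eqF.
Qed.

End good_sets.

Section sparse_step.
Context {R : realType} {n : nat} (n0 : (0 < n)%N).
Local Notation mu := (lebesgue_rV R n).
Local Notation dcubeq q := (@dcube R n q.1 q.2).
Local Notation tcubeq q := (@tcube R n q.1 q.2).
Local Notation intL1 h := (mu.-integrable setT (EFin \o h)).
Implicit Types (k : int) (m : {ffun 'I_n -> int}) (x y : 'rV[R]_n).
Implicit Types (q p : int * {ffun 'I_n -> int}) (g h : 'rV[R]_n -> R).
Variables (T1 : ('rV[R]_n -> R) -> 'rV[R]_n -> R) (C : R).
Hypothesis W : weak_osc T1 C.

Let C0 : 0 <= C. Proof. by case: W. Qed.

Local Notation c1n := (@tail_const R n).

Section one_cube.
Variables (f b : 'rV[R]_n -> R) (be : R) (k0 : int) (m0 : {ffun 'I_n -> int}).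
Hypotheses (fi : intL1 f) (bfi : intL1 (fun y => b y * f y)).

Local Notation cm := (commutator b T1).

Let v0 : R := side k0 ^+ n.
Definition fmass : R := fine (mass (absf f) (tcube k0 m0)).
Definition oscmass : R := fine (mass (absf (fun y => (b y - be) * f y)) (tcube k0 m0)).
(** The factor 2 ^ (n + 4) is |Q| / s, where 2 s bounds the measure of each of
the two exceptional sets in [sparse_step]. *)
Definition sparse_const : R := 2 ^+ (n + 4) * c1n.
(** Up to the constant, the contribution of the cube to the two sparse
operators; be stands for the average of b over the triple. *)
Definition local_bound x : R := sparse_const * C * ((`|b x - be| * fmass + oscmass) / v0).

(** One step of the recursion, on the cube (k0, m0).  The stopping cubes are
taken at height 2 ^-(n + 1) for the indicator function of the exceptional set
E: by maximality E covers at most half of each of them, which is what the far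
estimate of [good_set] requires, and their total volume is at most
2 ^(n + 1) |E|.  Outside them E is negligible. *)
Lemma sparse_step : exists ST : set (int * {ffun 'I_n -> int}),
  [/\ forall q, ST q -> q.1 < k0 /\ dcubeq q `<=` dcube k0 m0,
      forall q p x, ST q -> ST p -> dcubeq q x -> dcubeq p x -> q = p,
      forall s : seq (int * {ffun 'I_n -> int}), uniq s ->
        (forall q, q \in s -> ST q) -> \sum_(q <- s) side q.1 ^+ n <= v0 / 2 &
      {ae mu, forall x, dcube k0 m0 x ->
        ((forall q, ST q -> ~ dcubeq q x) ->
           `|cm (cutoff (tcube k0 m0) f) x| <= local_bound x) /\
        (forall q, ST q -> dcubeq q x ->
           `|cm (cutoff (tcube k0 m0) f) x| <=
           local_bound x + `|cm (cutoff (tcubeq q) f) x|)}].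
Proof.
have v00 : 0 < v0 by rewrite exprn_gt0// side_gt0.
set Q0 := dcube k0 m0; set t0 := tcube k0 m0.
have mt0 : measurable t0 by exact: measurable_grid_cube.
have mQ0 : measurable Q0 by exact: measurable_grid_cube.
have [mf foo] := (integrable_mass f).1 fi.
pose fb y := (b y - be) * f y.
have fbi : intL1 fb.
  have := integrableD measurableT bfi (integrableZl measurableT (- be) fi).
  congr (mu.-integrable _ _); apply/funext => y; rewrite /fb/= -EFinM -EFinD.
  by congr EFin; ring.
have [mfb fboo] := (integrable_mass fb).1 fbi.
pose g1 := cutoff t0 f; pose g2 := cutoff t0 fb.
have ig1 : intL1 g1 by exact: cutoff_int.
have ig2 : intL1 g2 by exact: cutoff_int.
have massfin h : measurable_fun setT h -> (mass (absf h) setT < +oo)%E ->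
    mass (absf h) t0 = (fine (mass (absf h) t0))%:E.
  move=> mh hoo; rewrite fineK// ge0_fin_numE; last by apply: mass_ge0 => x; exact: normr_ge0.
  apply: le_lt_trans hoo; apply: mass_le => //; first exact: measurableT_comp.
  by move=> x; exact: normr_ge0.
have gN1 : (mass (absf g1) setT <= fmass%:E)%E by rewrite mass_cutoff// massfin.
have gN2 : (mass (absf g2) setT <= oscmass%:E)%E by rewrite mass_cutoff// massfin.
have N10 : 0 <= fmass by rewrite fine_ge0// mass_ge0// => x; exact: normr_ge0.
have N20 : 0 <= oscmass by rewrite fine_ge0// mass_ge0// => x; exact: normr_ge0.
(* With this s, the set E has measure at most 2^-(n+1) |Q0| / 2. *)
pose s := v0 / 2 ^+ (n + 4).
have s0 : 0 < s by rewrite divr_gt0// exprn_gt0.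
have [E1 [mE1 muE1 out1 in1]] := good_set W ig1 gN1 N10 s0.
have [E2 [mE2 muE2 out2 in2]] := good_set W ig2 gN2 N20 s0.
pose E := (E1 `|` E2) `&` Q0.
have mE12 : measurable (E1 `|` E2) by exact: measurableU.
have mE : measurable E by exact: measurableI.
have muE : (mu E <= (4 * s)%:E)%E.
  apply: (@le_trans _ _ (mu (E1 `|` E2))); first exact: measureIl.
  apply: (le_trans (measureU2 _ mE1 mE2)); apply: (le_trans (leeD muE1 muE2)).
  by rewrite -EFinD lee_fin; lra.
pose phi x : R := \1_E x.
have mphi : measurable_fun setT phi by exact: measurable_indic.
have phi0 x : 0 <= phi x by [].
have massE A : measurable A -> mass phi A = mu (E `&` A).
  by move=> mA; rewrite /mass integral_indic.
have mass_bound : (mass phi setT <= (4 * s)%:E)%E by rewrite massE// setIT.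
pose a : R := 2 ^- (n.+1).
have a0 : 0 < a by rewrite invr_gt0 exprn_gt0.
have asv : 4 * s = a * v0 / 2.
  have e16 : (2 ^+ 4 : R) = 16 by ring.
  by rewrite /s /a exprD e16 (exprS 2 n); field; rewrite expf_neq0.
have mdq q : measurable (dcubeq q) by exact: measurable_grid_cube.
pose ST := stopping phi a.
have lb q : ST q -> ((a * side q.1 ^+ n)%:E < mu (E `&` dcubeq q))%E.
  by move=> /stopping_lb; rewrite massE.
have ub q : ST q -> (mu (E `&` dcubeq q) <= (side q.1 ^+ n / 2)%:E)%E.
  move=> /(stopping_ub mphi phi0); rewrite massE// => /le_trans; apply.
  rewrite lee_fin /a (exprS 2 n) le_eqVlt; apply/orP; left; apply/eqP.
  by field; rewrite expf_neq0.
(* E is too small to have this density in a cube as large as Q0. *)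
have STk q : ST q -> q.1 < k0.
  move=> Sq; rewrite ltNge; apply/negP => kq.
  have := lt_le_trans (lb _ Sq) (le_trans (measureIl mu mE (mdq q)) muE).
  rewrite asv lte_fin => h.
  have : v0 <= side q.1 ^+ n.
    rewrite lerXn2r ?nnegrE ?side_ge0//.
    by rewrite /side ler_weXz2l// ler1n.
  move=> h2; have : a * v0 <= a * side q.1 ^+ n by rewrite ler_pM2l.
  have h3 : 0 < a * v0 by rewrite mulr_gt0.
  lra.
have STsub q : ST q -> exists x, dcubeq q x /\ Q0 x.
  move=> Sq; apply: contrapT => h.
  have e0 : E `&` dcubeq q = set0.
    by apply/seteqP; split => // x [[_ Qx] xq]; apply: h; exists x.
  have := lb _ Sq; rewrite e0 measure0 lte_fin ltNge => /negP; apply.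
  by rewrite mulr_ge0 ?(ltW a0)// exprn_ge0// side_ge0.
have STanc q : ST q -> exists2 x, Q0 x & dcubeq q = dcube q.1 (idx q.1 x) /\ k0 = q.1 + `|k0 - q.1|%:Z.
  move=> Sq; have [x [/dcubeP xq Qx]] := STsub _ Sq; exists x => //.
  have lt := STk _ Sq; have ek : k0 = q.1 + `|k0 - q.1|%:Z by move: lt; clear; lia.
  by split; [rewrite xq|exact: ek].
exists ST; split.
- move=> q Sq; split; first exact: STk.
  have [x /dcubeP xQ [-> ek]] := STanc _ Sq.
  by rewrite /Q0 -xQ; apply: dcube_mono; exact: ltW (STk _ Sq).
- by move=> q p x Sq Sp xq xp; exact: (stopping_disj Sq Sp xq xp).
- move=> l ul lS.
  have h : (\sum_(q <- l) mass phi (dcubeq q) <= (4 * s)%:E)%E.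
    apply: le_trans mass_bound; rewrite -ge0_integral_bigsetU//.
    + by apply: mass_le => //; exact: bigsetU_measurable.
    + apply/trivIsetP => q q' /= /lS Sq /lS Sq' /eqP qq'.
      apply/seteqP; split => // x [xq xq']; apply: qq'.
      exact: (stopping_disj Sq Sq' xq xq').
    + by apply/measurable_EFinP; exact: measurable_funTS.
    + by move=> x _; rewrite lee_fin.
  have : ((a * \sum_(q <- l) side q.1 ^+ n)%:E <= (4 * s)%:E)%E.
    apply: le_trans h; rewrite mulr_sumr -sumEFin big_seq [leRHS]big_seq.
    by apply: lee_sum => q /lS /stopping_lb /ltW.
  by rewrite asv lee_fin -mulrA ler_pM2l.
have lbE x : C * c1n * fmass / s * `|b x - be| + C * c1n * oscmass / s = local_bound x.
  have si : s^-1 = 2 ^+ (n + 4) / v0 by rewrite /s invf_div.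
  rewrite /local_bound /sparse_const si -/v0; move: (2 ^+ (n + 4)) => w.
  by field; rewrite gt_eqF.
have c1_1 : 1 <= c1n.
  by rewrite /c1n lerDl mulr_ge0 ?addr_ge0 ?mulr_ge0 ?exprn_ge0.
have lift N : 0 <= N -> C * N / s <= C * c1n * N / s.
  move=> NN; rewrite ler_pM2r ?invr_gt0// ler_wpM2r// -[leLHS]mulr1 ler_wpM2l//.
have e1 : {ae mu, forall x, T1 (fun y => b y * g1 y) x = be * T1 g1 x + T1 g2 x}.
  have := wo_lin W be ig1 ig2; apply: filterS => x <-; congr T1.
  apply/funext => y; rewrite /g1 /g2 /fb.
  have [ty|nty] := pselect (t0 y); first by rewrite !cutoff_in//; ring.
  by rewrite !cutoff_out// !mulr0 addr0.
have stop := stopping_ae n0 mphi phi0 a0 mass_bound.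
have a1 : a < 1.
  by rewrite /a invf_lt1 ?exprn_gt0// exprn_egt1// ltr1n.
have per q : {ae mu, forall x, ST q -> dcubeq q x ->
     `|cm g1 x| <= local_bound x + `|cm (cutoff (tcubeq q) f) x|}.
  have [Sq|nSq] := pselect (ST q); last by apply: aeW => x /nSq.
  have [x0 /dcubeP xQ [eq ek]] := STanc _ Sq.
  set tq := tcubeq q.
  have mtq : measurable tq by exact: measurable_grid_cube.
  have mtqC : measurable (~` tq) by exact: measurableC.
  have tqt0 : tq `<=` t0.
    have -> : tq = tcube (q.1 + 0%:Z) (idx (q.1 + 0%:Z) x0).
      rewrite addr0 /tq; congr tcube.
      by move: (dcube_idx (R := R) q.1 x0); rewrite -eq => /dcubeP ->.
    rewrite /t0 -xQ {1 2}ek; exact: tcube_anc.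
  have half i0 : (mu (i0 `&` dcubeq q) <= mu (E `&` dcubeq q))%E ->
      (mu (i0 `&` dcubeq q) <= (side q.1 ^+ n / 2)%:E)%E.
    by move=> /le_trans; apply; exact: ub.
  have qQ : dcubeq q `<=` Q0.
    by rewrite eq /Q0 -xQ; apply: dcube_mono; exact: ltW (STk _ Sq).
  have hE1 : (mu (E1 `&` dcubeq q) <= (side q.1 ^+ n / 2)%:E)%E.
    apply: half; apply: le_measure; rewrite ?inE; [exact: measurableI..|].
    by move=> x [Ex xq]; split => //; split; [left|exact: qQ].
  have hE2 : (mu (E2 `&` dcubeq q) <= (side q.1 ^+ n / 2)%:E)%E.
    apply: half; apply: le_measure; rewrite ?inE; [exact: measurableI..|].
    by move=> x [Ex xq]; split => //; split; [right|exact: qQ].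
  have aa1 := in1 _ _ hE1; have aa2 := in2 _ _ hE2.
  pose f3 := cutoff tq f.
  have if3 : intL1 f3 by exact: cutoff_int.
  pose g1c := cutoff (~` tq) g1; pose g2c := cutoff (~` tq) g2.
  have ig1c : intL1 g1c by exact: cutoff_int.
  have ig2c : intL1 g2c by exact: cutoff_int.
  have ibf3 : intL1 (fun y => b y * f3 y).
    have := cutoff_int mtq bfi; congr (mu.-integrable _ _); apply/funext => y.
    by rewrite /= /f3 /cutoff mulrA.
  have ad1 : {ae mu, forall x, T1 g1 x = T1 f3 x + T1 g1c x}.
    apply: (T1_add W) => // y; rewrite (cutoff_split tq g1 y); congr (_ + _).
    have [ty|nty] := pselect (tq y); last by rewrite /f3 !cutoff_out.
    by rewrite /f3 /g1 !cutoff_in//; exact: tqt0.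
  have ibg : intL1 (fun y => be * g1c y + g2c y).
    exact: (integrableD measurableT (integrableZl measurableT be ig1c) ig2c).
  have ad2 : {ae mu, forall x, T1 (fun y => b y * g1 y) x =
      T1 (fun y => b y * f3 y) x + T1 (fun y => be * g1c y + g2c y) x}.
    apply: (T1_add W) => // y; rewrite /f3 /g1c /g2c.
    have [ty|nty] := pselect (tq y).
      rewrite (cutoff_in _ ty) (cutoff_out (A := ~` tq)); last by move=> /(_ ty).
      rewrite (cutoff_out (A := ~` tq)); last by move=> /(_ ty).
      by rewrite mulr0 !addr0 /g1 cutoff_in//; exact: tqt0.
    rewrite (cutoff_out _ nty) mulr0 add0r !(cutoff_in (A := ~` tq))//.
    have [ty'|nty'] := pselect (t0 y); first by rewrite /g1 /g2 !cutoff_in// /fb; ring.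
    by rewrite /g1 /g2 !cutoff_out// !mulr0 addr0.
  have ad3 := wo_lin W be ig1c ig2c.
  have ad12 : {ae mu, forall x, T1 g1 x = T1 f3 x + T1 g1c x /\
      T1 (fun y => b y * g1 y) x =
      T1 (fun y => b y * f3 y) x + (be * T1 g1c x + T1 g2c x)}.
    have : {ae mu, forall x, T1 (fun y => b y * g1 y) x =
      T1 (fun y => b y * f3 y) x + (be * T1 g1c x + T1 g2c x)}.
      by apply: filterS2 ad2 ad3 => x -> ->.
    by move: ad1; apply: filterS2.
  have aa12 : {ae mu, forall x, dcubeq q x -> `|T1 g1c x| <= C * c1n * fmass / s /\
      `|T1 g2c x| <= C * c1n * oscmass / s}.
    by move: aa1 aa2; apply: filterS2 => x h1 h2 xq; split; [exact: h1|exact: h2].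
  move: ad12 aa12; apply: filterS2 => x [E1x E2x] hx _ xq.
  have [h1 h2] := hx xq.
  (* The commutator of the far part g1c, after subtracting the constant be from b. *)
  have -> : cm g1 x = (b x - be) * T1 g1c x - T1 g2c x + cm f3 x.
    by rewrite /commutator E1x E2x; ring.
  apply: (le_trans (ler_normD _ _)); rewrite lerD2r -lbE.
  apply: (le_trans (ler_normB _ _)); apply: lerD => //.
  by rewrite normrM mulrC ler_wpM2r.
have := ae_forall_countable per; move: e1 stop; apply: filterS3 => x e1x stopx perx xQ.
split; last by move=> q; exact: perx.
move=> /stopx; rewrite /phi indicE.
have [Ex|nEx] := pselect (E x); first by rewrite mem_set//= leNgt a1.
move=> _.
have [nE1 nE2] : ~ E1 x /\ ~ E2 x.
  by split => Ei; apply: nEx; split => //; [left|right].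
have h1 := out1 _ nE1; have h2 := out2 _ nE2.
have -> : cm g1 x = (b x - be) * T1 g1 x - T1 g2 x by rewrite /commutator e1x; ring.
rewrite -lbE; apply: (le_trans (ler_normB _ _)); apply: lerD.
  rewrite normrM mulrC ler_wpM2r//; apply: (le_trans h1); exact: lift.
by apply: (le_trans h2); exact: lift.
Qed.

End one_cube.
End sparse_step.

(** * The sparse family *)

Section recursion.
Context {R : realType} {n : nat} (n0 : (0 < n)%N).
Local Notation mu := (lebesgue_rV R n).
Local Notation idxT := (int * {ffun 'I_n -> int})%type.
Local Notation dcubeq q := (@dcube R n q.1 q.2).
Local Notation tcubeq q := (@tcube R n q.1 q.2).
Local Notation vol q := (@side R q.1 ^+ n).
Local Notation intL1 h := (mu.-integrable setT (EFin \o h)).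
Implicit Types (q p : int * {ffun 'I_n -> int}).
Variables (T1 : ('rV[R]_n -> R) -> 'rV[R]_n -> R) (C : R).
Hypothesis W : weak_osc T1 C.
Variables (f b : 'rV[R]_n -> R) (be : idxT -> R) (F0 : set idxT).
Hypotheses (fi : intL1 f) (bfi : intL1 (fun y => b y * f y)).
Hypothesis F0_disj : forall q p x, F0 q -> F0 p -> dcubeq q x -> dcubeq p x -> q = p.
Hypothesis F0_cover : forall x, exists2 q, F0 q & dcubeq q x.
Hypothesis F0_supp : forall q y, F0 q -> f y != 0 -> tcubeq q y.

Local Notation lbound q := (local_bound C f b (be q) q.1 q.2).
Local Notation cmq q := (commutator b T1 (cutoff (tcubeq q) f)).

(** The generations of stopping cubes, starting from the partition F0.  Each
cube loses at most half of its volume to the next generation.  The union of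
the i-th generation decays like 2 ^-i on each initial cube, so almost every
point belongs to finitely many generations, and the inequalities of the steps
telescope along the cubes that contain it. *)
Theorem sparse_family : exists (F : set idxT) (E : idxT -> set 'rV[R]_n),
  [/\ forall q, F q -> [/\ measurable (E q), E q `<=` dcubeq q &
        ((vol q / 2)%:E <= mu (E q))%E],
      forall q p x, F q -> F p -> E q x -> E p x -> q = p &
      {ae mu, forall x, exists s : seq idxT,
        [/\ uniq s, forall q, q \in s -> F q /\ dcubeq q x &
          `|commutator b T1 f x| <= \sum_(q <- s) lbound q x]}].
Proof.
have /choice[ch hch] := fun q => sparse_step n0 W (be q) q.1 q.2 fi bfi.
have ch_sub q p : ch q p -> p.1 < q.1 /\ dcubeq p `<=` dcubeq q.
  by have [h _ _ _] := hch q; exact: h.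
have ch_disj q p p' x : ch q p -> ch q p' -> dcubeq p x -> dcubeq p' x -> p = p'.
  by have [_ h _ _] := hch q; exact: h.
have ch_vol q (s : seq idxT) : uniq s -> (forall p, p \in s -> ch q p) ->
    \sum_(p <- s) vol p <= vol q / 2.
  by have [_ _ h _] := hch q; exact: h.
have mdq q : measurable (dcubeq q) by exact: measurable_grid_cube.
have vol0 q : 0 < vol q by rewrite exprn_gt0// side_gt0.
pose fix gen (i : nat) : set idxT :=
  if i is j.+1 then [set p | exists2 q, gen j q & ch q p] else F0.
have gen_disj i q p x : gen i q -> gen i p -> dcubeq q x -> dcubeq p x -> q = p.
  elim: i q p => [|i IH] q p; first exact: F0_disj.
  move=> [q' gq' qq'] [p' gp' pp'] xq xp.
  have [_ sq] := ch_sub _ _ qq'; have [_ sp] := ch_sub _ _ pp'.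
  have e := IH _ _ gq' gp' (sq _ xq) (sp _ xp); rewrite -e in pp'.
  exact: ch_disj qq' pp' xq xp.
pose G i := \bigcup_(q in gen i) dcubeq q.
have mG i : measurable (G i) by exact: bigcup_measurable_countable.
(* A point of a later generation lies in a stopping cube of its ancestor. *)
have descend i j q x : gen i q -> dcubeq q x -> G (i + j).+1 x ->
    exists2 p, ch q p & dcubeq p x.
  move=> gq xq; elim: j => [|j IH].
    rewrite addn0 => -[p [q' gq' q'p] xp]; exists p => //.
    have [_ sp] := ch_sub _ _ q'p.
    by rewrite (gen_disj _ _ _ _ gq gq' xq (sp _ xp)).
  rewrite addnS => -[p [q' gq' q'p] xp]; apply: IH; exists q' => //.
  by have [_ sp] := ch_sub _ _ q'p; exact: sp.
have decay j i q : gen i q ->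
    (mu (G (i + j)%N `&` dcubeq q) <= (vol q / 2 ^+ j)%:E)%E.
  elim: j i q => [|j IH] i q gq.
    by rewrite expr0 divr1; apply: (le_trans (measureIr mu (mG _) (mdq q))); rewrite [leLHS]mu_dcube.
  have sub : G (i + j.+1)%N `&` dcubeq q `<=`
      \bigcup_(p in ch q) (G (i.+1 + j)%N `&` dcubeq p).
    rewrite addnS => x [Gx xq]; have [p qp xp] := descend _ _ _ _ gq xq Gx.
    by exists p => //; rewrite addSn.
  have mGI p : measurable (G (i.+1 + j)%N `&` dcubeq p) by exact: measurableI.
  apply: (@le_trans _ _ (mu (\bigcup_(p in ch q) (G (i.+1 + j)%N `&` dcubeq p)))).
    apply: le_measure; rewrite ?inE//; first exact: measurableI.
    exact: bigcup_measurable_countable.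
  apply: measure_bigcup_le => // s sS.
  have -> : \big[setU/set0]_(p <- s) (G (i.+1 + j)%N `&` dcubeq p) =
            \big[setU/set0]_(p <- undup s) (G (i.+1 + j)%N `&` dcubeq p).
    by apply/seteqP; split => x /bigcup_seqE[p ps xp]; apply/bigcup_seqE; exists p;
      rewrite ?mem_undup in ps *.
  apply: (le_trans (measure_bigsetU_le _ _ mGI)).
  apply: (@le_trans _ _ (\sum_(p <- undup s) (vol p / 2 ^+ j)%:E)%E).
    rewrite big_seq [leRHS]big_seq; apply: lee_sum => p; rewrite mem_undup => /sS qp.
    by apply: IH; exists q.
  rewrite sumEFin lee_fin -mulr_suml exprS invfM mulrA ler_pM2r ?invr_gt0 ?exprn_gt0//.
  by apply: ch_vol; [exact: undup_uniq|move=> p; rewrite mem_undup; exact: sS].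
have leave : {ae mu, forall x, exists i, ~ G i x}.
  exists (\bigcap_i G i); split; first exact: bigcap_measurable.
    have mGG : measurable (\bigcap_i G i) by exact: bigcap_measurable.
    have -> : \bigcap_i G i = \bigcup_(q in F0) ((\bigcap_i G i) `&` dcubeq q).
      apply/seteqP; split => x; last by move=> [q _ []].
      by move=> Gx; have [q Fq xq] := F0_cover x; exists q.
    apply: measure_bigcup0 => [q|q Fq]; first exact: measurableI.
    apply: le0_small => // d d0.
    have [j hj] : exists j : nat, vol q / 2 ^+ j <= d.
      exists (Num.trunc (vol q / d)).+1.
      rewrite ler_pdivrMr ?exprn_gt0// mulrC -ler_pdivrMr//.
      apply: le_trans (ltW (truncnS_gt _)) _.
      by rewrite -natrX ler_nat ltnW// ltn_expl.
    apply: (@le_trans _ _ (vol q / 2 ^+ j)%:E); last by rewrite lee_fin.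
    apply: le_trans (decay j 0%N q Fq); apply: le_measure; rewrite ?inE.
    - exact: measurableI.
    - exact: measurableI.
    - by move=> x [Gx xq]; split => //; exact: Gx.
  move=> x /= h i _; apply: contrapT => nG; apply: h; by exists i.
pose F := \bigcup_i gen i.
pose E q := dcubeq q `\` \bigcup_(p in ch q) dcubeq p.
have mch q : measurable (\bigcup_(p in ch q) dcubeq p).
  exact: bigcup_measurable_countable.
exists F, E; split.
- move=> q _; split; [exact: measurableD|by move=> x []|].
  have much : (mu (\bigcup_(p in ch q) dcubeq p) <= (vol q / 2)%:E)%E.
    apply: measure_bigcup_le => // s sS.
    have -> : \big[setU/set0]_(p <- s) dcubeq p = \big[setU/set0]_(p <- undup s) dcubeq p.
      by apply/seteqP; split => x /bigcup_seqE[p ps xp]; apply/bigcup_seqE; exists p;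
        rewrite ?mem_undup in ps *.
    apply: (le_trans (measure_bigsetU_le _ _ mdq)).
    rewrite (eq_bigr (fun p => (vol p)%:E)); last by move=> p _; exact: mu_dcube.
    rewrite sumEFin lee_fin.
    by apply: ch_vol; [exact: undup_uniq|move=> p; rewrite mem_undup; exact: sS].
  have mEq : measurable (E q) by exact: measurableD.
  have : (mu (dcubeq q) <= mu (E q) + mu (\bigcup_(p in ch q) dcubeq p))%E.
    apply: le_trans (measureU2 _ mEq (mch q)); apply: le_measure; rewrite ?inE//.
      exact: measurableU.
    move=> x xq; have [xc|nxc] := pselect ((\bigcup_(p in ch q) dcubeq p) x); first by right.
    by left.
  rewrite [X in (X <= _)%E -> _]mu_dcube.
  move=> /le_trans /(_ (leeD2l _ much)).
  case: (mu (E q)) (measure_ge0 mu (E q)) => [r r0 h|_ _|]//; last by rewrite leey.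
  by move: h; rewrite -EFinD !lee_fin -lerBlDr {1}[vol q]splitr addrK.
- have key i j q p x : gen i q -> gen (i + j)%N p -> E q x -> E p x -> q = p.
    case: j => [|j] gq gp [xq nq] [xp _].
      by rewrite addn0 in gp; exact: gen_disj gq gp xq xp.
    exfalso; apply: nq; rewrite addnS in gp.
    by have [p' qp' xp'] := descend i j q x gq xq (ex_intro2 _ _ p gp xp); exists p'.
  move=> q p x [i _ gq] [j _ gp] Eq Ep.
  have [ij|/ltnW ij] := leqP i j.
    have gp' : gen (i + (j - i))%N p by rewrite subnKC.
    exact: (key _ _ _ _ _ gq gp' Eq Ep).
  have gq' : gen (j + (i - j))%N q by rewrite subnKC.
  by apply/esym; exact: (key _ _ _ _ _ gp gq' Ep Eq).
- have steps : {ae mu, forall x, forall q, dcubeq q x ->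
      ((forall p, ch q p -> ~ dcubeq p x) -> `|cmq q x| <= lbound q x) /\
      (forall p, ch q p -> dcubeq p x -> `|cmq q x| <= lbound q x + `|cmq p x|)}.
    by apply: ae_forall_countable => q; have [_ _ _] := hch q.
  move: leave steps; apply: filterS2 => x [i nGi] hx.
  (* x has left the family after at most j further generations. *)
  have chain j i' q : gen i' q -> dcubeq q x -> ~ G (i' + j).+1 x ->
      exists s : seq idxT, [/\ uniq s,
        forall p, p \in s -> [/\ F p, dcubeq p x & p.1 <= q.1] &
        `|cmq q x| <= \sum_(p <- s) lbound p x].
    elim: j i' q => [|j IH] i' q gq xq nG; have [stop step] := hx _ xq.
      exists [:: q]; split => //.
        by move=> p; rewrite inE => /eqP ->; split => //; exists i'.
      rewrite big_seq1; apply: stop => p qp xp; apply: nG; rewrite addn0.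
      by exists p => //; exists q.
    have [[p [qp xp]]|np] := pselect (exists p, ch q p /\ dcubeq p x); last first.
      exists [:: q]; split => //.
        by move=> p; rewrite inE => /eqP ->; split => //; exists i'.
      by rewrite big_seq1; apply: stop => p qp xp; apply: np; exists p.
    have gp : gen i'.+1 p by exists q.
    have [|s [us sF hs]] := IH _ _ gp xp; first by rewrite addSn -addnS.
    have [lt _] := ch_sub _ _ qp.
    exists (q :: s); split.
    + rewrite /= us andbT; apply/negP => /sF[_ _].
      by rewrite leNgt lt.
    + move=> p'; rewrite inE => /predU1P[->|/sF[Fp' xp' pp']]; first by split => //; exists i'.
      by split => //; apply: (le_trans pp'); exact: ltW.
    + rewrite big_cons; apply: (le_trans (step _ qp xp)).
      by rewrite lerD2l.
  have [q Fq xq] := F0_cover x.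
  have nG' : ~ G (0 + i).+1 x.
    rewrite add0n => -[p [q' gq' q'p] xp]; apply: nGi; exists q' => //.
    by have [_ sp] := ch_sub _ _ q'p; exact: sp.
  have [s [us sF hs]] := chain i 0%N q Fq xq nG'.
  exists s; split => //; first by move=> p /sF[].
  have e : cutoff (tcubeq q) f = f.
    apply/funext => y; have [ty|nty] := pselect (tcubeq q y); first exact: cutoff_in.
    rewrite cutoff_out//; apply/esym/eqP/negPn/negP => fy.
    by apply: nty; exact: F0_supp Fq fy.
  by rewrite e in hs.
Qed.

End recursion.

(** * A starting partition adapted to the support *)

Section exhaustion.
Context {R : realType} {n : nat}.
Implicit Types (k : int) (x y : 'rV[R]_n).
Local Notation idxT := (int * {ffun 'I_n -> int})%type.
Local Notation dcubeq q := (@dcube R n q.1 q.2).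
Local Notation tcubeq q := (@tcube R n q.1 q.2).
Local Notation id0 k := (idx k (0 : 'rV[R]_n)).

(** The cube of generation k0 around the origin, and for each later generation
the siblings of the cube around the origin.  If the support lies in the
initial cube, every triple of the family contains it: the triple of a sibling
covers the common parent. *)
Definition tower k0 : set idxT :=
  [set q | q = (k0, id0 k0) \/ exists j : nat, [/\ q.1 = k0 + j%:Z,
     q.2 != id0 q.1 & exists2 x, dcubeq q x & idx (q.1 + 1) x = id0 (q.1 + 1)]].

Lemma tower_parent k0 q x : tower k0 q -> dcubeq q x ->
  idx (q.1 + 1) x = id0 (q.1 + 1).
Proof.
move=> [->/dcubeP/= e|[j [_ _ [y /dcubeP ye <-]]] /dcubeP xe].
  by rewrite (idx_anc 1 e).
by rewrite (@idx_anc _ _ _ x y 1)// xe ye.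
Qed.

Lemma tower_disj k0 q p x : tower k0 q -> tower k0 p ->
  dcubeq q x -> dcubeq p x -> q = p.
Proof.
suff key q' p' (i j : nat) : tower k0 q' -> dcubeq q' x -> dcubeq p' x ->
    q'.1 = k0 + i%:Z -> p'.1 = k0 + j%:Z -> p'.2 != id0 p'.1 -> (j <= i)%N.
  have same q' p' : dcubeq q' x -> dcubeq p' x -> q'.1 = p'.1 -> q' = p'.
    by case: q' p' => [k m] [k' m'] /dcubeP/= <- /dcubeP/= <- <-.
  move=> tq tp xq xp; move: (tq) (tp) => [eq0|[i [qi nq _]]] [ep0|[j [pj np _]]].
  - by rewrite eq0 ep0.
  - have q0 : q.1 = k0 + 0%:Z by rewrite eq0/= addr0.
    have := key q p 0%N j tq xq xp q0 pj np; rewrite leqn0 => /eqP j0.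
    by apply: same => //; rewrite q0 pj j0.
  - have p0 : p.1 = k0 + 0%:Z by rewrite ep0/= addr0.
    have := key p q 0%N i tp xp xq p0 qi nq; rewrite leqn0 => /eqP i0.
    by apply: same => //; rewrite p0 qi i0.
  - apply: same => //; rewrite qi pj; congr (_ + _%:Z); apply/eqP.
    by rewrite eqn_leq (key p q j i)// (key q p i j).
move=> tq xq xp qi pj np; rewrite leqNgt; apply/negP => ij.
move: np; move/dcubeP : (xp) => <-; apply/negP/negPn/eqP.
have := idx_anc (j - i.+1) (tower_parent tq xq).
suff -> : q'.1 + 1 + (j - i.+1)%N%:Z = p'.1 by [].
by rewrite qi pj; clear -ij; lia.
Qed.

Lemma tower_cover k0 x : exists2 q, tower k0 q & dcubeq q x.
Proof.
have ex : exists j : nat, idx (k0 + j%:Z) x == id0 (k0 + j%:Z).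
  have [k1 h] := idx_cofinal x 0; exists `|k1 - k0|%N; apply/eqP/h; lia.
case: (ex_minnP ex) => -[|j] /eqP e h.
  exists (k0, id0 k0); first by left.
  by apply/dcubeP; move: e; rewrite /= addr0.
exists (k0 + j%:Z, idx (k0 + j%:Z) x); last exact: dcube_idx.
right; exists j; split => //=.
  by apply/negP => /h; rewrite ltnn.
exists x; first exact: dcube_idx.
by have <- : k0 + j.+1%:Z = k0 + j%:Z + 1 by lia.
Qed.

Lemma tower_supp k0 q y : idx k0 y = id0 k0 -> tower k0 q -> tcubeq q y.
Proof.
move=> ey [->|[j [qj nq [x /dcubeP xe ex]]]].
  by apply/tcubeP => i; rewrite ey/=; lia.
rewrite -xe; apply: sibling_tcube; rewrite ex qj -addrA.
by have := idx_anc (j + 1) ey; rewrite PoszD => ->.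
Qed.

Lemma compact_in_dcube (A : set 'rV[R]_n) : compact A ->
  exists k0, forall y, A y -> idx k0 y = id0 k0.
Proof.
move=> /compact_bounded[M [_ hM]].
have [k0 h] := exists_side (Num.max (M + 1) 0).
exists k0 => y Ay; have /ltW := h k0 (lexx _); rewrite ge_max => /andP[_ s0].
apply/ffunP => i; rewrite !idx_near0//.
- by rewrite mxE normr0; apply: le_lt_trans (h k0 (lexx _)); rewrite le_max lexx orbT.
- apply: le_lt_trans (h k0 (lexx _)); rewrite le_max; apply/orP; left.
  apply: le_trans (norm_coord _ _) _; apply: hM => //; by rewrite ltrDl.
Qed.

End exhaustion.

Section integrability.
Context {R : realType} {n : nat}.
Local Notation mu := (lebesgue_rV R n).
Local Notation intL1 h := (mu.-integrable setT (EFin \o h)).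
Implicit Types f g : 'rV[R]_n -> R.

Lemma closed_measurable_rV (A : set 'rV[R]_n) : closed A -> measurable A.
Proof.
move=> cA; rewrite -[A]setCK; apply: measurableC; apply: open_measurable_rV.
exact: closed_openC.
Qed.

Lemma Lfun_oo_ae f : f \in Lfun mu +oo%E ->
  exists M : R, {ae mu, forall x, `|f x| <= M}.
Proof.
rewrite inE => /andP[_]; rewrite inE/= /finite_norm unlock.
have mu0 : (0 < mu setT)%E.
  apply: (@lt_le_trans _ _ (mu (dcube 0 [ffun=> 0]))).
    by rewrite mu_dcube lte_fin exprn_gt0// side_gt0.
  by apply: le_measure; rewrite ?inE//; exact: measurable_grid_cube.
rewrite mu0 => h; exists (fine (ess_sup mu (abse \o (EFin \o f)))).
have := ess_sup_ge mu (abse \o (EFin \o f)).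
apply: filterS => x /=; move: h.
case: (ess_sup _ _) => [r| |]//.
Qed.

Lemma integrable_locally_bounded g f : locally_integrable_rV g ->
  f \in Lfun mu +oo%E -> compact (supp f) -> intL1 (fun y => g y * f y).
Proof.
move=> [mg ig] hf cf.
have mf : measurable_fun setT f by exact: L2_measurable hf.
have mgf : measurable_fun setT (fun y => g y * f y) by exact: measurable_funM.
have [M hM] := Lfun_oo_ae hf.
have mS : measurable (supp f).
  by apply: closed_measurable_rV; exact: closed_closure.
have mag : measurable_fun (supp f) (fun x => `|g x|%:E).
  by apply/measurable_EFinP; apply: measurable_funS (measurableT_comp _ mg).
apply/integrable_mass; split => //.
apply: (@le_lt_trans _ _ (\int[mu]_(x in supp f) (`|M|%:E * `|g x|%:E))%E); last first.
  rewrite ge0_integralZl//; apply: lte_mul_pinfty => //; exact: ig.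
rewrite /mass [leRHS]integral_mkcond.
apply: ae_ge0_le_integral => //.
- by move=> x _; rewrite lee_fin normr_ge0.
- by apply/measurable_EFinP; exact: measurableT_comp.
- by move=> x _; apply: erestrict_ge0 => y _; rewrite -EFinM lee_fin mulr_ge0.
- apply/(measurable_restrictT _ mS); apply: emeasurable_funM => //.
- move: hM; apply: filterS => x hx _; rewrite patchE.
  have [Sx|nS] := boolP (x \in supp f).
    rewrite -EFinM lee_fin /absf normrM mulrC; apply: ler_wpM2r => //.
    by apply: le_trans hx (ler_norm _).
  rewrite /absf lee_fin normr_le0 mulf_eq0; apply/orP; right.
  apply/negPn/negP => fx; move: nS; rewrite notin_setE; apply.
  exact: subset_closure.
Qed.

Lemma locally_integrable1 : locally_integrable_rV (fun _ : 'rV[R]_n => 1 : R).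
Proof.
split=> // A cA; have [k0 hk] := compact_in_dcube cA.
have cl : closed A := compact_closed (@norm_hausdorff R 'rV[R]_n) cA.
have mA : measurable (A : set 'rV[R]_n).
  exact: closed_measurable_rV cl.
under eq_integral do rewrite normr1.
rewrite integral_cst// mul1e.
apply: (@le_lt_trans _ _ (mu (dcube k0 (idx k0 (0 : 'rV[R]_n))))).
  apply: le_measure; rewrite ?inE; [exact: mA|exact: measurable_grid_cube|].
  by move=> y /hk e; apply/dcubeP.
by rewrite mu_dcube ltry.
Qed.

End integrability.

(** * From the grid to the sparse operators *)

Lemma sum_le_esum {R : realType} (I : eqType) (T : choiceType) (S : set T)
    (a : T -> \bar R) (g : I -> T) (s : seq I) : uniq s ->
  {in s &, injective g} -> (forall i, i \in s -> S (g i)) ->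
  (\sum_(i <- s) a (g i) <= \esum_(t in S) a t)%E.
Proof.
move=> us gi gS; have ug : uniq (map g s) by rewrite map_inj_in_uniq.
rewrite -(big_map g xpredT a) fsbig_seq//; apply: esum_ge.
exists [set` map g s] => //; split; first exact: finite_seq.
by move=> _ /= /mapP[i si ->]; exact: gS.
Qed.

Lemma sparse_const_gt0 {R : realType} {n : nat} : 0 < @sparse_const R n.
Proof.
apply: mulr_gt0; first exact: exprn_gt0.
have p0 : (0 : R) < 3 ^+ n by exact: exprn_gt0.
by rewrite /tail_const addr_gt0// mulr_gt0// addr_gt0// mulr_gt0.
Qed.

Section lattice_families.
Context {R : realType} {n : nat} (n0 : (0 < n)%N).
Local Notation mu := (lebesgue_rV R n).
Local Notation idxT := (int * {ffun 'I_n -> int})%type.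
Local Notation dcubeq q := (@dcube R n q.1 q.2).
Local Notation tcubeq q := (@tcube R n q.1 q.2).
Local Notation vol q := (@side R q.1 ^+ n).

Definition tclass j (q : idxT) := mod3_class j q.1 [ffun i => q.2 i - 1].

Definition tfamily (F : set idxT) (j : {ffun 'I_n -> 'I_3}) : set (set 'rV[R]_n) :=
  [set Q | exists q, [/\ F q, tclass j q & Q = tcubeq q]].

Lemma tfamily_sub F j : tfamily F j `<=` tlattice j.
Proof. by move=> Q [q [_ jq ->]]; exact: tcube_tlattice. Qed.

Lemma tcubeq_inj : injective (fun q : idxT => tcubeq q).
Proof. by move=> [k m] [k' m'] /(tcube_inj n0)/= [-> ->]. Qed.

Lemma dcube_tcube (q : idxT) : dcubeq q `<=` tcubeq q.
Proof. by move=> x /dcubeP e; apply/tcubeP => i; rewrite e; lia. Qed.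

(** The set E q attached to a cube fills half of it, hence 1 / (2 3 ^ n) of its
triple. *)
Lemma sparse_tfamily (F : set idxT) (E : idxT -> set 'rV[R]_n) j :
  (forall q, F q -> [/\ measurable (E q), E q `<=` dcubeq q &
    ((vol q / 2)%:E <= mu (E q))%E]) ->
  (forall q p x, F q -> F p -> E q x -> E p x -> q = p) ->
  sparse (2 * 9 ^+ n)^-1 (tfamily F j).
Proof.
move=> hE dE; pose E' Q := \bigcup_(q in [set q | F q /\ Q = tcubeq q]) E q.
have E'E q : F q -> E' (tcubeq q) = E q.
  move=> Fq; apply/seteqP; split => x; last by move=> ?; exists q.
  by move=> [p [Fp /tcubeq_inj <-]].
exists E'; split.
  move=> _ [q [Fq _ ->]]; rewrite (E'E _ Fq); have [mE sE vE] := hE q Fq.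
  split => //; first by apply: subset_trans sE _; exact: dcube_tcube.
  apply: le_trans vE; rewrite [X in (_ * X)%E]mu_tcube -EFinM lee_fin exprMn.
  have -> : (9 : R) = 3 * 3 by ring.
  have p3 : (1 : R) <= 3 ^+ n by rewrite exprn_ege1// ler1n.
  have v0 : 0 <= vol q by rewrite exprn_ge0// side_ge0.
  rewrite exprMn; set p := 3 ^+ n in p3 *.
  have -> : (2 * (p * p))^-1 * (p * vol q) = vol q / 2 / p by field; lra.
  by rewrite ler_pdivrMr; [rewrite ler_peMr// mulr_ge0|lra].
apply/trivIsetP => _ _ [q [Fq _ ->]] [p [Fp _ ->]] neq; apply/seteqP; split => // x [xq xp].
rewrite (E'E _ Fq) in xq; rewrite (E'E _ Fp) in xp.
by move/eqP : neq; apply; rewrite (dE q p x Fq Fp xq xp).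
Qed.

Variables (b f : 'rV[R]_n -> R).
Local Notation avb q := (average b (tcubeq q)).
Local Notation af := (fun y => `|f y|).

(** Each grid cube is assigned to the lattice of its triple, and a finite sum
over cubes containing x is split among the 3 ^ n lattices. *)
Lemma local_bound_sparse_ops (F : set idxT) (C : R) x (s : seq idxT) : 0 <= C ->
  uniq s -> (forall q, q \in s -> F q /\ dcubeq q x) ->
  ((\sum_(q <- s) local_bound C f b (avb q) q.1 q.2 x)%:E <=
   (3 ^+ n * @sparse_const R n * C)%:E *
   \sum_j (sparse_op (tfamily F j) b af x + sparse_op_star (tfamily F j) b af x))%E.
Proof.
move=> C0 us hs.
pose a (Q : set 'rV[R]_n) := (`|b x - average b Q| * average af Q * \1_Q x)%:E.
pose a' (Q : set 'rV[R]_n) :=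
  (average (fun y => (`|b y - average b Q| * `|f y|)%R) Q * \1_Q x)%:E.
have /choice[J hJ] := fun q : idxT => exists_mod3_class q.1 [ffun i => q.2 i - 1].
have term q : q \in s -> (local_bound C f b (avb q) q.1 q.2 x)%:E =
    ((3 ^+ n * @sparse_const R n * C)%:E * (a (tcubeq q) + a' (tcubeq q)))%E.
  move=> /hs[_ /dcube_tcube xq].
  rewrite /a /a' indicE mem_set// !mulr1 -EFinD -EFinM; congr EFin.
  have avgE h : average h (tcubeq q) =
      (\int[mu]_(y in tcubeq q) h y) / (3 ^+ n * vol q).
    by rewrite /average mu_tcube /= exprMn.
  rewrite /local_bound (avgE af) (avgE (fun y => `|b y - avb q| * `|f y|)).
  have -> : \int[mu]_(y in tcubeq q) `|f y| = fmass f q.1 q.2 by [].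
  have -> : \int[mu]_(y in tcubeq q) (`|b y - avb q| * `|f y|) =
      oscmass f b (avb q) q.1 q.2.
    rewrite /oscmass /mass /Rintegral; congr fine; apply: eq_integral => y _.
    by rewrite /absf normrM.
  have v0 : vol q != 0 by rewrite gt_eqF// exprn_gt0// side_gt0.
  have p0 : (3 : R) ^+ n != 0 by rewrite expf_neq0// pnatr_eq0.
  by field; exact/andP.
have c0 : 0 <= 3 ^+ n * @sparse_const R n * C.
  rewrite mulr_ge0// mulr_ge0 ?exprn_ge0//; exact: ltW sparse_const_gt0.
have avg0 (h : 'rV[R]_n -> R) Q : (forall y, 0 <= h y) -> 0 <= average h Q.
  by move=> h0; apply: divr_ge0; [exact: Rintegral_ge0|rewrite fine_ge0].
have a0 Q : (0 <= a Q)%E 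
  by rewrite lee_fin; apply: mulr_ge0; rewrite ?indicE//; apply: mulr_ge0 => //; exact: avg0.
have a'0 Q : (0 <= a' Q)%E.
  rewrite lee_fin; apply: mulr_ge0; rewrite ?indicE//; apply: avg0 => y.
  by rewrite mulr_ge0.
rewrite -sumEFin (eq_big_seq _ term) -ge0_sume_distrr; last first.
  by move=> q _; rewrite adde_ge0.
apply: lee_wpmul2l; first by rewrite lee_fin.
rewrite (eq_bigr (fun q => (\sum_(j | J q == j) (a (tcubeq q) + a' (tcubeq q)))%E)); last first.
  by move=> q _; rewrite (big_pred1 (J q))// => j; rewrite eq_sym.
rewrite (exchange_big_dep xpredT)//=.
apply: lee_sum => j _; rewrite -big_filter big_split/=.
have jS q : q \in [seq q <- s | J q == j] -> tfamily F j (tcubeq q).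
  rewrite mem_filter => /andP[/eqP <- /hs[Fq _]].
  by exists q; split => //; exact: hJ.
have inj : {in [seq q <- s | J q == j] &, injective (fun q : idxT => tcubeq q)}.
  by move=> q p _ _; exact: tcubeq_inj.
apply: leeD.
  by have := sum_le_esum a (filter_uniq _ us) inj jS.
by have := sum_le_esum a' (filter_uniq _ us) inj jS.
Qed.

End lattice_families.

Section operator_norm.
Context {R : realType} {n : nat}.

Lemma opnorm_L2_fin (T : ('rV[R]_n -> R) -> 'rV[R]_n -> R) :
  bounded_linear_L2 T -> opnorm_L2 T \is a fin_num.
Proof.
move=> [TL2 Tlin [B hB]].
have up : (opnorm_L2 T <= `|B|%:E)%E.
  apply: ub_ereal_sup => _ [g [g2 g1] <-]; apply: le_trans (hB g g2) _.
  apply: (@le_trans _ _ (`|B|%:E * 'N[lebesgue_rV R n]_2%:E[EFin \o g])%E).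
    by apply: lee_wpmul2r; rewrite ?Lnorm_ge0// lee_fin ler_norm.
  by rewrite -[leRHS]mule1; apply: lee_wpmul2l.
rewrite ge0_fin_numE ?opnorm_L2_ge0//; exact: le_lt_trans up (ltry _).
Qed.

End operator_norm.

Theorem theorem1p1 (R : realType) (n : nat) (n_gt0 : (0 < n)%N) :
  exists c : R, 0 < c /\
  forall (omega : R -> R) (CK : R) (K : 'rV[R]_n -> 'rV[R]_n -> R)
    (T : ('rV[R]_n -> R) -> 'rV[R]_n -> R) (b : 'rV[R]_n -> R),
  modulus_of_continuity omega -> (dini omega < +oo)%E ->
  cz_operator omega CK K T -> locally_integrable_rV b ->
  forall f : 'rV[R]_n -> R,
  f \in Lfun (lebesgue_rV R n) +oo%E -> compact (supp f) ->
  exists (D S : 'I_(3 ^ n) -> set (set 'rV[R]_n)),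
    (forall j, [/\ dyadic_lattice (D j), S j `<=` D j &
       sparse (2 * 9 ^+ n)^-1 (S j)]) /\
    {ae lebesgue_rV R n, forall x,
      (`|commutator b (L1_extension T) f x|%:E <=
       c%:E * cz_constant omega CK T *
       \sum_(j < 3 ^ n) (sparse_op (S j) b (fun y => `|f y|%R) x +
                         sparse_op_star (S j) b (fun y => `|f y|%R) x))%E}.
Proof.
have cT_gt0 : 0 < @weak_const R n + @osc_const R n.
  apply: ltr_wpDl; first exact: weak_const_ge0.
  by apply: mulr_gt0 => //; apply: exprn_gt0; apply: mulr_gt0 => //; exact: exprn_gt0.
exists (3 ^+ n * @sparse_const R n * (@weak_const R n + @osc_const R n)); split.
  by apply: mulr_gt0 => //; apply: mulr_gt0; [exact: exprn_gt0|exact: sparse_const_gt0].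
move=> omega CK K T b momega hdini hT lb f foo cf.
have hA : opnorm_L2 T \is a fin_num by case: hT => /opnorm_L2_fin.
have hD : dini omega \is a fin_num.
  rewrite ge0_fin_numE//; apply: integral_ge0 => t /=.
  rewrite in_itv/= => /andP[t0 t1]; rewrite lee_fin divr_ge0 ?(ltW t0)//.
  by have [_ _ _ _ ->//] := momega; rewrite in_itv/= t1 (ltW t0).
have W : weak_osc (L1_extension T)
    ((@weak_const R n + @osc_const R n) * (fine (opnorm_L2 T) + CK + fine (dini omega))).
  by apply: (cz_weak_osc n_gt0 momega _ hT); rewrite fineK.
have fi : (lebesgue_rV R n).-integrable setT (EFin \o f).
  have := integrable_locally_bounded (@locally_integrable1 R n) foo cf.
  by congr (integrable _ _ _); apply/funext => y /=; rewrite mul1r.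
have bfi := integrable_locally_bounded lb foo cf.
have [k0 hk0] := compact_in_dcube cf.
have supp0 q y : @tower R n k0 q -> f y != 0 -> @tcube R n q.1 q.2 y.
  move=> tq fy; have yf : supp f y by exact: subset_closure.
  exact: tower_supp (hk0 y yf) tq.
have [F [E [hE dE hF]]] := sparse_family n_gt0 W
  (fun q => average b (@tcube R n q.1 q.2)) fi bfi (@tower_disj R n k0)
  (@tower_cover R n k0) supp0.
have card3 : #|{ffun 'I_n -> 'I_3}| = (3 ^ n)%N by rewrite card_ffun !card_ord.
pose J (j : 'I_(3 ^ n)) : {ffun 'I_n -> 'I_3} := enum_val (cast_ord (esym card3) j).
exists (fun j => tlattice (J j)), (fun j => tfamily F (J j)); split.
  move=> j; split; first exact: dyadic_lattice_tlattice.
    exact: tfamily_sub.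
  exact: sparse_tfamily hE dE.
move: hF; apply: filterS => x [s [us hs]] hx.
apply: (le_trans (_ : _ <= (_ : R)%:E)%E); first by rewrite lee_fin; exact: hx.
apply: (le_trans (local_bound_sparse_ops n_gt0 b f (wo_ge0 W) us hs)).
have -> : cz_constant omega CK T = (fine (opnorm_L2 T) + CK + fine (dini omega))%:E.
  by rewrite /cz_constant !EFinD !fineK.
rewrite -EFinM -!mulrA; set S := (X in (_ * X <= _)%E); set S' := (X in (_ <= _ * X)%E).
suff -> : S = S' by [].
rewrite /S /S' (reindex J)//=.
exists (fun p => cast_ord card3 (enum_rank p)) => p _; rewrite /J.
  by rewrite enum_valK cast_ordKV.
by rewrite cast_ordK enum_rankK.
Qed.
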